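(* Let $(B_{1,t})_{t\ge0}$ and $(B_{2,t})_{t\ge0}$ be two independent (standard one-dimensional) Brownian motions, and let $\mathcal{E}_0,\mathcal{E}_1,\mathcal{E}_2$ be non-negative random variables (not necessarily independent of each other) that are independent of $(B_{1,t})_{t\ge0}$ and $(B_{2,t})_{t\ge0}$, with $\mathbb{E}[\mathcal{E}_0]<\infty$. In addition, for each $i\in\{1,2\}$ let $m_i,\gamma_i>0$ and $\mathcal{I}_i:[0,\infty)\to[0,\infty)$ be such that $c_{\gamma_i}(m_i;\mathcal{I}_i)<\infty$ and $\mathcal{I}_i(0)=0$. Then the following statements hold. (1) For all $\lambda_1,\lambda_2>0$, $$\mathbb{E}\left[\mathcal{E}_0\int_0^\infty\mathcal{I}_1\big(\lambda_1\mathcal{E}_1e^{\gamma_1(B_{1,t}-m_1t)}\big)dt\right]\le\pi c_{\gamma_1}(m_1;\mathcal{I}_1)\,\mathbb{E}[\mathcal{E}_0]$$ and $$\mathbb{E}\left[\mathcal{E}_0\prod_{i=1}^2\left(\int_0^\infty\mathcal{I}_i\big(\lambda_i\mathcal{E}_ie^{\gamma_i(B_{i,t}-m_it)}\big)dt\right)\right]\le\left[\prod_{i=1}^2\pi c_{\gamma_i}(m_i;\mathcal{I}_i)\right]\mathbb{E}[\mathcal{E}_0].$$ (2) We have $$\lim_{\lambda_1\to\infty}\mathbb{E}\left[\mathcal{E}_0\int_0^\infty\mathcal{I}_1\big(\lambda_1\mathcal{E}_1e^{\gamma_1(B_{1,t}-m_1t)}\big)dt\right]=\pi c_{\gamma_1}(m_1;\mathcal{I}_1)\,\mathbb{E}[\mathcal{E}_0]$$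 and $$\lim_{\lambda_1,\lambda_2\to\infty}\mathbb{E}\left[\mathcal{E}_0\prod_{i=1}^2\left(\int_0^\infty\mathcal{I}_i\big(\lambda_i\mathcal{E}_ie^{\gamma_i(B_{i,t}-m_it)}\big)dt\right)\right]=\left[\prod_{i=1}^2\pi c_{\gamma_i}(m_i;\mathcal{I}_i)\right]\mathbb{E}[\mathcal{E}_0].$$
   Context: For $\gamma,m>0$ and a function $f:[0,\infty)\to[0,\infty)$, $$c_\gamma(m;f):=\frac1\pi\left\{\mathbb{E}\left[\int_0^\infty f\big(e^{\gamma\mathcal{B}^m_t}\big)dt\right]+\mathbb{E}\left[\int_0^\infty f\big(e^{\gamma(B_t-mt)}\big)dt\right]\right\},$$ where $(B_t)_{t\ge0}$ is a standard one-dimensional Brownian motion and $(\mathcal{B}^m_t)_{t\ge0}$ is a Brownian motion with drift $m$ (started from $0$) conditioned to be non-negative at all times $t\ge0$.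
   Formalization: The limits in (2) are proved assuming that a.s. E_1>0 (and E_2>0 for the joint limit) wherever E_0>0, since they fail e.g. for E_0=1, E_1=0; the I_i are taken Borel measurable. *)

(* Defs.v *)
From HB Require Import structures.
From mathcomp Require Import all_boot all_order all_algebra.
From mathcomp Require Import all_classical all_reals all_analysis.

Set Implicit Arguments.
Unset Strict Implicit.
Unset Printing Implicit Defensive.

Import Order.TTheory GRing.Theory Num.Theory.
Import numFieldNormedType.Exports.

Local Open Scope classical_set_scope.
Local Open Scope ring_scope.

Definition sigma_generated d (T : measurableType d) (R : realType)
    (F : set (T -> R)) : set (set T) :=
  <<s \bigcup_(f in F) preimage_set_system setT f measurable >>.

Definition independent_families d (T : measurableType d) (R : realType)
    (P : probability T R) (G H : set (set T)) : Prop :=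
  forall A B, G A -> H B -> P (A `&` B) = (P A * P B)%E.

(* Processes indexed by [0, +oo[ are represented by families indexed by R whose
   values at negative times are never used. *)
Definition sigma_process d (T : measurableType d) (R : realType)
    (P : probability T R) (J : set R) (X : R -> {RV P >-> R}) : set (set T) :=
  sigma_generated [set (X t : T -> R) | t in J].

Definition continuous_paths d (T : measurableType d) (R : realType)
    (P : probability T R) (X : R -> {RV P >-> R}) : Prop :=
  forall w, {within `[0, +oo[, continuous (fun t => X t w)}.

(* The second parameter of normal_prob is the standard deviation. *)
Definition brownian_motion d (T : measurableType d) (R : realType)
    (P : probability T R) (B : R -> {RV P >-> R}) : Prop :=
  [/\ {ae P, forall w, B 0 w = 0},
      continuous_paths B,
      forall s t, 0 <= s -> s < t -> forall A, measurable A ->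
        P ((B t \- B s) @^-1` A) = normal_prob 0 (Num.sqrt (t - s)) A &
      forall s t, 0 <= s -> s < t ->
        independent_families P
          (sigma_generated [set (B t \- B s : T -> R)])
          (sigma_process `[0, s] B)].

Definition cond_expectation d (T : measurableType d) (R : realType)
    (P : probability T R) (Y : T -> R) (A : set T) : R :=
  fine (\int[P]_(w in A) (Y w)%:E)%E / fine (P A).

Definition drift_ge d (T : measurableType d) (R : realType)
    (P : probability T R) (W : R -> {RV P >-> R}) (m e : R) : set T :=
  [set w | forall t, 0 <= t -> - e <= W t w + m * t].

(* X is a Brownian motion with drift m, started from 0, conditioned to be
   non-negative at all times.  A Brownian motion W with drift m > 0 started
   from 0 a.s. visits ]-oo, 0[, so the conditioning is, as usual, the limit as
   e -> 0+ of the conditioning on the event drift_ge W m e, which has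
   probability 1 - exp (- 2 m e) > 0.  The limit is in the sense of
   finite-dimensional distributions, which, with continuity of the paths,
   characterises the law of X. *)
Definition conditioned_nonneg d (T : measurableType d) (R : realType)
    (P : probability T R) d' (T' : measurableType d') (P' : probability T' R)
    (m : R) (W : R -> {RV P >-> R}) (X : R -> {RV P' >-> R}) : Prop :=
  [/\ {ae P', forall w, X 0 w = 0},
      continuous_paths X &
      forall (n : nat) (t : 'I_n -> R) (g : 'rV[R]_n -> R),
        (forall i, 0 <= t i) -> continuous g ->
        (exists M, forall x, `|g x| <= M) ->
        cond_expectation P (fun w => g (\row_i (W (t i) w + m * t i)))
          (drift_ge W m e) @[e --> 0^'+]
        --> fine (\int[P']_w (g (\row_i X (t i) w))%:E)%E].

(* c_gamma(m; f), computed from a Brownian motion W and a Brownian motion X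
   with drift m conditioned to be non-negative; the value depends only on the
   laws of these two processes. *)
Definition c_const d (T : measurableType d) (R : realType)
    (P : probability T R) d' (T' : measurableType d') (P' : probability T' R)
    (W : R -> {RV P >-> R}) (X : R -> {RV P' >-> R})
    (gamma m : R) (f : R -> R) : \bar R :=
  ((pi^-1)%:E *
   (\int[P']_w \int[lebesgue_measure]_(t in `[0%R, +oo[)
       (f (expR (gamma * X t w)))%:E +
    \int[P]_w \int[lebesgue_measure]_(t in `[0%R, +oo[)
       (f (expR (gamma * (W t w - m * t))))%:E))%E.

Definition exp_functional d (T : measurableType d) (R : realType)
    (P : probability T R) (B : R -> {RV P >-> R}) (gamma m : R) (f : R -> R)
    (a : R) (w : T) : \bar R :=
  (\int[lebesgue_measure]_(t in `[0%R, +oo[)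
     (f (a * expR (gamma * (B t w - m * t))))%:E)%E.

(* Main.v *)
Require Import Defs.
From HB Require Import structures.
From mathcomp Require Import all_boot all_order all_algebra.
From mathcomp Require Import all_classical all_reals all_analysis.
From mathcomp Require Import measurable_realfun.
From mathcomp Require Import ring lra.

Set Implicit Arguments.
Unset Strict Implicit.
Unset Printing Implicit Defensive.

Import Order.TTheory GRing.Theory Num.Theory.
Import numFieldNormedType.Exports.

Local Open Scope classical_set_scope.
Local Open Scope ring_scope.

(** Write [J a] for the exponential functional [exp_functional B gamma m I a] of a
    Brownian motion of drift [- m].  Everything rests on computing its expectation.
    By Tonelli's theorem this is an integral of [z |-> I (exp (gamma * z))] against
    an occupation density, and the occupation density at [z] of a Brownian motion
    of drift [- m] started from [y = ln a / gamma] is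
    [m^-1 * exp (- 2 m (z - y)^+)] ([integral_gden_green], [drifted_occupation]).
    This increases to the constant [m^-1] as [a] tends to infinity, so the
    expectation [mass] of [J a] increases to
    [total_mass = m^-1 * \int I (exp (gamma * z)) dz].

    The same number is [pi] times [c_const]: the second term of [c_const] is the
    expectation for [a = 1], and the occupation density at [z] of the motion
    conditioned to be nonnegative is [m^-1 * (1 - exp (- 2 m z^+))], exactly what is
    missing to make the density constant ([conditioned_occupation], [c_constE]).

    To get the latter density from the definition of the conditioned motion as a
    limit, one needs the law at time [t] of [x + B_t + m t] on the event that this
    process never becomes negative ([nonnegative_law]).  It is obtained from the
    reflection principle: for a test [k1] supported on the positive half-line, let
    [k2] be its image under the reflection at the origin that accounts for the
    drift.  Started from the origin, the process gives the same expectation to both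
    tests, hence optional stopping at the first zero shows that the paths that
    become negative contribute equally to both, while [k2] vanishes on the others
    ([stopped_le], [killed_test]).  Optional stopping is carried out on finer and
    finer grids, where the first negative position is close to the origin by
    continuity.  After time [t], the process stays nonnegative with probability
    [escape m z = 1 - exp (- 2 m z)], by the same formula with a horizon tending to
    infinity ([escape_law]).  Dividing by the probability [escape m e] of the
    conditioning and letting [e] tend to [0], the density at time [t] of the
    conditioned motion is [escape m z * (z / (m t))] times the Gaussian density
    ([conditioned_marginal]); the integral over time of [z / t] times this Gaussian
    density is the total mass of a first passage time law, which is [1]
    ([integral_first_passage]).

    Finally, by independence the functionals may be replaced by their expectations
    at the random starting points [l1 * E1] and [l2 * E2]
    ([integral_weighted_product]).  The bounds follow at once, and the limits
    follow from monotone convergence: the expectations at [(n, n)] are lower bounds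
    for those at all larger [(l1, l2)]. *)

(** * Integrals against densities and product laws *)

Section density.
Context d (T : measurableType d) (R : realType).
Variables (nu mu : {measure set T -> \bar R}) (rho : T -> R).
Hypothesis mrho : measurable_fun setT rho.
Hypothesis rho0 : forall x, 0 <= rho x.
Hypothesis nuE : forall A, measurable A ->
  nu A = (\int[mu]_(x in A) (rho x)%:E)%E.

Import HBNNSimple.

Let integral_density_nnsfun (f : {nnsfun T >-> R}) :
  (\int[nu]_x (f x)%:E = \int[mu]_x ((f x)%:E * (rho x)%:E))%E.
Proof.
under [LHS]eq_integral do rewrite fimfunE -fsumEFin//.
rewrite [LHS]ge0_integral_fsum//; last 2 first.
  - by move=> r; exact/measurable_EFinP/measurableT_comp.
  - by move=> n x _; rewrite EFinM nnfun_muleindic_ge0.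
under [RHS]eq_integral.
  move=> x xD; rewrite fimfunE -fsumEFin// ge0_mule_fsuml; last first.
    by move=> r; rewrite EFinM nnfun_muleindic_ge0.
  over.
rewrite [RHS]ge0_integral_fsum//; last 2 first.
  - move=> r; apply/measurable_EFinP.
    by apply: measurable_funM => //; apply/measurableT_comp.
  - move=> n x _; apply: mule_ge0; last by rewrite lee_fin.
    by rewrite EFinM nnfun_muleindic_ge0.
apply: eq_fsbigr => r _.
rewrite integralZl_indic_nnsfun// integral_indic// setIT nuE//.
have [r0|r0] := ltP r 0.
  rewrite preimage_nnfun0// integral_set0 mule0 [RHS]integral0_eq// => x _.
  by rewrite indic0 /= mulr0 mul0e.
rewrite [X in (_ * X)%E]integral_mkcond -ge0_integralZl//=; last 2 first.
- apply/(measurable_restrictT _ _).1 => //.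
  by apply/measurable_EFinP/measurable_funTS.
- by move=> x _; rewrite patchE; case: ifPn => // _; rewrite lee_fin.
apply: eq_integral => x _; rewrite patchE indicE.
by case: ifPn => /= _; rewrite ?mulr1 ?mulr0 ?mul0e ?mule0.
Qed.

(** Approximate from below by simple functions, for which the claim is the
    definition of the density. *)
Lemma ge0_integral_density (f : T -> \bar R) :
  measurable_fun setT f -> (forall x, 0 <= f x)%E ->
  (\int[nu]_x f x = \int[mu]_x (f x * (rho x)%:E))%E.
Proof.
move=> mf f0; pose f_ := nnsfun_approx measurableT mf.
transitivity (lim (\int[nu]_x (f_ n x)%:E @[n --> \oo])%E).
  rewrite -monotone_convergence//=.
  - apply: eq_integral => ? /[!inE] xD; apply/esym/cvg_lim => //=.
    exact: cvg_nnsfun_approx.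
  - by move=> n; exact/measurable_EFinP/measurable_funTS.
  - by move=> n ? _; rewrite lee_fin.
  - by move=> ? _ ? ? mn; rewrite lee_fin; exact/lefP/nd_nnsfun_approx.
rewrite (_ : (fun n => _) =
  (fun n => \int[mu]_x ((f_ n x)%:E * (rho x)%:E))%E); last first.
  by apply/funext => n; exact: integral_density_nnsfun.
rewrite -monotone_convergence//=.
- apply: eq_integral => x _; apply/cvg_lim => //; apply: cvgeZr => //.
  exact: cvg_nnsfun_approx.
- move=> n; apply/measurable_EFinP/measurable_funM => //.
- by move=> n x _; rewrite lee_fin mulr_ge0.
- move=> x _ a b ab; rewrite lee_fin ler_wpM2r//.
  by exact/lefP/nd_nnsfun_approx.
Qed.

End density.

Lemma ge0_integral_translation (R : realType) (f : R -> \bar R) (c : R) :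
  measurable_fun setT f -> (forall x, 0 <= f x)%E ->
  (\int[lebesgue_measure]_x f (x + c)%R = \int[lebesgue_measure]_x f x)%E.
Proof.
move=> mf f0.
pose phi : measurableTypeR R -> measurableTypeR R := fun x : R => x + c.
have mphi : measurable_fun setT phi by apply: measurable_funD.
rewrite [LHS](_ : _ = \int[pushforward lebesgue_measure phi]_x f x)%E; last first.
  by rewrite ge0_integral_pushforward.
apply: eq_measure_integral => A mA _; apply/esym.
apply: lebesgue_measure_unique => // _ [[a b] _ <-].
rewrite [RHS](_ : _ = lebesgue_measure (phi @^-1` `]a, b]%classic))//.
rewrite (_ : phi @^-1` _ = `]a - c, b - c]%classic).
  rewrite !lebesgue_measure_itv /= !lte_fin ltrD2r; case: ifPn => // _.
  by rewrite -!EFinB; congr EFin; ring.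
by apply/seteqP; split => x /=; rewrite !in_itv /= ltrBlDr lerBrDr.
Qed.

Lemma ge0_integral_reflection (R : realType) (f : R -> \bar R) :
  measurable_fun setT f -> (forall x, 0 <= f x)%E ->
  (\int[lebesgue_measure]_x f (- x)%R = \int[lebesgue_measure]_x f x)%E.
Proof.
move=> mf f0.
rewrite [LHS](_ : _ =
  (\int[pushforward lebesgue_measure (-%R : _ -> measurableTypeR R)]_x f x)%E); last first.
  by rewrite ge0_integral_pushforward.
by apply: eq_measure_integral => A mA _; exact: lebesgue_measureN.
Qed.

Section independence.
Context d (T : measurableType d) (R : realType) (P : probability T R).
Context d1 (T1 : measurableType d1) d2 (T2 : measurableType d2).

(** The joint law of [U] and [V] agrees with the product of their laws on
    rectangles, hence everywhere; the rest is Tonelli's theorem. *)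
Lemma integral_independent (U : T -> T1) (V : T -> T2) (g : T1 * T2 -> \bar R) :
  measurable_fun setT U -> measurable_fun setT V ->
  (forall A B, measurable A -> measurable B ->
     P (U @^-1` A `&` V @^-1` B) = (P (U @^-1` A) * P (V @^-1` B))%E) ->
  measurable_fun setT g -> (forall x, 0 <= g x)%E ->
  (\int[P]_w g (U w, V w) = \int[P]_w \int[P]_v g (U w, V v))%E.
Proof.
move=> mU mV UV mg g0.
pose U' : {mfun T >-> T1} := HB.pack U (isMeasurableFun.Build _ _ _ _ _ mU).
pose V' : {mfun T >-> T2} := HB.pack V (isMeasurableFun.Build _ _ _ _ _ mV).
have mUV : measurable_fun setT (fun w => (U w, V w)) by exact: measurable_fun_pair.
pose UV' : {mfun T >-> (T1 * T2)%type} :=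
  HB.pack (fun w => (U w, V w)) (isMeasurableFun.Build _ _ _ _ _ mUV).
pose muU := distribution P U'; pose muV := distribution P V'.
transitivity (\int[distribution P UV']_x g x)%E.
  by rewrite ge0_integral_distribution.
transitivity (\int[(muU \x muV)%E]_x g x)%E.
  apply: eq_measure_integral => A mA _.
  by apply/esym; apply: product_measure_unique => // B C mB mC; exact: UV.
rewrite fubini_tonelli1// /fubini_F ge0_integral_distribution//=.
- by apply: eq_integral => w _; rewrite ge0_integral_distribution//; exact: measurableT_comp.
- exact: measurable_fun_fubini_tonelli_F.
- by move=> x; apply: integral_ge0.
Qed.
End independence.

(** * Joint measurability of continuous processes *)

(** Paths are only known to be continuous on the half-line; stopping the clock at
    the origin for negative times makes them continuous on the whole line. *)
Lemma continuous_max0 (R : realType) (f : R -> R) :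
  {within `[0, +oo[, continuous f} -> continuous (fun t : R => f (Num.max t 0)).
Proof.
move=> /subspace_continuousP cf t.
have A0 : `[0, +oo[%classic (Num.max t 0).
  by rewrite /= in_itv /= le_max lexx orbT.
have c0 : {for t, continuous (fun t : R => Num.max t 0)}.
  by apply: continuous_max; [exact: cvg_id|exact: cvg_cst].
move=> A /(cf _ A0) hA.
apply: (@filterS _ (nbhs t) _ _ _ _ (c0 _ hA)) => s; apply.
by rewrite /= in_itv /= le_max lexx orbT.
Qed.

Lemma floor_grid_cvg (R : realType) (t : R) :
  (fun n : nat => (Num.floor (n.+1%:R * t))%:~R / n.+1%:R) @ \oo --> t.
Proof.
have h1 : (fun n : nat => t - n.+1%:R^-1) @ \oo --> t.
  rewrite -[X in _ --> X]subr0; apply: cvgB; first exact: cvg_cst.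
  exact: (@cvg_harmonic R).
apply: (squeeze_cvgr _ h1 (cvg_cst t)).
apply: nearW => n; have n0 : 0 < n.+1%:R :> R by rewrite ltr0n.
rewrite ler_pdivrMr// [X in _ && X](_ : _ = true); last by rewrite mulrC floor_le.
rewrite andbT ler_pdivlMr// mulrBl mulVf ?gt_eqF// lerBlDr mulrC.
by rewrite -[X in _ + X]/(1%:~R) -intrD ltW// floorD1_gt.
Qed.

Lemma continuous_cvg_seq (R : realType) (f : R -> R) (u : nat -> R) (t : R) :
  {for t, continuous f} -> u n @[n --> \oo] --> t ->
  f (u n) @[n --> \oo] --> f t.
Proof. by move=> cf ut; apply: (@cvg_comp _ _ _ u f _ _ _ ut). Qed.

(** The process is the pointwise limit of its samplings at the multiples of
    [1 / (n + 1)], which are jointly measurable because they involve countably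
    many times. *)
Lemma measurable_continuous_process d (T : measurableType d) (R : realType)
    (X : R -> T -> R) :
  (forall t, measurable_fun setT (X t)) ->
  (forall w, continuous (fun t => X t w)) ->
  measurable_fun setT (fun p : R * T => X p.1 p.2).
Proof.
move=> mX cX.
pose h (n : nat) (p : R * T) := X ((Num.floor (n.+1%:R * p.1))%:~R / n.+1%:R) p.2.
apply: (@measurable_fun_cvg _ _ _ setT h) => [n|[t w] _]; last first.
  exact: (@continuous_cvg_seq _ (X^~ w) _ t (cX w t) (@floor_grid_cvg R t)).
move=> _ A mA; rewrite setTI.
rewrite (_ : h n @^-1` A = \bigcup_(k : int)
   ((fun t : R => Num.floor (n.+1%:R * t)) @^-1` [set k] `*`
    X (k%:~R / n.+1%:R) @^-1` A)); last first.
  apply/seteqP; split => [[t w] /= htw|[t w] [k _ [/= tk Xk]]].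
    by exists (Num.floor (n.+1%:R * t)).
  by rewrite /h /= tk.
apply: countable_bigcupT_measurable => // k.
apply: measurableX; last by rewrite -[X in measurable X]setTI; exact: mX.
rewrite (_ : _ @^-1` _ = [set` `[k%:~R / n.+1%:R, (k + 1)%:~R / n.+1%:R[ ])//.
apply/seteqP; split => t /=; rewrite in_itv /= ler_pdivrMr ?ltr0n//
  ltr_pdivlMr ?ltr0n// [t * _]mulrC; first by move=> <-; rewrite floor_le floorD1_gt.
by move=> tk; apply: floor_def.
Qed.


(** * Gaussian densities and their integrals over time *)

Lemma measurable_inv (R : realType) : measurable_fun setT (GRing.inv : R -> R).
Proof.
rewrite -(setUv [set (0 : R)]); apply/measurable_funU => //.
  by apply: measurableC.
split; first exact: measurable_fun_set1.
apply: open_continuous_measurable_fun.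
  by apply: closed_openC; exact: closed_eq.
by move=> x; rewrite inE /= => /eqP x0; apply: inv_continuous.
Qed.

Lemma measurable_sqrt (R : realType) : measurable_fun setT (Num.sqrt : R -> R).
Proof. by apply: continuous_measurable_fun; exact: sqrt_continuous. Qed.

(** The density of a centred Gaussian of variance [t]. *)
Definition gden (R : realType) (t z : R) : R :=
  (Num.sqrt (2 * pi * t))^-1 * expR (- z ^+ 2 / (2 * t)).

Section gaussian.
Context (R : realType).
Implicit Types t z y m : R.
Local Notation mu := (@lebesgue_measure R).

Lemma gden_ge0 t z : 0 <= gden t z.
Proof. by rewrite mulr_ge0 ?expR_ge0// invr_ge0 sqrtr_ge0. Qed.

Lemma gdenN t z : gden t (- z) = gden t z.
Proof. by rewrite /gden sqrrN. Qed.

Lemma measurable_gden : measurable_fun setT (fun p : R * R => gden p.1 p.2).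
Proof.
apply: measurable_funM.
  apply: (measurableT_comp (@measurable_inv R)).
  apply: (measurableT_comp (@measurable_sqrt R)).
  by apply: measurable_funM => //; exact: measurable_fst.
apply: (measurableT_comp (@measurable_expR R)).
apply: measurable_funM.
  apply: measurableT_comp => //; apply: measurable_funX; exact: measurable_snd.
apply: (measurableT_comp (@measurable_inv R)).
by apply: measurable_funM => //; exact: measurable_fst.
Qed.

Lemma measurable_gdenl t : measurable_fun setT (gden t).
Proof. exact: (measurableT_comp measurable_gden (pair1_measurable t)). Qed.

Lemma measurable_fun_gden d (T : measurableType d) (f g : T -> R) :
  measurable_fun setT f -> measurable_fun setT g ->
  measurable_fun setT (fun x => gden (f x) (g x)).
Proof.
move=> mf mg; exact: (measurableT_comp measurable_gden (measurable_fun_pair mf mg)).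
Qed.

Lemma gdenE t : 0 < t -> gden t = normal_pdf 0 (Num.sqrt t).
Proof.
move=> t0; apply/funext => z; rewrite normal_pdfE ?gt_eqF ?sqrtr_gt0//.
rewrite /normal_peak /normal_fun subr0 sqr_sqrtr ?ltW// /gden.
by rewrite -[t * pi *+ 2]mulr_natl -[t *+ 2]mulr_natl (mulrC t pi) mulrA.
Qed.

Lemma integral_gden_shift t c : 0 < t ->
  (\int[mu]_z (gden t (z + c))%:E = 1)%E.
Proof.
move=> t0; rewrite (ge0_integral_translation (f := fun z => (gden t z)%:E)).
- by rewrite gdenE//; exact: integral_normal_pdf.
- by apply/measurable_EFinP; exact: measurable_gdenl.
- by move=> x; rewrite lee_fin gden_ge0.
Qed.

(** Completing the square: an exponential tilt moves the centre. *)
Lemma gden_tilt t z a : 0 < t ->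
  expR (a * z) * gden t z = expR (a ^+ 2 * t / 2) * gden t (z - a * t).
Proof.
move=> t0; rewrite /gden mulrCA [RHS]mulrCA -!expRD; congr (_ * expR _).
by field; rewrite gt_eqF.
Qed.

(** Girsanov's formula at a fixed time: reversing the drift multiplies the density
    at [y] by an exponential of [y]. *)
Lemma gden_reflect t m y : 0 < t ->
  expR (2 * m * y) * gden t (y + m * t) = gden t (y - m * t).
Proof.
move=> t0; rewrite /gden mulrCA -!expRD; congr (_ * expR _).
by field; rewrite gt_eqF.
Qed.

(** The standard normal distribution function, written as an integral so that the
    fundamental theorem of calculus applies to it. *)
Definition Phi (x : R) : R := (\int[mu]_(t in `]-oo, x]) gden 1 t)%R.

Lemma integrable_gden t : 0 < t -> mu.-integrable setT (fun z => (gden t z)%:E).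
Proof. by move=> t0; rewrite gdenE//; exact: integrable_normal_pdf. Qed.

Lemma continuous_gden t : 0 < t -> continuous (gden t).
Proof.
by move=> t0; rewrite gdenE//; apply: continuous_normal_pdf; rewrite gt_eqF ?sqrtr_gt0.
Qed.

Lemma is_derive_Phi (x : R) : is_derive x 1 Phi (gden 1 x).
Proof.
have [|||/=|d1 d2] := @continuous_FTC1 R (gden 1) -oo%O x (x + 1).
- by rewrite ltrDl.
- exact: (integrableS measurableT _ _ (integrable_gden _)).
- by rewrite ltNyr.
- by apply: continuous_gden.
- apply: DeriveDef; first exact: d1.
  by rewrite -derive1E; exact: d2.
Qed.

End gaussian.

Section standard_normal_cdf.
Context (R : realType).
Local Notation mu := (@lebesgue_measure R).

Let mid : measurable_fun setT (idfun : measurableTypeR R -> R).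
Proof. exact: (@measurable_id _ (measurableTypeR R) setT). Qed.

Let id_mfun : {mfun (measurableTypeR R) >-> R} :=
  HB.pack (idfun : measurableTypeR R -> R)
    (isMeasurableFun.Build _ _ _ _ (idfun : measurableTypeR R -> R) mid).

Let PhiE x : (Phi x)%:E = @cdf _ _ R (@normal_prob R 0 (Num.sqrt 1)) id_mfun x.
Proof.
rewrite /cdf /distribution /pushforward /= /normal_prob /Phi /Rintegral.
rewrite gdenE// fineK//; apply: integrable_fin_num => //.
by apply: integrableS (integrable_normal_pdf 0 (Num.sqrt 1)).
Qed.

Lemma Phi_y : Phi x @[x --> +oo] --> (1 : R).
Proof.
have := @cvg_cdfy1 _ _ R (@normal_prob R 0 (Num.sqrt 1)) id_mfun.
rewrite (_ : @cdf _ _ _ _ _ = fun x => (Phi x)%:E); last first.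
  by apply/funext => x; rewrite PhiE.
by move/fine_cvg.
Qed.

Lemma Phi_Ny : Phi x @[x --> -oo] --> (0 : R).
Proof.
have := @cvg_cdfNy0 _ _ R (@normal_prob R 0 (Num.sqrt 1)) id_mfun.
rewrite (_ : @cdf _ _ _ _ _ = fun x => (Phi x)%:E); last first.
  by apply/funext => x; rewrite PhiE.
by move/fine_cvg.
Qed.

End standard_normal_cdf.

Section drift_primitive.
Context (R : realType).
Implicit Types t z y m c : R.
Local Notation mu := (@lebesgue_measure R).

Lemma gden_scale t z : gden t z = gden 1 (z / Num.sqrt t) / Num.sqrt t.
Proof.
have [t0|t0] := ltP 0 t; last first.
  rewrite /gden (ler0_sqrtr t0) invr0 mulr0 [Num.sqrt _]ler0_sqrtr ?invr0 ?mul0r//.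
  by rewrite mulr_ge0_le0// mulr_ge0// pi_ge0.
rewrite /gden mulr1 sqrtrM ?mulr_ge0 ?pi_ge0// invfM mulrAC; congr (_ * _ * _).
congr expR; rewrite exprMn exprVn sqr_sqrtr ?ltW// mulr1.
by field; rewrite gt_eqF.
Qed.

(** For [c = 1] this is the distribution function of the first passage time to
    [y > 0] of a Brownian motion of drift [m]; for [c = -1] it is [m] times the
    occupation density at [y] up to time [t]. *)
Definition drift_primitive m y c t : R :=
  Phi ((m * t - y) / Num.sqrt t) +
  c * expR (2 * m * y) * Phi ((- m * t - y) / Num.sqrt t).

Lemma is_derive_drift_primitive m y c t : 0 < t ->
  is_derive t 1 (drift_primitive m y c)
    (gden t (y - m * t) * ((m * t + y) + c * (y - m * t)) / (2 * t)).
Proof.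
move=> t0; have st0 : 0 < Num.sqrt t by rewrite sqrtr_gt0.
have tE : t = Num.sqrt t ^+ 2 by rewrite sqr_sqrtr// ltW.
have dV : is_derive t 1 (fun t => (Num.sqrt t)^-1)
    (- (Num.sqrt t) ^- 2 * (2 * Num.sqrt t)^-1).
  by have := is_derive1_sqrt t0 => ?; apply: is_deriveV; rewrite gt_eqF.
have da k : is_derive t 1 (fun t => (k * t - y) / Num.sqrt t)
    ((k * t + y) / (2 * t * Num.sqrt t)).
  apply: is_derive_eq; rewrite /GRing.scale /=; move: tE st0 {dV}.
  generalize (Num.sqrt t) => s -> s0.
  by field; rewrite gt_eqF.
have dPhi k : is_derive t 1 (fun t => Phi ((k * t - y) / Num.sqrt t))
    (gden 1 ((k * t - y) / Num.sqrt t) * ((k * t + y) / (2 * t * Num.sqrt t))).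
  exact: (is_derive1_comp (is_derive_Phi _) (da k)).
have -> : drift_primitive m y c = (fun t => Phi ((m * t - y) / Num.sqrt t)) +
    (c * expR (2 * m * y)) *: (fun t => Phi (((- m) * t - y) / Num.sqrt t)).
  by [].
have d := is_deriveD (dPhi m) (is_deriveZ (c * expR (2 * m * y)) (dPhi (- m))).
apply: (is_derive_eq d).
have e1 : gden 1 ((m * t - y) / Num.sqrt t) = gden t (y - m * t) * Num.sqrt t.
  by rewrite -(opprB (m * t)) gdenN (gden_scale t) mulfVK// gt_eqF.
have e2 : expR (2 * m * y) * gden 1 ((- m * t - y) / Num.sqrt t) =
    gden t (y - m * t) * Num.sqrt t.
  rewrite -gden_reflect// -mulrA -(opprK (y + _)) gdenN opprD -mulNr addrC.
  by rewrite -[RHS]mulrA (gden_scale t) mulfVK ?gt_eqF// addrC.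
rewrite e1 /GRing.scale /= -[c * _ * _]mulrA [expR _ * (_ * _)]mulrA e2.
by field; rewrite !gt_eqF.
Qed.

Let sqrt_y : Num.sqrt x @[x --> +oo] --> (+oo : set_system R).
Proof.
apply/cvgryPge => A; near=> x.
rewrite (le_trans (ler_norm A))// -sqrtr_sqr ler_wsqrtr//.
Unshelve. all: by end_near. Qed.

Lemma drift_primitive_y m y c : 0 < m -> 0 <= y ->
  drift_primitive m y c x @[x --> +oo] --> (1 : R).
Proof.
move=> m0 y0.
rewrite -[X in _ --> X](_ : 1 + c * expR (2 * m * y) * 0 = _); last first.
  by rewrite mulr0 addr0.
have sx : \forall x \near +oo, 1 <= Num.sqrt (x : R).
  by have /cvgryPge := sqrt_y; exact.
have xx : \forall x \near (+oo : set_system R), 0 < x by exact: nbhs_pinfty_gt.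
have H1 : (m * x - y) / Num.sqrt x @[x --> +oo] --> (+oo : set_system R).
  apply/cvgryPge => A; near=> x.
  have x0 : 0 < x by near: x.
  have s1 : 1 <= Num.sqrt x by near: x.
  have : (A + y) / m <= Num.sqrt x.
    by near: x; move: ((A + y) / m); apply/cvgryPge.
  rewrite ler_pdivrMr// => Am.
  rewrite ler_pdivlMr ?(lt_le_trans ltr01)//.
  have -> : m * x = Num.sqrt x * m * Num.sqrt x.
    by rewrite -[in LHS](sqr_sqrtr (ltW x0)); ring.
  nra.
have H2 : (- m * x - y) / Num.sqrt x @[x --> +oo] --> (-oo : set_system R).
  apply/cvgrNyPle => A; near=> x.
  have x0 : 0 < x by near: x.
  have s1 : 1 <= Num.sqrt x by near: x.
  have : - A / m <= Num.sqrt x.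
    by near: x; move: (- A / m); apply/cvgryPge.
  rewrite ler_pdivrMr// => Am.
  rewrite ler_pdivrMr ?(lt_le_trans ltr01)//.
  have -> : - m * x = - (Num.sqrt x * m * Num.sqrt x).
    by rewrite -[in LHS](sqr_sqrtr (ltW x0)); ring.
  nra.
apply: cvgD; first exact: (cvg_comp _ _ H1 (@Phi_y R)).
by apply: cvgM; [exact: cvg_cst|exact: (cvg_comp _ _ H2 (@Phi_Ny R))].
Unshelve. all: by end_near. Qed.

(** The inverse squares tend to [0] and have explicit square roots. *)
Lemma drift_primitive_0 m y c : 0 < m -> 0 < y ->
  drift_primitive m y c (n.+1%:R ^- 2) @[n --> \oo] --> (0 : R).
Proof.
move=> m0 y0.
rewrite -[X in _ --> X](_ : 0 + c * expR (2 * m * y) * 0 = _); last first.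
  by rewrite mulr0 addr0.
have H k : (k * n.+1%:R ^- 2 - y) / Num.sqrt (n.+1%:R ^- 2) @[n --> \oo] -->
    (-oo : set_system R).
  apply/cvgrNyPle => A; near=> n.
  have n1 : 1 <= n.+1%:R :> R by rewrite ler1n.
  have : (`|k| - A) / y <= n.+1%:R.
    rewrite (@le_trans _ _ n%:R) ?ler_nat//.
    by near: n; exact: nbhs_infty_ger.
  rewrite ler_pdivrMr// => An.
  rewrite -exprVn sqrtr_sqr ger0_norm ?invr_ge0// invrK exprVn.
  have n0 : n.+1%:R != 0 :> R by rewrite gt_eqF// (lt_le_trans ltr01).
  have -> : (k * n.+1%:R ^- 2 - y) * n.+1%:R = k / n.+1%:R - y * n.+1%:R by field.
  have : k / n.+1%:R <= `|k|.
    by rewrite ler_pdivrMr ?(lt_le_trans ltr01)// (le_trans (ler_norm k))// ler_peMr.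
  by rewrite lerBlDr => h; rewrite (le_trans h)// -lerBlDl mulrC.
apply: cvgD; first exact: (cvg_comp _ _ (H m) (@Phi_Ny R)).
by apply: cvgM; [exact: cvg_cst|exact: (cvg_comp _ _ (H (- m)) (@Phi_Ny R))].
Unshelve. all: by end_near. Qed.

Let rate m y c t : R :=
  gden t (y - m * t) * ((m * t + y) + c * (y - m * t)) / (2 * t).

Let continuous_rate m y c t : 0 < t -> {for t, continuous (rate m y c)}.
Proof.
move=> t0.
have -> : rate m y c = fun s => gden 1 ((y - m * s) / Num.sqrt s) / Num.sqrt s *
    ((m * s + y) + c * (y - m * s)) / (2 * s).
  by apply/funext => s; rewrite /rate -gden_scale.
have cs : Num.sqrt s @[s --> t] --> Num.sqrt t by exact: sqrt_continuous.
have cV : (Num.sqrt s)^-1 @[s --> t] --> (Num.sqrt t)^-1.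
  by apply: cvgV cs; rewrite gt_eqF ?sqrtr_gt0.
have cm k : k * s @[s --> t] --> k * t.
  by apply: cvgM; [exact: cvg_cst|exact: cvg_id].
have cl : y - m * s @[s --> t] --> y - m * t.
  by apply: cvgB => //; exact: cvg_cst.
have cc : c * (y - m * s) @[s --> t] --> c * (y - m * t).
  by apply: cvgM cl; exact: cvg_cst.
have ca : (y - m * s) / Num.sqrt s @[s --> t] --> (y - m * t) / Num.sqrt t.
  exact: cvgM.
apply: cvgM; last by apply: cvgV => //; rewrite mulf_neq0 ?gt_eqF.
apply: cvgM.
  apply: cvgM cV.
  exact: (cvg_comp _ _ ca (@continuous_gden R 1 ltr01 _)).
by apply: cvgD cc; apply: cvgD => //; exact: cvg_cst.
Qed.

(** The fundamental theorem of calculus on [[n.+1 ^- 2, +oo[], then [n] to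
    infinity: the primitive runs from [0] to [1]. *)
Lemma integral_drift_primitive m y c : 0 < m -> 0 < y ->
  (forall t, 0 <= t -> 0 <= (m * t + y) + c * (y - m * t)) ->
  (\int[mu]_(t in `]0%R, +oo[)
    (gden t (y - m * t) * ((m * t + y) + c * (y - m * t)) / (2 * t))%:E = 1)%E.
Proof.
move=> m0 y0 c0.
have rate0 t : 0 <= t -> 0 <= rate m y c t.
  by move=> t0; rewrite divr_ge0 ?mulr_ge0 ?gden_ge0 ?c0.
have := @ge0_nondecreasing_set_cvg_integral _ (measurableTypeR R) R
  (fun n => `[(n.+1%:R : R) ^- 2, +oo[%classic) (EFin \o rate m y c) (@lebesgue_measure R).
have -> : \bigcup_n `[(n.+1%:R : R) ^- 2, +oo[%classic = `]0, +oo[%classic.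
  apply/seteqP; split => t /=.
    move=> [n _] /=; rewrite !in_itv /= !andbT; apply: lt_le_trans.
    by rewrite invr_gt0 exprn_gt0.
  rewrite in_itv /= andbT => t0.
  exists (Num.truncn t^-1) => //=; rewrite in_itv /= andbT.
  rewrite -[leRHS]invrK lef_pV2 ?posrE ?exprn_gt0 ?invr_gt0//.
  rewrite (le_trans (ltW (truncnS_gt _)))// expr2 ler_peMr// ler1n//.
move=> H; apply: (cvg_unique _ (H _ _ _ _)) => {H} //=.
- move=> n1 n2 n12; apply/subsetPset => t /=; rewrite !in_itv /= !andbT.
  apply: le_trans; rewrite lef_pV2 ?posrE ?exprn_gt0//.
  by rewrite ler_pXn2r// ?nnegrE// ler_nat.
- move=> n; apply/measurable_EFinP/(measurable_funS measurableT) => //.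
  apply: measurable_funM; last first.
    by apply: (measurableT_comp (@measurable_inv R)); apply: measurable_funM.
  apply: measurable_funM.
    by apply: measurable_fun_gden => //; apply: measurable_funB => //; apply: measurable_funM.
  apply: measurable_funD; first by apply: measurable_funD => //; apply: measurable_funM.
  by apply: measurable_funM => //; apply: measurable_funB => //; apply: measurable_funM.
- move=> n t; rewrite /= in_itv /= andbT => nt; rewrite lee_fin rate0//.
  by apply: le_trans nt; rewrite invr_ge0 exprn_ge0.
have FTC n : (\int[mu]_(t in `[n.+1%:R ^- 2, +oo[) (rate m y c t)%:E =
    1%:E - (drift_primitive m y c (n.+1%:R ^- 2))%:E)%E.
  have n0 : 0 < n.+1%:R ^- 2 :> R by rewrite invr_gt0 exprn_gt0.
  have dF (t : R) : 0 < t -> is_derive t 1 (drift_primitive m y c) (rate m y c t).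
    by move=> t0; exact: is_derive_drift_primitive.
  apply: ge0_continuous_FTC2y.
  - by move=> x nx; rewrite rate0// (le_trans (ltW n0)).
  - apply/continuous_within_itvcyP; split.
      by move=> t; rewrite in_itv /= andbT => nt; apply: continuous_rate; exact: lt_trans nt.
    by apply: cvg_at_right_filter; exact: continuous_rate.
  - by apply: drift_primitive_y => //; exact: ltW.
  - by move=> x nx; have [] := dF x (lt_trans n0 nx).
  - apply: cvg_at_right_filter; apply: differentiable_continuous.
    by apply/derivable1_diffP; have [] := dF _ n0.
  - move=> x; rewrite in_itv /= andbT => nx.
    by have := dF x (lt_trans n0 nx) => ?; rewrite derive1E derive_val.
rewrite (_ : (fun _ => _) = (fun n => (1 - drift_primitive m y c (n.+1%:R ^- 2))%:E)); last first.
  by apply/funext => n; rewrite FTC.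
apply: cvg_EFin; first exact: nearW.
rewrite /= -[X in _ --> X]subr0; apply: cvgB; first exact: cvg_cst.
exact: drift_primitive_0.
Qed.

Lemma measurable_gden_time m y : measurable_fun setT (fun t => gden t (y - m * t)).
Proof.
apply: measurable_fun_gden => //.
by apply: measurable_funB => //; apply: measurable_funM.
Qed.

(** The first passage time to the level [y > 0] has density
    [(y / t) * gden t (y - m * t)], and a positive drift makes it finite. *)
Lemma integral_first_passage m y : 0 < m -> 0 < y ->
  (\int[mu]_(t in `]0%R, +oo[) (y / t * gden t (y - m * t))%:E = 1)%E.
Proof.
move=> m0 y0; rewrite -(@integral_drift_primitive m y 1 m0 y0).
  apply: eq_integral => t; rewrite inE /= in_itv /= andbT => t0.
  by congr EFin; field; rewrite gt_eqF.
by move=> t t0; lra.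
Qed.

Let integral_gden_time m y : 0 < m -> 0 < y ->
  (\int[mu]_(t in `]0%R, +oo[) (gden t (y - m * t))%:E = (m^-1)%:E)%E.
Proof.
move=> m0 y0.
have H : (\int[mu]_(t in `]0%R, +oo[) (m%:E * (gden t (y - m * t))%:E) = 1)%E.
  rewrite -(@integral_drift_primitive m y (-1) m0 y0).
    apply: eq_integral => t; rewrite inE /= in_itv /= andbT => t0.
    by congr EFin; field; rewrite gt_eqF.
  by move=> t t0; nra.
rewrite -[RHS]mule1 -H ge0_integralZl//=.
- by rewrite muleA -EFinM mulVf ?gt_eqF// mul1e.
- apply/measurable_EFinP; apply: measurable_funTS; exact: measurable_gden_time.
- by move=> t _; rewrite lee_fin gden_ge0.
- by rewrite lee_fin ltW.
Qed.

(** The Green function of a Brownian motion of drift [- m] started from the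
    origin.  For [y > 0] the exponential is the probability that [y] is ever
    reached; once it is reached, which is certain for [y < 0], the occupation
    density at [y] is [1 / m]. *)
Lemma integral_gden_green m y : 0 < m -> y != 0 ->
  (\int[mu]_(t in `]0%R, +oo[) (gden t (y + m * t))%:E =
   (m^-1 * expR (- (2 * m * Num.max y 0)))%:E)%E.
Proof.
move=> m0 y0; have [yp|yn|y00] := ltgtP 0 y; last by rewrite -y00 eqxx in y0.
  rewrite mulrC EFinM -(integral_gden_time m0 yp) -ge0_integralZl//=.
  - apply: eq_integral => t; rewrite inE /= in_itv /= andbT => t0.
    rewrite -EFinM -(@gden_reflect R t m y t0) mulrA -expRD addNr expR0 mul1r//.
  - apply/measurable_EFinP; apply: measurable_funTS; exact: measurable_gden_time.
  - by move=> t _; rewrite lee_fin gden_ge0.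
have yn' : 0 < - y by rewrite oppr_gt0.
rewrite mulr0 oppr0 expR0 mulr1 -(integral_gden_time m0 yn').
by apply: eq_integral => t _; rewrite -gdenN opprD.
Qed.

End drift_primitive.

(** * Limits of integrals *)

Lemma cvg_integral_monotone d (T : measurableType d) (R : realType)
    (mu : {measure set T -> \bar R}) (f_ : nat -> T -> \bar R) (f : T -> \bar R) :
  (forall n, measurable_fun setT (f_ n)) -> (forall n w, 0 <= f_ n w)%E ->
  (forall w, {homo (fun n => f_ n w) : n k / (n <= k)%N >-> (n <= k)%E}) ->
  (forall w, f_ n w @[n --> \oo] --> f w) ->
  (\int[mu]_w f_ n w)%E @[n --> \oo] --> (\int[mu]_w f w)%E.
Proof.
move=> mf f0 ndf cf.
have := @cvg_monotone_convergence _ T R mu setT measurableT f_ mf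
  (fun n x _ => f0 n x) (fun x _ => ndf x).
rewrite (_ : \int[mu]_x limn _ = \int[mu]_x f x)%E//.
by apply: eq_integral => w _; apply/cvg_lim => //; exact: cf.
Qed.

Section bounded_convergence.
Context d (T : measurableType d) (R : realType) (P : probability T R).

Lemma cvg_integral_bounded (f_ : nat -> T -> R) (f : T -> R) (C : R) :
  (forall n, measurable_fun setT (f_ n)) ->
  (forall n w, 0 <= f_ n w <= C) ->
  (forall w, f_ n w @[n --> \oo] --> f w) ->
  (\int[P]_w (f_ n w)%:E)%E @[n --> \oo] --> (\int[P]_w (f w)%:E)%E.
Proof.
move=> mf f0 cf.
have mfl : measurable_fun setT f by exact: (measurable_fun_cvg mf (fun w _ => cf w)).
have h1 n : measurable_fun setT (fun w => (f_ n w)%:E) by apply/measurable_EFinP.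
have h2 : measurable_fun setT (fun w => (f w)%:E) by apply/measurable_EFinP.
have [|||_ _] := @dominated_convergence _ _ R P setT measurableT
  (fun n w => (f_ n w)%:E) (fun w => (f w)%:E) (cst C%:E) h1 h2 => //.
- by apply/aeW => w _; apply: cvg_EFin; [exact: nearW|exact: cf].
- exact: finite_measure_integrable_cst.
- apply/aeW => w n _ /=; have /andP[p0 p1] := f0 n w.
  by rewrite lee_fin ger0_norm.
Qed.

End bounded_convergence.

(** * Grids in a time interval *)

Section grid.
Context (R : realType).
Implicit Types (f : R -> R) (a b e s t : R).

Definition grid a b (N j : nat) : R := a + (b - a) * (j%:R / N.+1%:R).

Lemma grid_itv a b N j : a <= b -> (j <= N.+1)%N -> a <= grid a b N j <= b.
Proof.
move=> ab jN; have N0 : 0 < N.+1%:R :> R by rewrite ltr0n.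
rewrite /grid lerDl mulr_ge0 ?subr_ge0 ?divr_ge0//= -lerBrDl.
by rewrite ler_piMr ?subr_ge0// ler_pdivrMr// mul1r ler_nat.
Qed.

(** Continuity is uniform on the compact interval [[a, b]]; [near_covering] gives
    the uniformity without choosing a modulus. *)
Lemma grid_oscillation f a b e : continuous f -> a <= b -> 0 < e ->
  \forall N \near \oo, forall s t, a <= s <= b ->
    `|t - s| <= (b - a) / N.+1%:R -> `|f t - f s| < e.
Proof.
move=> cf ab e0.
have /compact_near_coveringP := @segment_compact R a b.
move=> /(_ _ \oo (fun N s => forall t, `|t - s| <= (b - a) / N.+1%:R ->
  `|f t - f s| < e)).
move=> h; apply: filterS (h _ _) => {h} [N hN s t /hN h /h//|s _].
have e2 : 0 < e / 2 by rewrite divr_gt0.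
have /cvgrPdist_lt /(_ _ e2) [r /= r0 hr] := cf s.
have hN : \forall N \near \oo, (b - a) / N.+1%:R < r / 2.
  near=> N; rewrite ltr_pdivrMr// mulrC -ltr_pdivrMr ?divr_gt0//.
  rewrite (@le_lt_trans _ _ N%:R) ?ltr_nat//.
  by near: N; exact: nbhs_infty_ger.
near=> u N => /= v uv.
have us : `|s - u| < r / 2 by near: u; exists (r / 2) => //=; rewrite divr_gt0.
have Nr : (b - a) / N.+1%:R < r / 2 by near: N.
have vs : `|s - v| < r.
  rewrite -(subrKA u) (le_lt_trans (ler_normD _ _))// (splitr r) ltrD//.
  by rewrite distrC (le_lt_trans uv).
have ur : `|s - u| < r by rewrite (lt_le_trans us)// ler_pdivrMr// ler_peMr ?ltW// ltr1n.
rewrite -(subrKA (f s)) (le_lt_trans (ler_normD _ _))// (splitr e) ltrD//.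
  by rewrite distrC; exact: hr.
by exact: hr.
Unshelve. all: by end_near. Qed.

(** This reduces what happens at some time of [[a, b]] to finitely many times: the
    grid point to the left of [s] is close to [s]. *)
Lemma grid_hits f a b s : continuous f -> a <= b -> a <= s <= b -> f s < 0 ->
  \forall N \near \oo, exists j : 'I_N.+2, f (grid a b N j) < 0.
Proof.
move=> cf ab /andP[sa sb] fs.
have e0 : 0 < - f s by rewrite oppr_gt0.
apply: filterS (grid_oscillation cf ab e0) => N /(_ s (grid a b N _)) h.
have N0 : 0 < N.+1%:R :> R by rewrite ltr0n.
have [eab|ltab] := eqVneq a b.
  exists ord0; rewrite /= (_ : grid a b N 0 = s)//.
  apply/eqP; rewrite /grid mul0r mulr0 addr0 eq_le sa /=.
  by rewrite [leRHS]eab.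
have ba0 : 0 < b - a by rewrite subr_gt0 lt_neqAle ltab.
pose q := (s - a) / (b - a) * N.+1%:R.
have q0 : 0 <= q by rewrite mulr_ge0 ?divr_ge0 ?subr_ge0.
have qN : q <= N.+1%:R.
  by rewrite ler_piMl// ler_pdivrMr// mul1r lerB.
have jN : (Num.truncn q < N.+2)%N.
  by rewrite ltnS -(ler_nat R) (le_trans _ qN)// truncn_le.
exists (Ordinal jN) => /=.
have := h (Num.truncn q); rewrite sa sb => /(_ isT).
have -> : grid a b N (Num.truncn q) - s = - ((b - a) / N.+1%:R * (q - (Num.truncn q)%:R)).
  by rewrite /grid /q; field; rewrite !gt_eqF.
have /andP[q1 q2] := truncn_itv q0.
rewrite normrN ger0_norm ?mulr_ge0 ?subr_ge0 ?divr_ge0 ?(ltW ba0)//.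
rewrite ler_piMr ?divr_ge0 ?(ltW ba0)//; last first.
  by rewrite lerBlDl natr1 ltW.
move=> /(_ isT); rewrite ltr_norml => /andP[_].
by rewrite ltrBlDr addNr.
Qed.

End grid.

(** * Brownian increments and the past *)

Section generated_sigma_algebra.
Context d (T : measurableType d) (R : realType) (F : set (T -> R)).

(** [T] with the coarser sigma-algebra generated by the functions in [F], so that
    measurability with respect to [F] is ordinary measurability on this type. *)
Definition gen_by : Type :=
  g_sigma_algebraType (\bigcup_(f in F) preimage_set_system setT f measurable).
HB.instance Definition _ := Measurable.on gen_by.

Lemma measurable_gen_by f : F f -> measurable_fun setT (f : gen_by -> R).
Proof.
move=> Ff _ A mA; apply: sub_sigma_algebra; exists f => //=.
by exists A.
Qed.

Lemma measurable_to_gen_by : (forall f, F f -> measurable_fun setT f) ->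
  measurable_fun setT (id : T -> gen_by).
Proof.
move=> mF _ A mA; rewrite setTI preimage_id.
move: mA; apply: smallest_sub; first exact: sigma_algebra_measurable.
by move=> _ [f Ff [C mC <-]]; exact: mF.
Qed.

End generated_sigma_algebra.

Section brownian_increments.
Context d (T : measurableType d) (R : realType) (P : probability T R).
Variables (B : R -> {RV P >-> R}).
Hypothesis hB : brownian_motion B.

(** The natural filtration of [B], as a family of measurable types. *)
Definition past (s : R) : Type := gen_by [set (B t : T -> R) | t in `[0, s]].
HB.instance Definition _ s := Measurable.on (past s).

Lemma measurable_past s t : 0 <= t <= s -> measurable_fun setT (B t : past s -> R).
Proof.
by move=> ts; apply: measurable_gen_by; exists t => //=; rewrite in_itv.
Qed.

Lemma measurable_to_past s : measurable_fun setT (id : T -> past s).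
Proof. by apply: measurable_to_gen_by => _ [t _ <-]; exact: measurable_funPT. Qed.

Lemma integral_increment s t (g : R -> \bar R) : 0 <= s -> s < t ->
  measurable_fun setT g -> (forall z, 0 <= g z)%E ->
  (\int[P]_w g (B t w - B s w)%R =
   \int[lebesgue_measure]_z (g z * (gden (t - s) z)%:E))%E.
Proof.
move=> s0 st mg g0; have [_ _ hinc _] := hB.
have ts0 : 0 < t - s by rewrite subr_gt0.
pose phi : T -> measurableTypeR R := fun w => B t w - B s w.
have mphi : measurable_fun setT phi by exact: measurable_funB.
rewrite [LHS](_ : _ = \int[pushforward P phi]_z g z)%E; last first.
  by rewrite ge0_integral_pushforward.
apply: (@ge0_integral_density _ _ R _ (@lebesgue_measure R) (gden (t - s))) => //.
- exact: measurable_gdenl.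
- by move=> x; exact: gden_ge0.
- by move=> A mA; rewrite gdenE//; exact: hinc.
Qed.

(** The Markov property in integral form: the increment after time [s] is
    integrated out against its Gaussian law, whatever happened before. *)
Lemma integral_past_increment s t (g : T * R -> \bar R) : 0 <= s -> s < t ->
  measurable_fun setT (g : past s * R -> \bar R) -> (forall z, 0 <= g z)%E ->
  (\int[P]_w g (w, (B t w - B s w)%R) =
   \int[P]_w \int[lebesgue_measure]_z (g (w, z) * (gden (t - s) z)%:E))%E.
Proof.
move=> s0 st mg g0; have [_ _ _ hind] := hB.
rewrite (@integral_independent _ _ _ P _ (past s) _ _ id (B t \- B s : {mfun T >-> R}) g)//.
- apply: eq_integral => w _; apply: integral_increment => //.
  exact: (measurableT_comp mg (pair1_measurable (w : past s))).
- exact: measurable_to_past.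
- move=> A C mA mC; rewrite preimage_id setIC muleC.
  apply: (hind _ _ s0 st) => //.
  apply: sub_sigma_algebra; exists (B t \- B s) => //=.
  by exists C => //; rewrite setTI.
Qed.

Lemma brownian_marginal t (g : R -> \bar R) : 0 < t ->
  measurable_fun setT g -> (forall z, 0 <= g z)%E ->
  (\int[P]_w g (B t w) = \int[lebesgue_measure]_z (g z * (gden t z)%:E))%E.
Proof.
move=> t0 mg g0; have [B0 _ _ _] := hB.
rewrite -[in RHS](subr0 t) -integral_increment//.
apply: ae_eq_integral => //.
- exact: measurableT_comp.
- by apply: measurableT_comp => //; apply: measurable_funB.
- by apply: filterS B0 => w -> _; rewrite subr0.
Qed.

End brownian_increments.

(** * Optional stopping *)

Section drifted_past.
Context d (T : measurableType d) (R : realType) (P : probability T R).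
Variables (B : R -> {RV P >-> R}) (m : R).
Hypothesis hB : brownian_motion B.
Local Notation Y t w := (B t w + m * t).
Local Notation mu := (@lebesgue_measure R).

Lemma measurable_kgden (k : R -> R) (r c : R) : measurable_fun setT k ->
  measurable_fun setT (fun z : R => ((k (c + z))%:E * (gden r z)%:E)%E).
Proof.
move=> mk; apply/measurable_EFinP/measurable_funM; last exact: measurable_gdenl.
by apply: measurableT_comp => //; exact: measurable_funD.
Qed.

Lemma measurable_past_mono s t : s <= t ->
  measurable_fun setT (id : past B t -> past B s).
Proof.
move=> st; apply: (@measurable_to_gen_by _ (past B t) R).
move=> _ [u /= us <-]; apply: measurable_past; move: us.
by rewrite in_itv /= => /andP[-> us]; rewrite (le_trans us).
Qed.

Lemma past_expectation (k : R -> R) U s b x : 0 <= s -> s < b ->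
  measurable_fun setT k -> (forall z, 0 <= k z) ->
  (forall w, 0 <= U w) -> measurable_fun setT (U : past B s -> R) ->
  (\int[P]_w (U w * k (x + Y b w))%:E =
   \int[P]_w ((U w)%:E *
     \int[mu]_z ((k (x + Y s w + m * (b - s) + z)%R)%:E * (gden (b - s) z)%:E)))%E.
Proof.
move=> s0 sb mk k0 U0 mU.
pose g (p : T * R) := (U p.1 * k (x + Y s p.1 + m * (b - s) + p.2))%:E.
transitivity (\int[P]_w g (w, (B b w - B s w)%R))%E.
  by apply: eq_integral => w _; rewrite /g /=; congr (_ * k _)%:E; ring.
rewrite integral_past_increment//.
- apply: eq_integral => w _; rewrite -ge0_integralZl//=.
  + by apply: eq_integral => z _; rewrite /g /= EFinM muleA.
  + exact: measurable_kgden.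
  + by move=> z _; rewrite -EFinM lee_fin mulr_ge0 ?gden_ge0.
  + by rewrite lee_fin.
- apply/measurable_EFinP/measurable_funM.
    by apply: (measurableT_comp mU); exact: measurable_fst.
  apply: measurableT_comp => //; apply: measurable_funD; last exact: measurable_snd.
  apply: measurable_funD => //; apply: measurable_funD => //; apply: measurable_funD => //.
  have mBs : measurable_fun setT (B s : past B s -> R).
    by apply: measurable_past; rewrite s0 lexx.
  exact: (measurableT_comp mBs measurable_fst).
- by move=> z; rewrite lee_fin mulr_ge0.
Qed.

End drifted_past.

Section optional_stopping.
Context d (T : measurableType d) (R : realType) (P : probability T R).
Variables (B : R -> {RV P >-> R}) (m : R).
Hypothesis hB : brownian_motion B.
Local Notation Y t w := (B t w + m * t).
Local Notation mu := (@lebesgue_measure R).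

Variables (k1 k2 : R -> R) (M L : R).
Hypotheses (k1_ge0 : forall z, 0 <= k1 z) (k2_ge0 : forall z, 0 <= k2 z).
Hypotheses (k1M : forall z, k1 z <= M) (k2M : forall z, k2 z <= M).
Hypotheses (k1L : forall z y, k1 z <= k1 y + L * `|z - y|)
           (k2L : forall z y, k2 z <= k2 y + L * `|z - y|).
Hypotheses (mk1 : measurable_fun setT k1) (mk2 : measurable_fun setT k2).
Hypothesis L0 : 0 <= L.
Hypothesis k10 : k1 0 = 0.
(** The tests [k1] and [k2] cannot be told apart from the origin; for a test and
    its reflection this is a symmetry of the Gaussian density. *)
Hypothesis balance : forall r, 0 < r ->
  (\int[mu]_z ((k1 (m * r + z))%:E * (gden r z)%:E) =
   \int[mu]_z ((k2 (m * r + z))%:E * (gden r z)%:E))%E.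

(** The price of replacing the position [y] by the origin in a test that is bounded
    by [M] and [L]-Lipschitz. *)
Let err (y : R) := Num.min M (L * `|y|).

Let M0 : 0 <= M. Proof. exact: le_trans (k1_ge0 0) (k1M 0). Qed.

Let err0 y : 0 <= err y.
Proof. by rewrite /err le_min M0 mulr_ge0. Qed.

Let k1err y z : k1 (y + z) <= k1 z + err y.
Proof.
rewrite /err minElt; case: ifPn => _.
  by rewrite (le_trans (k1M _))// lerDr.
by have := k1L (y + z) z; rewrite addrK.
Qed.

Let k2err y z : k2 z <= k2 (y + z) + err y.
Proof.
rewrite /err minElt; case: ifPn => _.
  by rewrite (le_trans (k2M _))// lerDr.
by have := k2L z (y + z); rewrite opprD addrCA subrr addr0 normrN.
Qed.

Let int_err (k : R -> R) (r c y : R) : 0 < r -> measurable_fun setT k ->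
  (forall z, 0 <= k z) ->
  (\int[mu]_z ((k (c + z) + err y)%:E * (gden r z)%:E) =
   \int[mu]_z ((k (c + z))%:E * (gden r z)%:E) + (err y)%:E)%E.
Proof.
move=> r0 mk k0.
under eq_integral do rewrite EFinD muleDl//.
rewrite ge0_integralD//=.
- congr (_ + _)%E; rewrite ge0_integralZl//=.
  + have := @integral_gden_shift R r 0 r0.
    by under eq_integral do rewrite addr0; move=> ->; rewrite mule1.
  + by apply/measurable_EFinP; exact: measurable_gdenl.
  + by move=> z _; rewrite lee_fin gden_ge0.
  + by rewrite lee_fin.
- by move=> z _; rewrite -EFinM lee_fin mulr_ge0 ?gden_ge0.
- exact: measurable_kgden.
- by move=> z _; rewrite -EFinM lee_fin mulr_ge0 ?gden_ge0.
- by apply/measurable_EFinP/measurable_funM => //; exact: measurable_gdenl.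
Qed.

(** Move the starting point to the origin, exchange the tests there by [balance],
    and move it back; the price is paid twice. *)
Let near_origin (r y : R) : 0 < r ->
  (\int[mu]_z ((k1 (y + m * r + z)%R)%:E * (gden r z)%:E) <=
   \int[mu]_z ((k2 (y + m * r + z)%R)%:E * (gden r z)%:E) + (2 * err y)%:E)%E.
Proof.
move=> r0.
apply: (@le_trans _ _ (\int[mu]_z ((k1 (m * r + z) + err y)%:E * (gden r z)%:E))%E).
  apply: ge0_le_integral => //=.
  - by move=> z _; rewrite -EFinM lee_fin mulr_ge0 ?gden_ge0.
  - exact: measurable_kgden.
  - apply/measurable_EFinP/measurable_funM; last exact: measurable_gdenl.
    apply: measurable_funD => //; apply: measurableT_comp => //; exact: measurable_funD.
  - by move=> z _; rewrite -!EFinM lee_fin ler_wpM2r ?gden_ge0// -addrA k1err.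
rewrite int_err// balance// mulr_natl mulr2n EFinD addeA leeD2r// -int_err//.
apply: ge0_le_integral => //=.
- by move=> z _; rewrite -EFinM lee_fin mulr_ge0 ?gden_ge0.
- exact: measurable_kgden.
- apply/measurable_EFinP/measurable_funM; last exact: measurable_gdenl.
  apply: measurable_funD => //; apply: measurableT_comp => //; exact: measurable_funD.
- by move=> z _; rewrite -!EFinM lee_fin ler_wpM2r ?gden_ge0// -addrA k2err.
Qed.

(** Conditionally on the past at time [t], the process starts afresh from its
    position, and [near_origin] applies; [U] is any weight known at time [t]. *)
Let restart U t b x : 0 <= t -> t <= b ->
  (forall w, 0 <= U w) -> measurable_fun setT (U : past B t -> R) ->
  (\int[P]_w (U w * k1 (x + Y b w))%:E <=
   \int[P]_w (U w * k2 (x + Y b w))%:E +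
   \int[P]_w (U w * (2 * err (x + Y t w)))%:E)%E.
Proof.
move=> t0 tb U0 mU.
have mUT : measurable_fun setT U.
  exact: (measurableT_comp mU (@measurable_to_past _ _ _ _ B t)).
have mY s : measurable_fun setT (fun w => x + Y s w).
  by apply: measurable_funD => //; apply: measurable_funD.
have mE : measurable_fun setT (fun w => (U w * (2 * err (x + Y t w)))%:E).
  apply/measurable_EFinP/measurable_funM => //; apply: measurable_funM => //.
  apply: measurable_minr => //; apply: measurable_funM => //.
  by apply: measurableT_comp (mY t).
have E0 w : (0 <= (U w * (2 * err (x + Y t w)))%:E)%E.
  by rewrite lee_fin !mulr_ge0.
(* for [t = b] there is no Gaussian step left, and [k1 0 = 0] replaces [balance] *)
move: tb; rewrite le_eqVlt => /predU1P[<-|tb].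
  rewrite -ge0_integralD//; last 2 first.
  - by move=> w _; rewrite lee_fin mulr_ge0.
  - apply/measurable_EFinP/measurable_funM => //; exact: measurableT_comp.
  apply: ge0_le_integral => //.
  - by move=> w _; rewrite lee_fin mulr_ge0.
  - apply/measurable_EFinP/measurable_funM => //; exact: measurableT_comp.
  - apply: emeasurable_funD => //.
    apply/measurable_EFinP/measurable_funM => //; exact: measurableT_comp.
  - move=> w _; rewrite -EFinD -mulrDr lee_fin ler_wpM2l//.
    have := k1err (x + Y t w) 0; rewrite addr0 k10 add0r => h.
    rewrite (le_trans h)// (@le_trans _ _ (2 * err (x + Y t w)))//; last by rewrite lerDr.
    by rewrite ler_peMl// ler1n.
have mk12 (k : R -> R) : measurable_fun setT k -> (forall z, 0 <= k z) ->
    measurable_fun setT (fun w => ((U w)%:E * \int[mu]_z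
      ((k (x + Y t w + m * (b - t) + z)%R)%:E * (gden (b - t) z)%:E))%E).
  move=> mk kp; apply: emeasurable_funM; first exact/measurable_EFinP.
  apply: (@measurable_fun_fubini_tonelli_F _ _ T (measurableTypeR R) R mu
    (fun p : T * R => (k (x + Y t p.1 + m * (b - t) + p.2)%R)%:E * (gden (b - t) p.2)%:E)%E).
  - apply/measurable_EFinP/measurable_funM; last first.
      by apply: (measurableT_comp (@measurable_gdenl _ _)); exact: measurable_snd.
    apply: measurableT_comp => //; apply: measurable_funD; last exact: measurable_snd.
    by apply: measurable_funD => //; apply: (measurableT_comp (mY t)); exact: measurable_fst.
  - by move=> p; rewrite -EFinM lee_fin mulr_ge0 ?gden_ge0.
have i0 (k : R -> R) w : (forall z, 0 <= k z) -> (0 <= \int[mu]_z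
      ((k (x + Y t w + m * (b - t) + z)%R)%:E * (gden (b - t) z)%:E))%E.
  by move=> kp; apply: integral_ge0 => z _; rewrite -EFinM lee_fin mulr_ge0 ?gden_ge0.
rewrite (@past_expectation _ _ _ _ _ m hB k1 U t b x)//.
rewrite (@past_expectation _ _ _ _ _ m hB k2 U t b x)//.
rewrite -ge0_integralD//; last 2 first.
- by move=> w _; apply: mule_ge0; [rewrite lee_fin|exact: i0].
- exact: mk12.
apply: ge0_le_integral => //.
- by move=> w _; apply: mule_ge0; [rewrite lee_fin|exact: i0].
- exact: mk12.
- by apply: emeasurable_funD => //; exact: mk12.
- move=> w _; rewrite EFinM -ge0_muleDr ?i0//; last first.
    by rewrite lee_fin mulr_ge0.
  by apply: lee_wpmul2l; rewrite ?lee_fin// near_origin// subr_gt0.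
Qed.

Section at_grid.
Variables (a b x : R) (V : T -> R) (C : R).
Hypotheses (a0 : 0 <= a) (ab : a <= b).
Hypotheses (V0 : forall w, 0 <= V w) (VC : forall w, V w <= C).
Hypothesis mV : measurable_fun setT (V : past B a -> R).
Hypothesis Va : forall w, V w != 0 -> 0 <= x + Y a w.

(** [D j] is the event that the [j]-th grid time is the first one at which the path
    is negative, and [H] is their disjoint union. *)
Let D N (j : 'I_N.+2) : set T := [set w | x + Y (grid a b N j) w < 0 /\
  forall i : 'I_N.+2, (i < j)%N -> 0 <= x + Y (grid a b N i) w].

Let H N : set T := [set w | exists j : 'I_N.+2, x + Y (grid a b N j) w < 0].

Let H_first N w : H N w -> exists j0 : 'I_N.+2, forall j, D j w <-> j = j0.
Proof.
move=> [j1 hj1].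
pose p (j : 'I_N.+2) := x + Y (grid a b N j) w < 0.
have [j0 /= hj0 min0] := @arg_minnP _ j1 p (fun j : 'I_N.+2 => j : nat) hj1.
have Dj0 : D j0 w.
  split=> // i ij; rewrite leNgt; apply/negP => /min0; rewrite leqNgt.
  by rewrite ij.
exists j0 => j; split=> [[hj hmin]|->//].
apply/val_inj/eqP; rewrite eqn_leq min0// andbT leqNgt; apply/negP => /hmin.
by rewrite leNgt => /negP; apply.
Qed.

Let sum_D N w (c : 'I_N.+2 -> R) :
  (~ H N w -> \sum_j \1_(D j) w * c j = 0) /\
  (H N w -> exists2 j, D j w & \sum_j \1_(D j) w * c j = c j).
Proof.
split=> [nH|/H_first[j0 hj0]].
  apply: big1 => j _; rewrite indicE memNset ?mul0r//.
  by move=> [h _]; apply: nH; exists j.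
exists j0; first by apply/hj0.
rewrite (bigD1 j0)//= indicE mem_set ?mul1r; last by apply/hj0.
rewrite big1 ?addr0// => j jj0; rewrite indicE memNset ?mul0r// => /hj0 e.
by rewrite e eqxx in jj0.
Qed.

Let sum1_D N w : \sum_j \1_(@D N j) w = \1_(H N) w :> R.
Proof.
have [h0 h1] := @sum_D N w (fun _ => 1).
rewrite (eq_bigr (fun j => \1_(@D N j) w * 1)); last by move=> j _; rewrite mulr1.
have [hH|hH] := pselect (H N w).
  by have [j _ ->] := h1 hH; rewrite indicE mem_set.
by rewrite h0// indicE memNset.
Qed.

Let mD N (j : 'I_N.+2) : measurable (@D N j : set (past B (grid a b N j))).
Proof.
have mYi (i : 'I_N.+2) : (i <= j)%N ->
    measurable_fun setT ((fun w => x + Y (grid a b N i) w) : past B (grid a b N j) -> R).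
  move=> ij; apply: measurable_funD => //; apply: measurable_funD => //.
  apply: measurable_past; have /andP[ai _] := @grid_itv _ a b N i ab (ltn_ord i).
  rewrite (le_trans a0 ai)/= /grid lerD2l ler_wpM2l ?subr_ge0//.
  by rewrite ler_wpM2r// ler_nat.
rewrite (_ : @D N j = ((fun w => x + Y (grid a b N j) w) @^-1` `]-oo, 0[%classic) `&`
  \bigcap_(i in [set i : 'I_N.+2 | (i < j)%N])
    ((fun w => x + Y (grid a b N i) w) @^-1` `[0, +oo[%classic)); last first.
  apply/seteqP; split => w /=.
    by move=> [h1 h2]; split; rewrite ?in_itv//= => i ij; rewrite /= in_itv/= andbT h2.
  rewrite in_itv/= => -[h1 h2]; split=> // i ij.
  by have := h2 i ij; rewrite /= in_itv/= andbT.
apply: measurableI.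
  by rewrite -[X in measurable X]setTI; apply: mYi.
apply: fin_bigcap_measurable => // i /= ij.
by rewrite -[X in measurable X]setTI; apply: mYi => //; exact: ltnW.
Qed.

Let mDT N (j : 'I_N.+2) : measurable (@D N j).
Proof.
have := @measurable_to_past _ _ _ _ B (grid a b N j) measurableT _ (@mD N j).
by rewrite setTI.
Qed.

Let path w s := x + (B (Num.max s 0) w + m * s).

Let pathE w s : a <= s -> path w s = x + Y s w.
Proof. by move=> as_; rewrite /path max_l// (le_trans a0). Qed.

Let continuous_path w : continuous (path w).
Proof.
have [_ cB _ _] := hB; have c := continuous_max0 (cB w).
move=> s; apply: cvgD; first exact: cvg_cst.
apply: cvgD; first exact: c.
by apply: cvgM; [exact: cvg_cst|exact: cvg_id].
Qed.

Let stays : set T := [set w | forall s, a <= s <= b -> 0 <= x + Y s w].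

Let cvg_H w : \1_(H N) w @[N --> \oo] --> (\1_(~` stays) w : R).
Proof.
have [sw|nsw] := pselect (stays w).
  rewrite indicE memNset//; apply: cvg_near_cst; apply: nearW => N.
  rewrite indicE memNset// => -[j]; rewrite ltNge; apply/negP; rewrite negbK.
  by apply: sw; apply: grid_itv => //; rewrite -ltnS.
rewrite indicE mem_set//; apply: cvg_near_cst.
have [s sab ns] : exists2 s, a <= s <= b & path w s < 0.
  apply: contra_notP nsw => h s sab; rewrite leNgt; apply/negP => ns; apply: h.
  by exists s => //; rewrite pathE//; case/andP: sab.
apply: filterS (grid_hits (@continuous_path w) ab sab ns) => N [j hj].
rewrite indicE mem_set//; exists j; rewrite -pathE//.
by have /andP[] := @grid_itv _ a b N j ab (ltn_ord j).
Qed.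

Let errN N w : R := \sum_j \1_(@D N j) w * (V w * (2 * err (x + Y (grid a b N j) w))).

Let C0 : 0 <= C. Proof. exact: le_trans (V0 point) (VC point). Qed.

Let errN_bound N w : 0 <= errN N w <= C * (2 * M).
Proof.
have [h0 h1] := @sum_D N w (fun j => V w * (2 * err (x + Y (grid a b N j) w))).
have [hH|hH] := pselect (H N w); last by rewrite /errN h0// lexx !mulr_ge0.
have [j _ e] := h1 hH; rewrite /errN e.
by rewrite !mulr_ge0//= ler_pM// ?mulr_ge0// ler_wpM2l// ge_min lexx.
Qed.

(** Where [V] does not vanish the path is nonnegative at the first grid point, hence
    at the grid point that precedes its first negative value; by continuity this
    negative value is close to the origin. *)
Let cvg_errN w : errN N w @[N --> \oo] --> (0 : R).
Proof.
apply/cvgr0Pnorm_lt => e e0.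
pose K := C * (2 * L) + 1.
have K0 : 0 < K by rewrite ltr_wpDl// !mulr_ge0.
have eK : 0 < e / K by rewrite divr_gt0.
apply: filterS (grid_oscillation (@continuous_path w) ab eK) => N hN.
have [h0 h1] := @sum_D N w (fun j => V w * (2 * err (x + Y (grid a b N j) w))).
have [hH|hH] := pselect (H N w); last by rewrite /errN h0// normr0.
have [j [Dj Dmin] E] := h1 hH; rewrite /errN E.
have [->|Vw] := eqVneq (V w) 0; first by rewrite mul0r normr0.
have j0 : (0 < j)%N.
  rewrite lt0n; apply/eqP => j0; move: Dj; rewrite j0 /grid mul0r mulr0 addr0.
  by rewrite ltNge Va.
have jN : (j.-1 < N.+2)%N by rewrite (leq_ltn_trans (leq_pred _)).
have := Dmin (Ordinal jN); rewrite /= prednK// leqnn => /(_ isT) hpred.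
have /andP[t1 t2] := @grid_itv _ a b N j ab (ltn_ord j).
have /andP[s1 s2] := @grid_itv _ a b N j.-1 ab jN.
have := hN (grid a b N j.-1) (grid a b N j); rewrite s1 s2 => /(_ isT).
have -> : grid a b N j - grid a b N j.-1 = (b - a) / N.+1%:R.
  rewrite /grid -[in LHS](prednK j0) /= -natr1; ring.
rewrite ger0_norm ?divr_ge0 ?subr_ge0// lexx => /(_ isT).
rewrite !pathE// => osc.
have hyp : `|x + Y (grid a b N j) w| < e / K.
  move: osc; rewrite ltr_norml ltr_norml => /andP[q1 q2]; lra.
rewrite ger0_norm ?mulr_ge0//.
have errle : err (x + Y (grid a b N j) w) <= L * (e / K).
  by rewrite /err ge_min ler_wpM2l ?orbT// ltW.
apply: (@le_lt_trans _ _ (C * (2 * (L * (e / K))))).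
  by rewrite ler_pM// ?mulr_ge0// ler_wpM2l.
rewrite (_ : C * _ = (C * (2 * L)) / K * e); last by ring.
by rewrite gtr_pMl// ltr_pdivrMr// mul1r ltrDl.
Qed.

Let mYT s : measurable_fun setT (fun w => x + Y s w).
Proof. by apply: measurable_funD => //; apply: measurable_funD. Qed.

Let mVT : measurable_fun setT V.
Proof. exact: (measurableT_comp mV (@measurable_to_past _ _ _ _ B a)). Qed.

Let mH N : measurable (H N).
Proof.
rewrite (_ : H N = \bigcup_(j in [set: 'I_N.+2])
  ((fun w => x + Y (grid a b N j) w) @^-1` `]-oo, 0[%classic)).
  apply: fin_bigcup_measurable => // j _.
  by rewrite -[X in measurable X]setTI; apply: mYT.
apply/seteqP; split => w /=.
  by move=> [j hj]; exists j => //=; rewrite in_itv.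
by move=> [j _]; rewrite /= in_itv/= => hj; exists j.
Qed.

Let merrN N : measurable_fun setT (errN N).
Proof.
apply: measurable_sum => j; apply: measurable_funM.
  exact: measurable_indic (@mDT N j).
apply: measurable_funM => //; apply: measurable_funM => //.
apply: measurable_minr => //; apply: measurable_funM => //.
by apply: measurableT_comp (mYT _).
Qed.

Let mVHk (k : R -> R) N : measurable_fun setT k ->
  measurable_fun setT (fun w => V w * \1_(H N) w * k (x + Y b w)).
Proof.
move=> mk; apply: measurable_funM.
  by apply: measurable_funM => //; exact: measurable_indic (mH N).
exact: (measurableT_comp mk (mYT b)).
Qed.

Let mVDk (k : R -> R) N (j : 'I_N.+2) : measurable_fun setT k ->
  measurable_fun setT (fun w => \1_(@D N j) w * V w * k (x + Y b w)).
Proof.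
move=> mk; apply: measurable_funM.
  by apply: measurable_funM => //; exact: measurable_indic (@mDT N j).
exact: (measurableT_comp mk (mYT b)).
Qed.

Let sum_DVk (k : R -> R) N : measurable_fun setT k -> (forall z, 0 <= k z) ->
  (\int[P]_w (V w * \1_(H N) w * k (x + Y b w))%:E =
   \sum_j \int[P]_w (\1_(@D N j) w * V w * k (x + Y b w))%:E)%E.
Proof.
move=> mk kp; rewrite -ge0_integral_sum//.
- apply: eq_integral => w _; rewrite -sum1_D sumEFin; congr EFin.
  by rewrite mulrC mulr_sumr mulr_sumr; apply: eq_bigr => j _; ring.
- by move=> j; apply/measurable_EFinP; exact: mVDk.
- by move=> j w _; rewrite lee_fin !mulr_ge0.
Qed.

(** Apply [restart] at the first grid time of negativity, which is decided by the
    past at that time. *)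
Let at_grid N :
  (\int[P]_w (V w * \1_(H N) w * k1 (x + Y b w))%:E <=
   \int[P]_w (V w * \1_(H N) w * k2 (x + Y b w))%:E + \int[P]_w (errN N w)%:E)%E.
Proof.
rewrite !sum_DVk// (_ : \int[P]_w (errN N w)%:E = \sum_j \int[P]_w
   (\1_(@D N j) w * V w * (2 * err (x + Y (grid a b N j) w)))%:E)%E; last first.
  rewrite -ge0_integral_sum//.
  - apply: eq_integral => w _; rewrite sumEFin; congr EFin.
    by apply: eq_bigr => j _; ring.
  - move=> j; apply/measurable_EFinP/measurable_funM.
      by apply: measurable_funM => //; exact: measurable_indic (@mDT N j).
    apply: measurable_funM => //; apply: measurable_minr => //; apply: measurable_funM => //.
    by apply: measurableT_comp (mYT _).
  - by move=> j w _; rewrite lee_fin !mulr_ge0.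
rewrite -big_split /=; apply: lee_sum => j _.
have /andP[t1 t2] := @grid_itv _ a b N j ab (ltn_ord j).
apply: restart => //.
- exact: le_trans t1.
- by move=> w; rewrite mulr_ge0.
- apply: measurable_funM; first exact: measurable_indic (@mD N j).
  exact: (measurableT_comp mV (@measurable_past_mono _ _ _ _ B _ _ t1)).
Qed.

Let cvg_VHk (k : R -> R) : measurable_fun setT k -> (forall z, 0 <= k z <= M) ->
  (\int[P]_w (V w * \1_(H N) w * k (x + Y b w))%:E @[N --> \oo] -->
   \int[P]_w (V w * \1_(~` stays) w * k (x + Y b w))%:E)%E.
Proof.
move=> mk kM; apply: (@cvg_integral_bounded _ _ _ _ _ _ (C * M)).
- by move=> N; exact: mVHk.
- move=> N w; have /andP[p1 p2] := kM (x + Y b w).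
  rewrite !mulr_ge0//= ler_pM ?mulr_ge0//.
  by rewrite (@le_trans _ _ (V w))// ler_piMr// indicE; case: (_ \in _).
- move=> w; apply: cvgM; last exact: cvg_cst.
  by apply: cvgM (@cvg_H w); exact: cvg_cst.
Qed.

(** Optional stopping at the exit from the nonnegative half-line: at that moment the
    path sits at the origin, from where the tests [k1] and [k2] have the same
    expectation.  Exchanging [k1] and [k2] turns the inequality into an
    equality. *)
Lemma stopped_le :
  (\int[P]_w (V w * \1_(~` [set w | forall s, a <= s <= b -> (0 <= x + Y s w)%R]) w *
     k1 (x + Y b w))%:E <=
   \int[P]_w (V w * \1_(~` [set w | forall s, a <= s <= b -> (0 <= x + Y s w)%R]) w *
     k2 (x + Y b w))%:E)%E.
Proof.
have c1 := cvg_VHk mk1 (fun z => introT andP (conj (k1_ge0 z) (k1M z))).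
have c2 := cvg_VHk mk2 (fun z => introT andP (conj (k2_ge0 z) (k2M z))).
have c3 : (\int[P]_w (errN N w)%:E)%E @[N --> \oo] --> 0%E.
  rewrite -(@integral0 _ _ _ P setT).
  exact: (cvg_integral_bounded merrN errN_bound cvg_errN).
have ad (y : \bar R) : (y +? 0)%E by rewrite fin_num_adde_defl.
have c4 := cvgeD (ad _) c2 c3 _; rewrite adde0 in c4.
rewrite -(cvg_lim _ c1)// -(cvg_lim _ (c4 _))//.
apply: lee_lim.
- by apply/cvg_ex; eexists; exact: c1.
- by apply/cvg_ex; eexists; exact: (c4 _).
- by apply: nearW => N; exact: at_grid.
Qed.

End at_grid.

End optional_stopping.

(** * Bounded Lipschitz functions *)

Section bounded_lipschitz.
Context (R : realType).
Implicit Types f g : R -> R.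

(** Bounded and Lipschitz, with a common constant: the class of tests for which
    optional stopping on a grid has a vanishing error. *)
Definition blip f := exists2 C, 0 <= C &
  (forall x, `|f x| <= C) /\ (forall x y, `|f x - f y| <= C * `|x - y|).

Lemma blip_mul f g : blip f -> blip g -> blip (fun x => f x * g x).
Proof.
move=> [C C0 [fC fL]] [D D0 [gD gL]].
exists (2 * (C * D)); first by rewrite !mulr_ge0.
split=> [x|x y].
  rewrite normrM; apply: (@le_trans _ _ (C * D)); first by rewrite ler_pM.
  by rewrite ler_peMl ?mulr_ge0// ler1n.
rewrite (_ : _ - _ = f x * (g x - g y) + (f x - f y) * g y); last by ring.
rewrite (le_trans (ler_normD _ _))// !normrM.
rewrite (_ : 2 * _ * _ = C * (D * `|x - y|) + (C * `|x - y|) * D); last by ring.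
by rewrite lerD// ler_pM.
Qed.

Lemma blip_shift f c : blip f -> blip (fun x => f (x - c)).
Proof.
move=> [C C0 [fC fL]]; exists C => //; split=> // x y.
by rewrite (le_trans (fL _ _))// opprB addrA subrK.
Qed.

Lemma blip_reflect f : blip f -> blip (fun x => f (- x)).
Proof.
move=> [C C0 [fC fL]]; exists C => //; split=> // x y.
by rewrite (le_trans (fL _ _))// -opprD normrN.
Qed.

Lemma blip_continuous f : blip f -> continuous f.
Proof.
move=> [C C0 [_ fL]] x; apply/cvgrPdist_lt => e e0.
have C1 : 0 < C + 1 by rewrite ltr_wpDl.
near=> y; rewrite (le_lt_trans (fL _ _))//.
have xy : `|x - y| < e / (C + 1).
  by near: y; exists (e / (C + 1)) => //=; rewrite divr_gt0.
rewrite (@le_lt_trans _ _ ((C + 1) * `|x - y|)) ?ler_wpM2r ?lerDl//.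
by rewrite mulrC -ltr_pdivlMr.
Unshelve. all: by end_near. Qed.

Lemma blip_measurable f : blip f -> measurable_fun setT f.
Proof. by move=> /blip_continuous; exact: continuous_measurable_fun. Qed.

Lemma ler_normB_max (a b c : R) : `|Num.max a c - Num.max b c| <= `|a - b|.
Proof.
by rewrite !maxElt; case: ifPn; case: ifPn; rewrite -?leNgt => *;
  rewrite !ler_norml; have := ler_norm (a - b); have := ler_norm (b - a);
  rewrite (distrC b a) => *; apply/andP; split; lra.
Qed.

Lemma ler_normB_min (a b c : R) : `|Num.min a c - Num.min b c| <= `|a - b|.
Proof.
by rewrite !minElt; case: ifPn; case: ifPn; rewrite -?leNgt => *;
  rewrite !ler_norml; have := ler_norm (a - b); have := ler_norm (b - a);
  rewrite (distrC b a) => *; apply/andP; split; lra.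
Qed.

Lemma ler_normB_expR (a b c : R) : a <= c -> b <= c ->
  `|expR a - expR b| <= expR c * `|a - b|.
Proof.
wlog ba : a b / b <= a => [h ac bc|ac bc].
  have [ba|/ltW ab] := leP b a; first exact: h.
  by rewrite distrC [X in _ * X]distrC; exact: h.
rewrite !ger0_norm ?subr_ge0 ?ler_expR//.
have -> : expR a - expR b = expR a * (1 - expR (b - a)).
  by rewrite expRB; field; rewrite gt_eqF// expR_gt0.
have h := expR_ge1Dx (b - a).
rewrite ler_pM ?expR_ge0 ?ler_expR ?subr_ge0//; last lra.
by rewrite -expR0 ler_expR subr_le0.
Qed.

(** Trapezoids with edges of slope [n], increasing to the indicator of [(c, d)]. *)
Definition plateau (c d : R) (n : nat) (z : R) : R :=
  Num.max (Num.min (Num.min (n%:R * (z - c)) (n%:R * (d - z))) 1) 0.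

Lemma plateau_ge0 c d n z : 0 <= plateau c d n z.
Proof. by rewrite /plateau le_max lexx orbT. Qed.

Lemma plateau_le1 c d n z : plateau c d n z <= 1.
Proof. by rewrite /plateau ge_max ge_min lexx orbT ler01. Qed.

Lemma plateau_out c d n z : ~~ (c < z < d) -> plateau c d n z = 0.
Proof.
rewrite negb_and -!leNgt => h; apply/max_r; rewrite !ge_min.
case/orP: h => h; first by rewrite mulr_ge0_le0 ?subr_le0.
by rewrite [n%:R * (d - z) <= 0]mulr_ge0_le0 ?subr_le0// orbT.
Qed.

Lemma blip_plateau c d n : blip (plateau c d n).
Proof.
exists (n%:R + 1); first by rewrite addr_ge0.
split=> [x|x y].
  by rewrite ger0_norm ?plateau_ge0// (le_trans (plateau_le1 _ _ _ _))// lerDr.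
rewrite (le_trans (ler_normB_max _ _ _))// (le_trans (ler_normB_min _ _ _))//.
have h1 : `|n%:R * (x - c) - n%:R * (y - c)| <= (n%:R + 1) * `|x - y|.
  by rewrite -mulrBr opprB addrA subrK normrM ger0_norm// ler_wpM2r// lerDl.
have h2 : `|n%:R * (d - x) - n%:R * (d - y)| <= (n%:R + 1) * `|x - y|.
  rewrite -mulrBr (_ : _ - _ = y - x); last by ring.
  by rewrite normrM ger0_norm// distrC ler_wpM2r// lerDl.
move: h1 h2; rewrite !ler_norml => /andP[? ?] /andP[? ?].
by rewrite !minElt; case: ifPn; case: ifPn; rewrite -?leNgt => *; apply/andP; split; lra.
Qed.

Lemma le_plateau c d d' n k z : d <= d' -> (n <= k)%N ->
  plateau c d n z <= plateau c d' k z.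
Proof.
move=> dd nk; have [/andP[cz zd]|h] := boolP (c < z < d); last first.
  by rewrite plateau_out// plateau_ge0.
have nkR : n%:R <= k%:R :> R by rewrite ler_nat.
have h1 : n%:R * (z - c) <= k%:R * (z - c) by rewrite ler_wpM2r// subr_ge0 ltW.
have h2 : n%:R * (d - z) <= k%:R * (d' - z).
  by apply: ler_pM => //; [rewrite subr_ge0 ltW | rewrite lerB].
rewrite /plateau ge_max !le_max lexx orbT andbT; apply/orP; left.
by rewrite !le_min !ge_min h1 h2 lexx !orbT.
Qed.

Lemma plateau_eq1 c d (z e : R) n : 0 < e -> c + e <= z <= d - e ->
  e^-1 <= n%:R -> plateau c d n z = 1.
Proof.
move=> e0 /andP[cz zd] en.
have en1 : 1 <= n%:R * e by rewrite -ler_pdivrMr// div1r.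
have h1 : 1 <= n%:R * (z - c) by rewrite (le_trans en1)// ler_wpM2l//; lra.
have h2 : 1 <= n%:R * (d - z) by rewrite (le_trans en1)// ler_wpM2l//; lra.
by rewrite /plateau min_r ?le_min ?h1// max_l.
Qed.

Lemma cvg_plateau c d z :
  plateau c d n z @[n --> \oo] --> (\1_(`]c, d[%classic) z : R).
Proof.
rewrite indicE; have [zcd|zcd] := boolP (c < z < d); last first.
  rewrite memNset /=; last by rewrite in_itv; exact/negP.
  by apply: cvg_near_cst; apply: nearW => n; rewrite plateau_out.
rewrite mem_set /= ?in_itv//.
have /andP[cz zd] := zcd.
pose e := Num.min (z - c) (d - z).
have e0 : 0 < e by rewrite lt_min !subr_gt0 cz.
have ec : e <= z - c by rewrite ge_min lexx.
have ed : e <= d - z by rewrite ge_min lexx orbT.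
apply: cvg_near_cst; near=> n; apply: (plateau_eq1 e0); first by apply/andP; split; lra.
by near: n; exact: nbhs_infty_ger.
Unshelve. all: by end_near. Qed.

Lemma cvg_plateau_y (z : R) :
  plateau 0 n%:R n z @[n --> \oo] --> (\1_(`]0, +oo[%classic) z : R).
Proof.
rewrite indicE; have [z0|z0] := ltP 0 z; last first.
  rewrite memNset /=; last by rewrite in_itv/= andbT; apply/negP; rewrite -leNgt.
  apply: cvg_near_cst; apply: nearW => n; rewrite plateau_out//.
  by rewrite negb_and -leNgt z0.
rewrite mem_set /= ?in_itv/= ?z0//.
apply: cvg_near_cst; near=> n; apply: (plateau_eq1 z0).
  rewrite add0r lexx/= lerBrDl.
  by near: n; exact: nbhs_infty_ger.
by near: n; exact: nbhs_infty_ger.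
Unshelve. all: by end_near. Qed.

(** [1 - exp (- 2 m z)] is the probability that a Brownian motion of drift [m]
    never falls by more than [z]; it vanishes below the origin. *)
Definition escape (m z : R) : R := 1 - expR (- (2 * m * Num.max z 0)).

Lemma escape_ge0 m z : 0 <= m -> 0 <= escape m z.
Proof.
move=> m0; rewrite /escape subr_ge0 -expR0 ler_expR oppr_le0.
by rewrite !mulr_ge0// le_max lexx orbT.
Qed.

Lemma escape_le1 m z : escape m z <= 1.
Proof. by rewrite /escape gerBl expR_ge0. Qed.

Lemma escape_le0 m z : z <= 0 -> escape m z = 0.
Proof. by move=> z0; rewrite /escape max_r// mulr0 oppr0 expR0 subrr. Qed.

Lemma blip_escape m : 0 <= m -> blip (escape m).
Proof.
move=> m0; exists (1 + 2 * m); first by rewrite addr_ge0// mulr_ge0.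
split=> [x|x y].
  by rewrite ger0_norm ?escape_ge0// (le_trans (escape_le1 _ _))// lerDl mulr_ge0.
rewrite /escape opprB addrC addrA subrK.
have mx0 (z : R) : 0 <= Num.max z 0 by rewrite le_max lexx orbT.
rewrite (le_trans (@ler_normB_expR _ _ 0 _ _)) ?oppr_le0 ?mulr_ge0//.
rewrite expR0 mul1r opprK addrC -mulrBr normrM ger0_norm ?mulr_ge0//.
rewrite ler_pM ?mulr_ge0 ?lerDr//.
exact: ler_normB_max.
Qed.

(** The exponential weight of a reflection, frozen outside of [[0, c]] to make it
    bounded and Lipschitz. *)
Definition capped_exp (m c z : R) : R := expR (2 * m * Num.min (Num.max z 0) c).

Lemma blip_capped_exp m c : 0 <= m -> 0 <= c -> blip (capped_exp m c).
Proof.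
move=> m0 c0; exists ((1 + 2 * m) * expR (2 * m * c)).
  by rewrite mulr_ge0 ?expR_ge0// addr_ge0// mulr_ge0.
have hc (z : R) : 2 * m * Num.min (Num.max z 0) c <= 2 * m * c.
  by rewrite ler_wpM2l ?mulr_ge0// ge_min lexx orbT.
split=> [x|x y].
  rewrite ger0_norm ?expR_ge0//.
  rewrite (@le_trans _ _ (expR (2 * m * c))) ?ler_expR//.
  by rewrite ler_peMl ?expR_ge0// lerDl mulr_ge0.
rewrite (le_trans (ler_normB_expR (hc x) (hc y)))//.
rewrite -mulrBr normrM ger0_norm ?mulr_ge0//.
rewrite mulrA [(1 + _) * _]mulrC ler_pM ?mulr_ge0 ?expR_ge0//.
  by rewrite ler_wpM2l ?expR_ge0// lerDr.
by rewrite (le_trans (ler_normB_min _ _ _))// ler_normB_max.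
Qed.

End bounded_lipschitz.

(** * Brownian motion killed when it becomes negative *)

(** The density at [z] of a Brownian motion of drift [m] started from [y], at time
    [r], on the event that it has stayed nonnegative: the factor is the
    probability that a bridge from [y] to [z] does so. *)
Definition qden (R : realType) (m r y z : R) : R :=
  gden r (z - y - m * r) * (1 - expR (- (2 * y * z / r))).

Section killed.
Context d (T : measurableType d) (R : realType) (P : probability T R).
Variables (B : R -> {RV P >-> R}) (m : R).
Hypotheses (hB : brownian_motion B) (m0 : 0 <= m).
Local Notation Y t w := (B t w + m * t).
Local Notation mu := (@lebesgue_measure R).

Lemma qden_ge0 (r y z : R) : 0 < r -> 0 <= y -> 0 <= z -> 0 <= qden m r y z.
Proof.
move=> r0 y0 z0; rewrite mulr_ge0 ?gden_ge0// subr_ge0 -expR0 ler_expR.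
by rewrite oppr_le0 divr_ge0 ?mulr_ge0// ltW.
Qed.

Lemma qden0 (r z : R) : qden m r 0 z = 0.
Proof. by rewrite /qden mulr0 mul0r mul0r oppr0 expR0 subrr mulr0. Qed.

Lemma measurable_qden (r : R) : measurable_fun setT (fun p : R * R => qden m r p.1 p.2).
Proof.
have m1 := @measurable_fst _ _ R R; have m2 := @measurable_snd _ _ R R.
apply: measurable_funM.
  apply: (measurableT_comp (@measurable_gdenl R r)).
  by apply: measurable_funB => //; apply: measurable_funB.
apply: measurable_funB => //; apply: measurableT_comp => //.
apply: measurableT_comp => //; apply: measurable_funM => //.
by apply: measurable_funM => //; apply: measurable_funM.
Qed.

Lemma measurable_qdenr (r y : R) : measurable_fun setT (qden m r y).
Proof. exact: (measurableT_comp (measurable_qden r) (pair1_measurable y)). Qed.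

Let shift_test (k : R -> R) (r c : R) : measurable_fun setT k -> (forall z, 0 <= k z) ->
  (\int[mu]_z ((k (c + z)%R)%:E * (gden r z)%:E) =
   \int[mu]_z (k z * gden r (z - c)%R)%:E)%E.
Proof.
move=> mk k0.
rewrite -(@ge0_integral_translation R (fun z => (k z * gden r (z - c)%R)%:E) c).
- by apply: eq_integral => z _; rewrite addrK [(z + c)%R]addrC EFinM.
- apply/measurable_EFinP/measurable_funM => //.
  by apply: (measurableT_comp (@measurable_gdenl R r)); apply: measurable_funB.
- by move=> z; rewrite lee_fin mulr_ge0 ?gden_ge0.
Qed.

Variables (k1 : R -> R) (n : nat).
Hypotheses (bk1 : blip k1) (k1_ge0 : forall z, 0 <= k1 z).
Hypothesis k1_out : forall z, ~~ (0 < z < n%:R) -> k1 z = 0.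

(** The image of [k1] under the reflection at the origin; the exponential makes up
    for the drift, and [k1] vanishes where it is frozen. *)
Let k2 (z : R) : R := k1 (- z) * capped_exp m n%:R (- z).

Let bk2 : blip k2.
Proof.
apply: blip_mul; first exact: (blip_reflect bk1).
by apply: (@blip_reflect _ (capped_exp m n%:R)); exact: blip_capped_exp.
Qed.

Let k2_ge0 z : 0 <= k2 z.
Proof. by rewrite mulr_ge0// expR_ge0. Qed.

Let mk1 := blip_measurable bk1.
Let mk2 := blip_measurable bk2.

Let k1_0 : k1 0 = 0. Proof. by rewrite k1_out// ltxx. Qed.

Let k2_pos z : 0 <= z -> k2 z = 0.
Proof. by move=> z0; rewrite /k2 k1_out ?mul0r// oppr_gt0 ltNge z0. Qed.

Let image_density (r y z : R) : 0 < r ->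
  expR (2 * m * z) * gden r (z + y + m * r) =
  expR (- (2 * y * z / r)) * gden r (z - y - m * r).
Proof.
move=> r0; rewrite /gden mulrCA [RHS]mulrCA -!expRD; congr (_ * expR _).
by field; rewrite gt_eqF.
Qed.

(** The reflected test seen from [y] is the original one seen from [- y], by the
    symmetry [image_density] of the drifted Gaussian density. *)
Let image (r y : R) : 0 < r ->
  (\int[mu]_z ((k2 (y + m * r + z)%R)%:E * (gden r z)%:E) =
   \int[mu]_z (k1 z * (expR (- (2 * y * z / r)) * gden r (z - y - m * r)))%:E)%E.
Proof.
move=> r0; rewrite shift_test//.
rewrite -ge0_integral_reflection; last 2 first.
- apply/measurable_EFinP/measurable_funM => //.
  by apply: (measurableT_comp (@measurable_gdenl R r)); apply: measurable_funB.
- by move=> z; rewrite lee_fin mulr_ge0 ?gden_ge0.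
apply: eq_integral => z _; congr EFin; rewrite /k2 opprK.
have [/andP[z0 zn]|zn] := boolP (0 < z < n%:R); last by rewrite k1_out// !mul0r.
rewrite -image_density// -mulrA; congr (_ * (_ * _)).
  by rewrite /capped_exp max_l ?ltW// min_l// ltW.
by rewrite -[in LHS]gdenN; congr gden; ring.
Qed.

Let direct (r y : R) : 0 < r -> 0 <= y ->
  (\int[mu]_z ((k1 (y + m * r + z)%R)%:E * (gden r z)%:E) =
   \int[mu]_z (k1 z * qden m r y z)%:E +
   \int[mu]_z ((k2 (y + m * r + z)%R)%:E * (gden r z)%:E))%E.
Proof.
move=> r0 y0; rewrite image// shift_test// -ge0_integralD//.
- by apply: eq_integral => z _; rewrite -EFinD; congr EFin; rewrite /qden opprD addrA; ring.
- move=> z _; rewrite lee_fin.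
  have [/andP[z0 _]|zn] := boolP (0 < z < n%:R); last by rewrite k1_out// !mul0r.
  by apply: mulr_ge0 => //; apply: qden_ge0 => //; exact: ltW.
- by apply/measurable_EFinP/measurable_funM => //; exact: measurable_qdenr.
- by move=> z _; rewrite lee_fin !mulr_ge0 ?expR_ge0 ?gden_ge0.
- apply/measurable_EFinP/measurable_funM => //; apply: measurable_funM.
    apply: measurableT_comp => //; apply: measurableT_comp => //.
    by apply: measurable_funM => //; apply: measurable_funM.
  apply: (measurableT_comp (@measurable_gdenl R r)).
  by apply: measurable_funB => //; apply: measurable_funB.
Qed.

Let balance (r : R) : 0 < r ->
  (\int[mu]_z ((k1 (m * r + z)%R)%:E * (gden r z)%:E) =
   \int[mu]_z ((k2 (m * r + z)%R)%:E * (gden r z)%:E))%E.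
Proof.
move=> r0; have := direct r0 (lexx 0); rewrite !add0r => ->.
rewrite integral0_eq ?add0e// => z _.
by rewrite qden0 mulr0.
Qed.

Variables (a b x : R) (V : T -> R) (C : R).
Hypotheses (a0 : 0 <= a) (ab : a < b).
Hypotheses (V0 : forall w, 0 <= V w) (VC : forall w, V w <= C).
Hypothesis mV : measurable_fun setT (V : past B a -> R).
Hypothesis Va : forall w, V w != 0 -> 0 <= x + Y a w.

Let S : set T := [set w | forall s, a <= s <= b -> 0 <= x + Y s w].
Hypothesis mS : measurable S.

(** The paths that leave the nonnegative half-line do not distinguish the tests. *)
Let stopped_eq :
  (\int[P]_w (V w * \1_(~` S) w * k1 (x + Y b w))%:E =
   \int[P]_w (V w * \1_(~` S) w * k2 (x + Y b w))%:E)%E.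
Proof.
have [C1 C10 [k1C k1L]] := bk1; have [C2 C20 [k2C k2L]] := bk2.
pose M := C1 + C2.
have M0 : 0 <= M by rewrite addr_ge0.
have k1M z : k1 z <= M by rewrite (le_trans (ler_norm _))// (le_trans (k1C z))// lerDl.
have k2M z : k2 z <= M by rewrite (le_trans (ler_norm _))// (le_trans (k2C z))// lerDr.
have l1 z y : k1 z <= k1 y + M * `|z - y|.
  rewrite addrC -lerBlDr (le_trans (ler_norm _))// (le_trans (k1L z y))//.
  by rewrite ler_wpM2r// lerDl.
have l2 z y : k2 z <= k2 y + M * `|z - y|.
  rewrite addrC -lerBlDr (le_trans (ler_norm _))// (le_trans (k2L z y))//.
  by rewrite ler_wpM2r// lerDr.
apply/eqP; rewrite eq_le; apply/andP; split.
  apply: (@stopped_le _ _ _ P B m hB k1 k2 M M _ _ _ _ _ _ _ _ _ _ _ a b x V C) => //.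
  exact: ltW.
apply: (@stopped_le _ _ _ P B m hB k2 k1 M M _ _ _ _ _ _ _ _ _ _ _ a b x V C) => //.
- exact: k2_pos.
- by move=> r r0; rewrite balance.
- exact: ltW.
Qed.

Let mYT s : measurable_fun setT (fun w => x + Y s w).
Proof. by apply: measurable_funD => //; apply: measurable_funD. Qed.

Let mVT : measurable_fun setT V.
Proof. exact: (measurableT_comp mV (@measurable_to_past _ _ _ _ B a)). Qed.

Let mVk (k : R -> R) (D : set T) : measurable D -> blip k ->
  measurable_fun setT (fun w => V w * \1_D w * k (x + Y b w)).
Proof.
move=> mD bk; apply: measurable_funM.
  by apply: measurable_funM => //; exact: measurable_indic.
exact: (measurableT_comp (blip_measurable bk) (mYT b)).
Qed.

Let r0 : 0 < b - a. Proof. by rewrite subr_gt0. Qed.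

Let split_S (k : R -> R) : blip k -> (forall z, 0 <= k z) ->
  (\int[P]_w (V w * k (x + Y b w))%:E =
   \int[P]_w (V w * \1_S w * k (x + Y b w))%:E +
   \int[P]_w (V w * \1_(~` S) w * k (x + Y b w))%:E)%E.
Proof.
move=> bk k0; rewrite -ge0_integralD//.
- apply: eq_integral => w _; rewrite -EFinD -mulrDl -mulrDr (_ : \1_S w + _ = 1) ?mulr1//.
  by rewrite !indicE in_setC; case: (_ \in _); rewrite ?addr0 ?add0r.
- by move=> w _; rewrite lee_fin !mulr_ge0.
- by apply/measurable_EFinP; exact: mVk.
- by move=> w _; rewrite lee_fin !mulr_ge0.
- by apply/measurable_EFinP; apply: mVk => //; exact: measurableC.
Qed.

Let mF (k : R -> R) (q : R -> R -> R) : measurable_fun setT k ->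
  measurable_fun setT (fun p : R * R => q p.1 p.2) ->
  (forall y z, 0 <= y -> 0 <= k z * q y z) ->
  measurable_fun setT (fun w => (V w)%:E * \int[mu]_z (k z * q (Num.max (x + Y a w) 0) z)%:E)%E.
Proof.
move=> mk mq kq0; apply: emeasurable_funM; first exact/measurable_EFinP.
apply: (@measurable_fun_fubini_tonelli_F _ _ T (measurableTypeR R) R mu
  (fun p : T * R => (k p.2 * q (Num.max (x + Y a p.1) 0) p.2)%:E)).
- apply/measurable_EFinP/measurable_funM.
    by apply: (measurableT_comp mk); exact: measurable_snd.
  have mm : measurable_fun setT (fun p : T * R => Num.max (x + Y a p.1) 0).
    by apply: measurable_maxr => //; apply: (measurableT_comp (mYT a)); exact: measurable_fst.
  by apply: (measurableT_comp mq (measurable_fun_pair mm _)); exact: measurable_snd.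
- by move=> p; rewrite lee_fin kq0// le_max lexx orbT.
Qed.

(** The reflection principle.  Subtract the expectation of [k2] from that of [k1]:
    the paths outside of [S] cancel by [stopped_eq], and [k2] vanishes at the end
    of the paths in [S].  By [direct] the Gaussian integrals of the two tests
    differ by an integral against [qden]. *)
Lemma killed_test :
  (\int[P]_w (V w * \1_S w * k1 (x + Y b w))%:E =
   \int[P]_w ((V w)%:E *
     \int[mu]_z (k1 z * qden m (b - a) (Num.max (x + Y a w) 0) z)%:E))%E.
Proof.
have C0 : 0 <= C by exact: le_trans (V0 point) (VC point).
have S2 : (\int[P]_w (V w * \1_S w * k2 (x + Y b w))%:E = 0)%E.
  apply: integral0_eq => w _; rewrite indicE.
  have [/set_mem wS|_] := boolP (w \in S); last by rewrite mulr0 mul0r.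
  by rewrite k2_pos ?mulr0//; apply: wS; rewrite lexx ltW.
have E2 := split_S bk2 k2_ge0; rewrite S2 add0e -stopped_eq in E2.
have fin2 : (\int[P]_w (V w * k2 (x + Y b w))%:E)%E \is a fin_num.
  rewrite ge0_fin_numE; last by apply: integral_ge0 => w _; rewrite lee_fin mulr_ge0.
  have [C2 C20 [k2C _]] := bk2.
  apply: (@le_lt_trans _ _ (\int[P]_w (C * C2)%:E)%E).
    apply: ge0_le_integral => //=.
    - by move=> w _; rewrite lee_fin mulr_ge0.
    - apply/measurable_EFinP/measurable_funM => //.
      exact: (measurableT_comp (blip_measurable bk2) (mYT b)).
    - by move=> w _; rewrite lee_fin ler_pM// (le_trans (ler_norm _)).
  rewrite integral_cst//; apply: (@le_lt_trans _ _ ((C * C2)%:E * 1)%E); last first.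
    by rewrite mule1 ltry.
  by apply: lee_wpmul2l; [rewrite lee_fin mulr_ge0|exact: probability_le1].
(* add the finite expectation of [k2] to both sides *)
rewrite -[LHS](addeK _ fin2) -[RHS](addeK _ fin2); congr (_ - _)%E.
rewrite {1}E2 -split_S//.
rewrite (@past_expectation _ _ _ _ _ m hB k1 V a b x)//.
rewrite (@past_expectation _ _ _ _ _ m hB k2 V a b x)//.
have q0 y z : 0 <= y -> 0 <= k1 z * qden m (b - a) y z.
  move=> y0; have [/andP[z0 _]|zn] := boolP (0 < z < n%:R); last first.
    by rewrite k1_out// !mul0r.
  by apply: mulr_ge0 => //; apply: qden_ge0 => //; exact: ltW.
have f0 w : (0 <= \int[mu]_z
    ((k2 (x + Y a w + m * (b - a) + z)%R)%:E * (gden (b - a) z)%:E))%E.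
  by apply: integral_ge0 => z _; rewrite -EFinM lee_fin mulr_ge0 ?gden_ge0.
rewrite -ge0_integralD//.
- apply: eq_integral => w _; rewrite -ge0_muleDr ?f0//; last first.
    by apply: integral_ge0 => z _; rewrite lee_fin q0// le_max lexx orbT.
  have [->|Vw] := eqVneq (V w) 0; first by rewrite !mul0e.
  by rewrite (direct r0 (Va Vw)) (max_l (Va Vw)).
- move=> w _; apply: mule_ge0; first by rewrite lee_fin.
  by apply: integral_ge0 => z _; rewrite lee_fin q0// le_max lexx orbT.
- by apply: (mF (q := fun y z => qden m (b - a) y z)) => //; exact: measurable_qden.
- by move=> w _; apply: mule_ge0; rewrite ?lee_fin.
- apply: emeasurable_funM; first exact/measurable_EFinP.
  apply: (@measurable_fun_fubini_tonelli_F _ _ T (measurableTypeR R) R mu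
    (fun p : T * R => (k2 (x + Y a p.1 + m * (b - a) + p.2)%R)%:E * (gden (b - a) p.2)%:E)%E).
  + apply/measurable_EFinP/measurable_funM; last first.
      by apply: (measurableT_comp (@measurable_gdenl _ _)); exact: measurable_snd.
    apply: (measurableT_comp mk2); apply: measurable_funD; last exact: measurable_snd.
    by apply: measurable_funD => //; apply: (measurableT_comp (mYT a)); exact: measurable_fst.
  + by move=> p; rewrite -EFinM lee_fin mulr_ge0 ?gden_ge0.
Qed.

End killed.

(** * The law of a drifted Brownian motion that stays nonnegative *)

Section nonnegative_paths.
Context d (T : measurableType d) (R : realType) (P : probability T R).
Variables (B : R -> {RV P >-> R}) (m : R).
Hypotheses (hB : brownian_motion B) (m0 : 0 < m).
Local Notation Y t w := (B t w + m * t).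
Local Notation mu := (@lebesgue_measure R).

Definition stays (x a b : R) : set T :=
  [set w | forall s, a <= s <= b -> 0 <= x + Y s w].

Definition stays_forever (x a : R) : set T :=
  [set w | forall s, a <= s -> 0 <= x + Y s w].

Let mYT x s : measurable_fun setT (fun w => x + Y s w).
Proof. by apply: measurable_funD => //; apply: measurable_funD. Qed.

Let path x w s := x + (B (Num.max s 0) w + m * s).

Let continuous_path x w : continuous (path x w).
Proof.
have [_ cB _ _] := hB; have c := continuous_max0 (cB w).
move=> s; apply: cvgD; first exact: cvg_cst.
apply: cvgD; first exact: c.
by apply: cvgM; [exact: cvg_cst|exact: cvg_id].
Qed.

Lemma measurable_stays_past x a b : 0 <= a -> a <= b ->
  measurable (stays x a b : set (past B b)).
Proof.
move=> a0 ab.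
rewrite (_ : stays x a b = \bigcap_N \bigcap_(j in [set: 'I_N.+2])
   ((fun w => x + Y (grid a b N j) w) @^-1` `[0, +oo[%classic)); last first.
  apply/seteqP; split => w /=.
    move=> sw N _ j _ /=; rewrite in_itv/= andbT; apply: sw.
    exact: (@grid_itv _ a b N j ab (ltn_ord j)).
  move=> hw s sab; rewrite leNgt; apply/negP => ns.
  have ps : path x w s < 0 by rewrite /path max_l// (le_trans a0)//; case/andP: sab.
  have [N _ /(_ N (leqnn N)) [j]] := grid_hits (@continuous_path x w) ab sab ps.
  have /andP[aj _] := @grid_itv _ a b N j ab (ltn_ord j).
  rewrite /path max_l ?(le_trans a0)// ltNge.
  by have := hw N I j I; rewrite /= in_itv/= andbT => ->.
apply: bigcapT_measurable => N; apply: fin_bigcap_measurable => // j _.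
rewrite -[X in measurable X]setTI.
have /andP[aj jb] := @grid_itv _ a b N j ab (ltn_ord j).
have mm : measurable_fun setT ((fun w => x + Y (grid a b N j) w) : past B b -> R).
  apply: measurable_funD => //; apply: measurable_funD => //.
  by apply: measurable_past; rewrite jb (le_trans a0).
exact: mm.
Qed.

Lemma measurable_stays x a b : 0 <= a -> a <= b -> measurable (stays x a b).
Proof.
move=> a0 ab; have := @measurable_to_past _ _ _ _ B b measurableT _ (measurable_stays_past x a0 ab).
by rewrite setTI.
Qed.

Lemma stays_foreverE x a : stays_forever x a = \bigcap_n stays x a (a + n.+1%:R).
Proof.
apply/seteqP; split => w /=; first by move=> sw n _ s /andP[as_ _]; exact: sw.
move=> h s as_; apply: (h (Num.truncn (s - a)) I); rewrite as_ -lerBlDl.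
by rewrite ltW// truncnS_gt.
Qed.

Lemma measurable_stays_forever x a : 0 <= a -> measurable (stays_forever x a).
Proof.
move=> a0; rewrite stays_foreverE; apply: bigcapT_measurable => n.
by apply: measurable_stays => //; rewrite lerDl.
Qed.

(** [killed_test] for tests that need not vanish outside of a compact subset of the
    positive half-line, by monotone convergence along plateaus.  [V] is restricted
    to the paths that are nonnegative at time [a], on which alone
    [killed_test] speaks. *)
Lemma killed_law (a b x : R) (V : T -> R) (C : R) (k : R -> R) : 0 <= a -> a < b ->
  (forall w, 0 <= V w) -> (forall w, V w <= C) ->
  measurable_fun setT (V : past B a -> R) -> blip k -> (forall z, 0 <= k z) ->
  (\int[P]_w (V w * \1_(stays x a b) w *
     (k (x + Y b w) * \1_(`]0, +oo[%classic) (x + Y b w)))%:E =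
   \int[P]_w ((V w)%:E * \int[mu]_z (k z * \1_(`]0%R, +oo[%classic) z *
     qden m (b - a) (Num.max (x + Y a w) 0) z)%:E))%E.
Proof.
move=> a0 ab V0 VC mV bk k0.
have mS := measurable_stays x a0 (ltW ab).
pose kn n z := k z * plateau 0 n%:R n z.
have bkn n : blip (kn n) by apply: blip_mul => //; exact: blip_plateau.
have kn0 n z : 0 <= kn n z by rewrite mulr_ge0// plateau_ge0.
have kn_out n z : ~~ (0 < z < n%:R) -> kn n z = 0.
  by move=> h; rewrite /kn plateau_out// mulr0.
pose V' w := V w * \1_(stays x a a) w.
have mSa := measurable_stays_past x a0 (lexx a).
have V'0 w : 0 <= V' w by rewrite mulr_ge0.
have V'V w : V' w <= V w by rewrite ler_piMr// indicE; case: (_ \in _).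
have V'C w : V' w <= C by rewrite (le_trans (V'V w)).
have mV' : measurable_fun setT (V' : past B a -> R).
  by apply: measurable_funM => //; exact: measurable_indic.
have V'a w : V' w != 0 -> 0 <= x + Y a w.
  rewrite /V' indicE; have [/set_mem + _|_] := boolP (_ \in _); last by rewrite mulr0 eqxx.
  by apply; rewrite lexx.
have H n := @killed_test _ _ _ _ B m hB (ltW m0) (kn n) n (bkn n) (kn0 n) (kn_out n)
  a b x V' C a0 ab V'0 V'C mV' V'a mS.
have VV'S w : V' w * \1_(stays x a b) w = V w * \1_(stays x a b) w.
  rewrite [\1_(stays x a b) w]indicE.
  have [/set_mem sw|_] := boolP (w \in stays x a b); last by rewrite !mulr0.
  rewrite !mulr1 /V' indicE mem_set ?mulr1// => s /andP[as_ sa].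
  by apply: sw; rewrite as_ (le_trans sa)// ltW.
have mVT : measurable_fun setT V.
  exact: (measurableT_comp mV (@measurable_to_past _ _ _ _ B a)).
have mknT n := blip_measurable (bkn n).
have b0 : 0 < b - a by rewrite subr_gt0.
have max0 (y : R) : 0 <= Num.max y 0 by rewrite le_max lexx orbT.
have q0 n y z : 0 <= y -> 0 <= kn n z * qden m (b - a) y z.
  move=> y0; have [/andP[z0 _]|zn] := boolP (0 < z < n%:R); last first.
    by rewrite kn_out// !mul0r.
  by apply: mulr_ge0 => //; apply: qden_ge0 => //; exact: ltW.
have ndkn z : {homo (fun n => kn n z) : n l / (n <= l)%N >-> n <= l}.
  by move=> n l nl; rewrite ler_wpM2l// le_plateau// ler_nat.
have ckn z : kn n z @[n --> \oo] --> k z * \1_(`]0, +oo[%classic) z.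
  by apply: cvgM; [exact: cvg_cst|exact: cvg_plateau_y].
have mmax : measurable_fun setT (fun p : T * R => Num.max (x + Y a p.1) 0).
  by apply: measurable_maxr => //; apply: (measurableT_comp (mYT x a)); exact: measurable_fst.
have mint n : measurable_fun setT (fun p : T * R =>
    (kn n p.2 * qden m (b - a) (Num.max (x + Y a p.1) 0) p.2)%:E).
  apply/measurable_EFinP/measurable_funM.
    by apply: (measurableT_comp (mknT n)); exact: measurable_snd.
  apply: (measurableT_comp (@measurable_qden _ m (b - a)) (measurable_fun_pair mmax _)).
  exact: measurable_snd.
have mintw n w : measurable_fun setT (fun z : R =>
    (kn n z * qden m (b - a) (Num.max (x + Y a w) 0) z)%:E).
  exact: (measurableT_comp (mint n) (pair1_measurable w)).
pose Q n w := (\int[mu]_z (kn n z * qden m (b - a) (Num.max (x + Y a w) 0) z)%:E)%E.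
have Q0 n w : (0 <= Q n w)%E by apply: integral_ge0 => z _; rewrite lee_fin q0.
have ndQ w : {homo (fun n => Q n w) : n l / (n <= l)%N >-> (n <= l)%E}.
  move=> n l nl; apply: ge0_le_integral => //=.
  - by move=> z _; rewrite lee_fin q0.
  - exact: mintw.
  - exact: mintw.
  - move=> z _; rewrite lee_fin.
    have [z0|z0] := ltP 0 z; first by rewrite ler_wpM2r ?ndkn// qden_ge0// ltW.
    by rewrite !kn_out ?mul0r// negb_and -leNgt z0.
have cL : (\int[P]_w (V' w * \1_(stays x a b) w * kn n (x + Y b w))%:E)%E @[n --> \oo] -->
    (\int[P]_w (V w * \1_(stays x a b) w *
     (k (x + Y b w) * \1_(`]0%R, +oo[%classic) (x + Y b w)))%:E)%E.
  apply: cvg_integral_monotone.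
  - move=> n; apply/measurable_EFinP/measurable_funM.
      under eq_fun do rewrite VV'S.
      by apply: measurable_funM => //; exact: measurable_indic.
    exact: (measurableT_comp (mknT n) (mYT x b)).
  - by move=> n w; rewrite lee_fin; apply: mulr_ge0; [apply: mulr_ge0|exact: kn0].
  - move=> w n l nl; rewrite lee_fin; apply: ler_wpM2l; last exact: ndkn.
    exact: mulr_ge0.
  - move=> w; apply: cvg_EFin; first exact: nearW.
    rewrite -VV'S; apply: cvgM; [exact: cvg_cst|exact: ckn].
have cR : (\int[P]_w ((V' w)%:E * Q n w))%E @[n --> \oo] -->
   (\int[P]_w ((V w)%:E * \int[mu]_z (k z * \1_(`]0%R, +oo[%classic) z *
     qden m (b - a) (Num.max (x + Y a w) 0) z)%:E))%E.
  apply: cvg_integral_monotone.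
  - move=> n; apply: emeasurable_funM.
      apply/measurable_EFinP; apply: measurable_funM => //; apply: measurable_indic.
      exact: measurable_stays.
    apply: (@measurable_fun_fubini_tonelli_F _ _ T (measurableTypeR R) R mu
      (fun p : T * R => (kn n p.2 * qden m (b - a) (Num.max (x + Y a p.1) 0) p.2)%:E)).
      exact: mint.
    by move=> p; rewrite lee_fin q0.
  - by move=> n w; apply: mule_ge0; rewrite ?lee_fin.
  - by move=> w n l nl; apply: lee_wpmul2l; [rewrite lee_fin|exact: ndQ].
  - move=> w.
    have cQ : Q n w @[n --> \oo] --> (\int[mu]_z (k z * \1_(`]0%R, +oo[%classic) z *
       qden m (b - a) (Num.max (x + Y a w) 0) z)%:E)%E.
      apply: cvg_integral_monotone => //.
      + by move=> n; exact: mintw.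
      + by move=> n z; rewrite lee_fin q0.
      + move=> z n l nl; rewrite lee_fin.
        have [z0|z0] := ltP 0 z; first by rewrite ler_wpM2r ?ndkn// qden_ge0// ltW.
        by rewrite !kn_out ?mul0r// negb_and -leNgt z0.
      + move=> z; apply: cvg_EFin; first exact: nearW.
        by apply: cvgM; [exact: ckn|exact: cvg_cst].
    have [wa|] := boolP (0 <= x + Y a w); last rewrite -ltNge => wa.
      have -> : V' w = V w.
        by rewrite /V' indicE mem_set ?mulr1// => s; rewrite -eq_le => /eqP <-.
      by apply: cvgeZl.
    rewrite [X in _ --> X](_ : _ = 0%E); last first.
      rewrite integral0_eq ?mule0// => z _.
      by rewrite max_r ?ltW// qden0 mulr0.
    apply: cvg_near_cst; apply: nearW => n; rewrite /Q integral0_eq ?mule0// => z _.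
    by rewrite max_r ?ltW// qden0 mulr0.
have HQ : (fun n => \int[P]_w (V' w * \1_(stays x a b) w * kn n (x + Y b w))%:E)%E =
    (fun n => \int[P]_w ((V' w)%:E * Q n w))%E by apply/funext => n; exact: H.
by rewrite HQ in cL; exact: (cvg_unique _ cL cR).
Qed.

(** The probability that a Brownian motion of drift [m] started from [- c] is
    positive at time [r]. *)
Let halfline (r c : R) : \bar R :=
  (\int[mu]_(z in `]0%R, +oo[) (gden r (z + c - m * r)%R)%:E)%E.

Let mshift (r c : R) (D : set (measurableTypeR R)) :
  measurable_fun D (fun z : R => (gden r (z + c - m * r)%R)%:E).
Proof.
apply/measurable_funTS/measurable_EFinP.
apply: (measurableT_comp (@measurable_gdenl R r)).
by apply: measurable_funB => //; apply: measurable_funD.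
Qed.

Let halfline_le1 (r c : R) : 0 < r -> (halfline r c <= 1)%E.
Proof.
move=> r0; rewrite -(integral_gden_shift (c - m * r) r0).
under [X in (_ <= X)%E]eq_integral do rewrite addrA.
by apply: ge0_subset_integral => // z _; rewrite lee_fin gden_ge0.
Qed.

(** Chernoff's bound: on the negative half-line, the tilt that removes the drift
    bounds the density. *)
Let halfline_ge (r c : R) : 0 < r ->
  (1 - (expR (m * c - m ^+ 2 * r / 2))%:E <= halfline r c)%E.
Proof.
move=> r0; rewrite leeBlDr//.
have <- : (halfline r c + \int[mu]_(z in `]-oo, 0%R]) (gden r (z + c - m * r)%R)%:E = 1)%E.
  rewrite -(integral_gden_shift (c - m * r) r0).
  under [RHS]eq_integral do rewrite addrA.
  transitivity (\int[mu]_(z in (`]-oo, 0%R]%classic `|` `]0%R, +oo[%classic))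
      (gden r (z + c - m * r)%R)%:E)%E; last first.
    by rewrite -(@itv_bndbnd_setU _ R -oo%O (BRight 0) +oo%O)// set_itvNyy.
  rewrite ge0_integral_setU//=; last 2 first.
  - by move=> z _; rewrite lee_fin gden_ge0.
  - apply/disj_setPLR => z /=; rewrite !in_itv/= andbT => z0.
    by apply/negP; rewrite -leNgt.
  by rewrite addeC.
apply: leeD2l.
rewrite -[leRHS]mule1 -(integral_gden_shift c r0).
rewrite -ge0_integralZl//=; last 2 first.
- apply/measurable_EFinP/(measurableT_comp (@measurable_gdenl R r)).
  exact: measurable_funD.
- by move=> z _; rewrite lee_fin gden_ge0.
have mm : measurable_fun setT (fun z : R => ((expR (m * c - m ^+ 2 * r / 2))%:E *
    (gden r (z + c)%R)%:E)%E).
  apply: emeasurable_funM => //.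
  apply/measurable_EFinP/(measurableT_comp (@measurable_gdenl R r)).
  exact: measurable_funD.
apply: (@le_trans _ _ (\int[mu]_(z in `]-oo, 0%R])
  ((expR (m * c - m ^+ 2 * r / 2))%:E * (gden r (z + c)%R)%:E))%E).
  apply: ge0_le_integral => //=.
  - by move=> z _; rewrite lee_fin gden_ge0.
  - exact: measurable_funTS.
  - move=> z; rewrite in_itv/= => z0; rewrite -EFinM lee_fin.
    have := gden_tilt (z + c) m r0 => e.
    have -> : gden r (z + c - m * r) =
        expR (m * (z + c) - m ^+ 2 * r / 2) * gden r (z + c).
      by rewrite expRB mulrAC e; field; rewrite gt_eqF// expR_gt0.
    by rewrite ler_wpM2r ?gden_ge0// ler_expR lerB// ler_wpM2l ?(ltW m0)// gerDr.
apply: ge0_subset_integral => //.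
by move=> z _; rewrite -EFinM lee_fin mulr_ge0 ?expR_ge0 ?gden_ge0.
Qed.

Let halfline_fin (r c : R) : 0 < r -> halfline r c \is a fin_num.
Proof.
move=> r0; rewrite ge0_fin_numE; first by rewrite (le_lt_trans (halfline_le1 c r0))// ltry.
by apply: integral_ge0 => z _; rewrite lee_fin gden_ge0.
Qed.

Let cvg_halfline (c : R) : fine (halfline n.+1%:R c) @[n --> \oo] --> (1 : R).
Proof.
have ce : 1 - expR (m * c - m ^+ 2 * n.+1%:R / 2) @[n --> \oo] --> (1 : R).
  rewrite -[X in _ --> X]subr0; apply: cvgB; first exact: cvg_cst.
  under eq_fun do rewrite expRD.
  rewrite -(mulr0 (expR (m * c))); apply: cvgM; first exact: cvg_cst.
  have h : m ^+ 2 * n.+1%:R / 2 @[n --> \oo] --> (+oo : set_system R).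
    apply/cvgryPge => A; near=> n.
    rewrite ler_pdivlMr// -ler_pdivrMl ?exprn_gt0//.
    rewrite (@le_trans _ _ n%:R) ?ler_nat//.
    by near: n; exact: nbhs_infty_ger.
  exact: (cvg_comp _ _ h (@cvgr_expR R)).
have c1 : (1 : R) @[_ --> \oo] --> (1 : R) by exact: cvg_cst.
apply: (squeeze_cvgr _ ce c1); apply: nearW => n.
have n0 : 0 < n.+1%:R :> R by rewrite ltr0n.
rewrite -!lee_fin fineK ?halfline_fin// EFinB halfline_ge//=.
exact: halfline_le1.
Unshelve. all: by end_near. Qed.

(** The probability of staying nonnegative until time [r], from [y]. *)
Let survival (r y : R) : \bar R :=
  (\int[mu]_z (1 * \1_(`]0%R, +oo[%classic) z * qden m r y z)%:E)%E.

(** [qden] is a Gaussian density minus a multiple of its image, so its mass is a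
    difference of two half-line probabilities, both tending to [1]. *)
Let survivalE (r y : R) : 0 < r -> 0 <= y ->
  (halfline r (- y) = survival r y + (expR (- (2 * m * y)))%:E * halfline r y)%E.
Proof.
move=> r0 y0; rewrite /halfline -ge0_integralZl//=; last first.
  by move=> z _; rewrite lee_fin gden_ge0.
rewrite integral_mkcond [X in (_ + X)%E]integral_mkcond /survival -ge0_integralD//=.
- apply: eq_integral => z _; rewrite !patchE indicE.
  have [/set_mem|_] := boolP (z \in _); last by rewrite mulr0 mul0r adde0.
  rewrite /= in_itv/= andbT => z0; rewrite mulr1 mul1r -EFinM -EFinD; congr EFin.
  have e : expR (- (2 * m * y)) * gden r (z + y - m * r) =
      gden r (z - y - m * r) * expR (- (2 * y * z / r)).
    rewrite /gden mulrCA -[RHS]mulrA -!expRD; congr (_ * expR _).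
    by field; rewrite gt_eqF.
  by rewrite /qden e mulrBr mulr1 subrK.
- move=> z _; rewrite lee_fin mul1r indicE.
  have [/set_mem|_] := boolP (z \in _); last by rewrite mul0r.
  by rewrite /= in_itv/= andbT mul1r => z0; apply: qden_ge0 => //; exact: ltW.
- apply/measurable_EFinP; apply: measurable_funM; last exact: measurable_qdenr.
  by apply: measurable_funM => //; exact: measurable_indic.
- move=> z _; rewrite patchE; case: ifPn => // _.
  by rewrite -EFinM lee_fin mulr_ge0 ?expR_ge0 ?gden_ge0.
- apply/(measurable_restrictT _ _).1 => //.
  by apply: emeasurable_funM => //; exact: mshift.
Qed.

Let survival_ge0 (r y : R) : 0 < r -> 0 <= y -> (0 <= survival r y)%E.
Proof.
move=> r0 y0; apply: integral_ge0 => z _; rewrite lee_fin mul1r indicE.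
have [/set_mem|_] := boolP (z \in _); last by rewrite mul0r.
by rewrite /= in_itv/= andbT mul1r => z0; apply: qden_ge0 => //; exact: ltW.
Qed.

Let survival_fin (r y : R) : 0 < r -> 0 <= y ->
  survival r y = (fine (halfline r (- y)) - expR (- (2 * m * y)) * fine (halfline r y))%:E.
Proof.
move=> r0 y0; have := survivalE r0 y0.
rewrite -(fineK (halfline_fin (- y) r0)) -(fineK (halfline_fin y r0)) -EFinM => h.
by rewrite EFinB h /= addeK.
Qed.

Let cvg_survival (y : R) : 0 <= y ->
  fine (survival n.+1%:R y) @[n --> \oo] --> escape m y.
Proof.
move=> y0; rewrite (_ : (fun n : nat => fine (survival n.+1%:R y)) =
  (fun n : nat => fine (halfline n.+1%:R (- y)) - expR (- (2 * m * y)) * fine (halfline n.+1%:R y))).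
  rewrite /escape max_l// -[X in _ --> _ - X]mulr1.
  apply: cvgB; first exact: cvg_halfline.
  by apply: cvgM; [exact: cvg_cst|exact: cvg_halfline].
by apply/funext => n; rewrite survival_fin.
Qed.

Let survival_le1 (r y : R) : 0 < r -> 0 <= y -> (survival r y <= 1)%E.
Proof.
move=> r0 y0; rewrite (le_trans _ (halfline_le1 (- y) r0))// survivalE// leeDl//.
apply: mule_ge0; first by rewrite lee_fin expR_ge0.
by apply: integral_ge0 => z _; rewrite lee_fin gden_ge0.
Qed.

Let measurable_survival (r : R) : 0 < r ->
  measurable_fun setT (fun y : R => fine (survival r (Num.max y 0))).
Proof.
move=> r0; apply: measurableT_comp => //.
have max0 (y : R) : 0 <= Num.max y 0 by rewrite le_max lexx orbT.
apply: (@measurable_fun_fubini_tonelli_F _ _ R (measurableTypeR R) R mu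
  (fun p : R * R => (1 * \1_(`]0, +oo[%classic) p.2 * qden m r (Num.max p.1 0) p.2)%:E)).
- apply/measurable_EFinP; apply: measurable_funM.
    by apply: measurable_funM => //; apply: measurableT_comp.
  apply: (measurableT_comp (@measurable_qden _ m r) (measurable_fun_pair _ _)) => //.
  by apply: measurable_maxr.
- move=> p; rewrite lee_fin mul1r indicE.
  have [/set_mem|_] := boolP (p.2 \in _); last by rewrite mul0r.
  by rewrite /= in_itv/= andbT mul1r => z0; apply: qden_ge0 => //; exact: ltW.
Qed.

(** Being nonnegative and being positive at a fixed time are almost surely the
    same. *)
Lemma no_atom (t c : R) : 0 < t -> {ae P, forall w, B t w != c}.
Proof.
move=> t0; exists (B t @^-1` [set c]); split.
- by rewrite -[X in measurable X]setTI; exact: measurable_funPT.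
- transitivity (\int[P]_w (\1_([set c] : set R) (B t w))%:E)%E.
    rewrite -[in LHS](setTI (_ @^-1` _)) setIC -integral_indic//.
  rewrite (@brownian_marginal _ _ _ _ _ hB t (fun z => (\1_([set c] : set R) z)%:E))//.
    rewrite (_ : \int[mu]_z _ = \int[mu]_(z in [set c]) (gden t z)%:E)%E.
      exact: integral_set1.
    rewrite [RHS]integral_mkcond; apply: eq_integral => z _; rewrite patchE indicE.
    by case: (_ \in _); rewrite ?mul1e ?mul0e.
  by apply/measurable_EFinP; exact: measurable_indic.
- by move=> w /=; apply: contra_notP => /eqP.
Qed.

(** Letting the horizon tend to infinity: from height [y] the path stays
    nonnegative for ever with probability [escape m y]. *)
Lemma escape_law (a x : R) (V : T -> R) (C : R) : 0 <= a ->
  (forall w, 0 <= V w) -> (forall w, V w <= C) ->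
  measurable_fun setT (V : past B a -> R) ->
  (\int[P]_w (V w * \1_(stays_forever x a) w)%:E =
   \int[P]_w (V w * escape m (x + Y a w))%:E)%E.
Proof.
move=> a0 V0 VC mV.
have C0 : 0 <= C by exact: le_trans (V0 point) (VC point).
have mVT : measurable_fun setT V.
  exact: (measurableT_comp mV (@measurable_to_past _ _ _ _ B a)).
have b1 : blip (fun _ : R => 1 : R).
  by exists 1 => //; split=> [z|z y]; rewrite ?normr1// subrr normr0 mul1r.
have an n : a < a + n.+1%:R by rewrite ltrDl.
have mS n := measurable_stays x a0 (ltW (an n)).
have max0 (y : R) : 0 <= Num.max y 0 by rewrite le_max lexx orbT.
have n0 n : 0 < n.+1%:R :> R by rewrite ltr0n.
have mpos : measurable_fun setT (\1_(`]0, +oo[%classic) : R -> R).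
  exact: measurable_indic.
have H n : (\int[P]_w (V w * \1_(stays x a (a + n.+1%:R)) w)%:E =
   \int[P]_w (V w * fine (survival n.+1%:R (Num.max (x + Y a w) 0)))%:E)%E.
  have := @killed_law a (a + n.+1%:R) x V C _ a0 (an n) V0 VC mV b1 (fun _ => ler01).
  rewrite [in RHS]addrC addKr.
  move=> h; transitivity (\int[P]_w (V w * \1_(stays x a (a + n.+1%:R)) w *
      (1 * \1_(`]0%R, +oo[%classic) (x + Y (a + n.+1%:R) w)))%:E)%E.
    apply: ae_eq_integral => //.
    - by apply/measurable_EFinP; apply: measurable_funM.
    - apply/measurable_EFinP; apply: measurable_funM.
        by apply: measurable_funM => //; exact: measurable_indic.
      apply: measurable_funM => //.
      exact: (measurableT_comp mpos (mYT x _)).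
    - have bn : 0 < a + n.+1%:R by rewrite ltr_wpDl.
      have := no_atom (- x - m * (a + n.+1%:R)) bn.
      apply: filterS => w Bw _; congr EFin.
      rewrite [\1_(stays _ _ _) w]indicE.
      have [/set_mem sw|_] := boolP (w \in stays _ _ _); last by rewrite mulr0 mul0r.
      rewrite mul1r indicE mem_set ?mulr1//= in_itv/= andbT lt_neqAle.
      rewrite sw ?lexx ?(ltW (an n))// andbT eq_sym.
      by apply: contra_neq Bw => e; lra.
  rewrite h; apply: eq_integral => w _; rewrite EFinM fineK//.
  rewrite ge0_fin_numE ?survival_ge0//.
  by rewrite (le_lt_trans (survival_le1 (n0 n) (max0 _)))// ltry.
have cL : (\int[P]_w (V w * \1_(stays x a (a + n.+1%:R)) w)%:E)%E @[n --> \oo] -->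
    (\int[P]_w (V w * \1_(stays_forever x a) w)%:E)%E.
  apply: (@cvg_integral_bounded _ _ _ _ _ _ C).
  - by move=> n; apply: measurable_funM => //; exact: measurable_indic.
  - by move=> n w; rewrite mulr_ge0//= (le_trans _ (VC w))// ler_piMr.
  - move=> w; apply: cvgM; first exact: cvg_cst.
    have [sw|nsw] := pselect (stays_forever x a w).
      rewrite indicE mem_set//; apply: cvg_near_cst; apply: nearW => n.
      by rewrite indicE mem_set// => s /andP[as_ _]; exact: sw.
    rewrite indicE memNset//.
    have [s as_ ns] : exists2 s, a <= s & x + Y s w < 0.
      apply: contra_notP nsw => h s as_; rewrite leNgt; apply/negP => ns; apply: h.
      by exists s.
    apply: cvg_near_cst; near=> n; rewrite indicE memNset// => sw.
    have : 0 <= x + Y s w.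
      apply: sw; rewrite as_ -lerBlDl (@le_trans _ _ n%:R) ?ler_nat//.
      by near: n; exact: nbhs_infty_ger.
    by rewrite leNgt ns.
have cR : (\int[P]_w (V w * fine (survival n.+1%:R (Num.max (x + Y a w) 0)))%:E)%E @[n --> \oo] -->
    (\int[P]_w (V w * escape m (x + Y a w))%:E)%E.
  apply: (@cvg_integral_bounded _ _ _ _ _ _ C).
  - move=> n; apply: measurable_funM => //.
    exact: (measurableT_comp (measurable_survival (n0 n)) (mYT x a)).
  - move=> n w.
    have f0 : 0 <= fine (survival n.+1%:R (Num.max (x + Y a w) 0)).
      by rewrite fine_ge0// survival_ge0.
    rewrite mulr_ge0//= (le_trans _ (VC w))// ler_piMr//.
    rewrite -lee_fin fineK ?survival_le1//.
    rewrite ge0_fin_numE ?survival_ge0//.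
    by rewrite (le_lt_trans (survival_le1 (n0 n) (max0 _)))// ltry.
  - move=> w; apply: cvgM; first exact: cvg_cst.
    rewrite (_ : escape m (x + Y a w) = escape m (Num.max (x + Y a w) 0)).
      exact: cvg_survival.
    by rewrite /escape -maxA maxxx.
have HQ : (fun n => \int[P]_w (V w * \1_(stays x a (a + n.+1%:R)) w)%:E)%E =
    (fun n => \int[P]_w (V w * fine (survival n.+1%:R (Num.max (x + Y a w) 0)))%:E)%E.
  by apply/funext => n; exact: H.
by rewrite HQ in cL; exact: (cvg_unique _ cL cR).
Unshelve. all: by end_near. Qed.

(** The joint effect of the position at time [t] and of nonnegativity for ever:
    nonnegativity after [t] contributes the factor [escape], and nonnegativity
    before [t] replaces the Gaussian density by the killed one. *)
Lemma nonnegative_law (t x : R) (g : R -> R) : 0 < t -> 0 <= x ->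
  blip g -> (forall z, 0 <= g z) ->
  (\int[P]_w (g (Y t w) * \1_(stays_forever x 0) w)%:E =
   \int[mu]_z (g (z - x) * escape m z * \1_(`]0%R, +oo[%classic) z * qden m t x z)%:E)%E.
Proof.
move=> t0 x0 bg g0.
have [C C0 [gC _]] := bg.
pose V w := g (Y t w) * \1_(stays x 0 t) w.
have V0 w : 0 <= V w by rewrite mulr_ge0.
have VC w : V w <= C.
  apply: (@le_trans _ _ (g (Y t w))); first by rewrite /V ler_piMr.
  exact: le_trans (ler_norm _) (gC _).
have mV : measurable_fun setT (V : past B t -> R).
  apply: measurable_funM; last first.
    by apply: measurable_indic; apply: measurable_stays_past => //; exact: ltW.
  apply: (measurableT_comp (blip_measurable bg)).
  by apply: measurable_funD => //; apply: measurable_past; rewrite lexx ltW.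
transitivity (\int[P]_w (V w * \1_(stays_forever x t) w)%:E)%E.
  apply: eq_integral => w _; rewrite /V -mulrA; congr (_ * _)%:E.
  rewrite !indicE -natrM mulnb; congr (_ %:R); congr nat_of_bool.
  apply/idP/andP => [/set_mem h|[/set_mem h1 /set_mem h2]].
    split; apply/mem_set => s; first by move=> /andP[s0 _]; exact: h.
    by move=> ts; apply: h; rewrite (le_trans _ ts)// ltW.
  apply/mem_set => s s0; have [st|ts] := leP s t; first by apply: h1; rewrite s0.
  exact/h2/ltW.
rewrite (escape_law _ (ltW t0) V0 VC mV).
pose k z := g (z - x) * escape m z.
have bk : blip k by apply: blip_mul; [exact: blip_shift|apply: blip_escape; exact: ltW].
have k0 z : 0 <= k z by rewrite mulr_ge0// escape_ge0// ltW.
transitivity (\int[P]_w (1 * \1_(stays x 0 t) w *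
    (k (x + Y t w) * \1_(`]0%R, +oo[%classic) (x + Y t w)))%:E)%E.
  apply: eq_integral => w _; congr EFin; rewrite /V /k mul1r addrAC subrr add0r.
  have [p|p] := ltP 0 (x + Y t w); last by rewrite escape_le0// !(mulr0, mul0r).
  by rewrite [\1_`]0, +oo[ _]indicE mem_set ?mulr1/= ?in_itv/= ?p//; ring.
rewrite (@killed_law 0 t x (fun _ => 1) 1 k)//.
have [B0 _ _ _] := hB.
rewrite subr0.
have max0 (y : R) : 0 <= Num.max y 0 by rewrite le_max lexx orbT.
transitivity (\int[P]_w \int[mu]_z
    (k z * \1_(`]0%R, +oo[%classic) z * qden m t x z)%:E)%E; last first.
  rewrite integral_cst//; set I := integral _ _ _.
  by rewrite [X in (_ * X)%E](_ : _ = 1%E) ?mule1//; exact: probability_setT.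
apply: ae_eq_integral => //.
- apply: emeasurable_funM => //.
  apply: (@measurable_fun_fubini_tonelli_F _ _ T (measurableTypeR R) R mu
    (fun p : T * R => (k p.2 * \1_(`]0, +oo[%classic) p.2 *
      qden m t (Num.max (x + Y 0 p.1) 0) p.2)%:E)).
  + apply/measurable_EFinP; apply: measurable_funM.
      apply: measurable_funM.
        by apply: (measurableT_comp (blip_measurable bk)); exact: measurable_snd.
      by apply: measurableT_comp => //; exact: measurable_indic.
    apply: (measurableT_comp (@measurable_qden _ m t) (measurable_fun_pair _ _)); last first.
      exact: measurable_snd.
    by apply: measurable_maxr => //; apply: (measurableT_comp (mYT x 0)); exact: measurable_fst.
  + move=> p; rewrite lee_fin indicE.
    have [/set_mem|_] := boolP (p.2 \in _); last by rewrite mulr0 mul0r.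
    rewrite /= in_itv/= andbT mulr1 => z0; apply: mulr_ge0 => //.
    by apply: qden_ge0 => //; exact: ltW.
- by apply: filterS B0 => w -> _; rewrite mul1e mulr0 !addr0 (max_l x0).
Qed.

Lemma never_below (x : R) : 0 <= x ->
  P (stays_forever x 0) = (escape m x)%:E.
Proof.
move=> x0; have [B0 _ _ _] := hB.
have m1 : measurable_fun setT ((fun _ => 1) : past B 0 -> R) by exact: measurable_cst.
have := @escape_law 0 x (fun _ => 1) 1 (lexx 0) (fun _ => ler01) (fun _ => lexx 1) m1.
under eq_integral do rewrite mul1r.
rewrite integral_indic ?setIT//; last exact: measurable_stays_forever.
move=> ->; transitivity (\int[P]_w (escape m x)%:E)%E; last first.
  rewrite integral_cst//.
  by rewrite [X in (_ * X)%E](_ : _ = 1%E) ?mule1//; exact: probability_setT.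
apply: ae_eq_integral => //.
- apply/measurable_EFinP; apply: measurable_funM => //.
  by apply: (measurableT_comp (blip_measurable (blip_escape (ltW m0)))).
- by apply: filterS B0 => w -> _; rewrite mul1r mulr0 !addr0.
Qed.

End nonnegative_paths.

(** * One-dimensional marginals of the conditioned motion *)

Lemma one_sub_expRN (R : realType) (x : R) : 0 <= x ->
  x / (1 + x) <= 1 - expR (- x) <= x.
Proof.
move=> x0; apply/andP; split; last by have := expR_ge1Dx (- x); lra.
have x1 : 0 < 1 + x by rewrite ltr_wpDr.
rewrite expRN lerBrDr -lerBrDl.
rewrite (_ : 1 - _ = (1 + x)^-1); last by field; rewrite gt_eqF.
by rewrite lef_pV2 ?posrE ?expR_gt0// expR_ge1Dx.
Qed.

(** Open intervals generate the Borel sets and are stable under intersection, so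
    that they determine the law of [X]. *)
Lemma law_of_density d (T : measurableType d) (R : realType) (P : probability T R)
    (X : {RV P >-> R}) (rho : R -> R) (f : R -> \bar R) :
  measurable_fun setT rho -> (forall z, 0 <= rho z) ->
  (forall a b, P (X @^-1` `]a, b[) =
    (\int[lebesgue_measure]_(z in `]a, b[) (rho z)%:E)%E) ->
  measurable_fun setT f -> (forall z, 0 <= f z)%E ->
  (\int[P]_w f (X w) = \int[lebesgue_measure]_z (f z * (rho z)%:E))%E.
Proof.
move=> mrho rho0 hX mf f0.
pose phi : T -> measurableTypeR R := X.
have mphi : measurable_fun setT phi by exact: (measurable_funP X).
have mrhoE : measurable_fun setT (fun z : measurableTypeR R => (rho z)%:E).
  exact/measurable_EFinP.
pose dm (A : set (measurableTypeR R)) : \bar R :=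
  (\int[@lebesgue_measure R]_(z in A) (rho z)%:E)%E.
have dm0 : dm set0 = 0%E by rewrite /dm integral_set0.
have dm_ge0 A : (0 <= dm A)%E by apply: integral_ge0 => z _; rewrite lee_fin.
have dm_add : semi_sigma_additive dm.
  by apply: semi_sigma_additive_nng_induced => // z; rewrite lee_fin.
pose nu : {measure set (measurableTypeR R) -> \bar R} :=
  HB.pack dm (isMeasure.Build _ _ _ dm dm0 dm_ge0 dm_add).
have muE (A : set (measurableTypeR R)) : measurable A -> pushforward P phi A = dm A.
  move=> mA; apply: (@measure_unique _ R (measurableTypeR R) (@RGenOpens.G R)
    (fun n : nat => `](- n%:R), n%:R[%classic) (@RGenOpens.measurableE R)
    _ _ _ (pushforward P phi) nu) => //.
  - move=> _ _ [a [b ->]] [a' [b' ->]]; exists (Num.max a a'), (Num.min b b').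
    apply/seteqP; split => z /=; rewrite !in_itv/= gt_max lt_min.
      by move=> [/andP[-> ->] /andP[-> ->]].
    by move=> /andP[/andP[-> ->] /andP[-> ->]].
  - by move=> n; exists (- n%:R), n%:R.
  - apply/seteqP; split => // z _; exists (Num.bound `|z|) => //=.
    by rewrite in_itv/= -ltr_norml; exact: archi_boundP.
  - by move=> _ [a [b ->]]; exact: hX.
  - move=> n; apply: (@le_lt_trans _ _ 1%E); last exact: ltry.
    by apply: probability_le1; rewrite -[X in measurable X]setTI; exact: mphi.
transitivity (\int[pushforward P phi]_z f z)%E.
  by rewrite ge0_integral_pushforward// preimage_setT.
have := @ge0_integral_density _ (measurableTypeR R) R (pushforward P phi)
  (@lebesgue_measure R) rho mrho rho0 muE.
apply=> //.
Qed.

Section conditioned_marginal.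
Context d (T : measurableType d) (R : realType) (P : probability T R).
Context d' (T' : measurableType d') (P' : probability T' R).
Variables (W : R -> {RV P >-> R}) (X : R -> {RV P' >-> R}) (m : R).
Hypotheses (hW : brownian_motion W) (m0 : 0 < m) (hX : conditioned_nonneg m W X).
Local Notation mu := (@lebesgue_measure R).

(** The density at [z] of the conditioned motion at time [t]. *)
Definition cden (t z : R) : R := escape m z * (z / (m * t)) * gden t (z - m * t).

Lemma cden_ge0 t z : 0 < t -> 0 <= cden t z.
Proof.
move=> t0; have [z0|z0] := leP z 0; first by rewrite /cden escape_le0// !mul0r.
by rewrite !mulr_ge0 ?escape_ge0 ?gden_ge0 ?divr_ge0 ?mulr_ge0 ?invr_ge0 ?mulr_ge0// ltW.
Qed.

Lemma measurable_cden : measurable_fun setT (fun p : R * R => cden p.1 p.2).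
Proof.
have m1 := @measurable_fst _ _ R R; have m2 := @measurable_snd _ _ R R.
apply: measurable_funM.
  apply: measurable_funM.
    by apply: (measurableT_comp (blip_measurable (blip_escape (ltW m0)))).
  apply: measurable_funM => //; apply: (measurableT_comp (@measurable_inv R)).
  exact: measurable_funM.
apply: measurable_fun_gden => //; apply: measurable_funB => //.
exact: measurable_funM.
Qed.

Lemma drift_geE e : drift_ge W m e = stays_forever W m e 0.
Proof.
apply/seteqP; split => w /= h s s0; first by rewrite addrC -lerBlDr sub0r h.
by have := h _ s0; lra.
Qed.

(** The density at [z] of [W t w + m * t] conditioned on [drift_ge W m e]: the
    process started from [e] must stay nonnegative, and is at [z + e]. *)
Let F (t e z : R) : R := escape m (z + e) * qden m t e (z + e) / escape m e.

(** Both [qden m t e (z + e)] and [escape m e] contain a factor [1 - exp (- x)] with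
    [x] proportional to [e]; by [one_sub_expRN] their ratio is close to the ratio
    [(z + e) / (m t)] of the exponents. *)
Let F_squeeze (t e z : R) : 0 < t -> 0 < e -> 0 <= z + e ->
  let k := escape m (z + e) * gden t (z - m * t) * ((z + e) / (m * t)) in
  k / (1 + 2 * e * (z + e) / t) <= F t e z <= k * (1 + 2 * m * e).
Proof.
move=> t0 e0 ze0 /=.
set a := 2 * e * (z + e) / t; set r := (z + e) / (m * t); set b := 2 * m * e.
have abr : a = b * r by rewrite /a /b /r; field; rewrite !gt_eqF.
have r0 : 0 <= r by rewrite divr_ge0 ?mulr_ge0 ?(ltW m0) ?(ltW t0)//.
have b0 : 0 < b by rewrite !mulr_gt0.
have a0 : 0 <= a by rewrite abr mulr_ge0 ?(ltW b0).
set k := escape m (z + e) * gden t (z - m * t).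
have k0 : 0 <= k by rewrite mulr_ge0 ?gden_ge0 ?escape_ge0// ltW.
have /andP[Pa aP] := one_sub_expRN a0; have /andP[Qb bQ] := one_sub_expRN (ltW b0).
have -> : F t e z = k * ((1 - expR (- a)) / (1 - expR (- b))).
  rewrite /F /qden {2}/escape (max_l (ltW e0)) -/b.
  rewrite (_ : z + e - e = z); last by ring.
  by rewrite [X in X / _]mulrA -[LHS]mulrA.
have Q0 : 0 < 1 - expR (- b) by rewrite (lt_le_trans _ Qb)// divr_gt0// addr_gt0.
have a1 : 0 < 1 + a by rewrite ltr_wpDr.
have b1 : 0 < 1 + b by rewrite addr_gt0.
rewrite -[k * r / _]mulrA -[k * r * _]mulrA !ler_wpM2l//.
  rewrite ler_pdivrMr// (le_trans aP)// abr.
  rewrite (_ : b * r = r * (1 + b) * (b / (1 + b))); last by field; rewrite gt_eqF.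
  by rewrite ler_wpM2l// mulr_ge0// ltW.
rewrite ler_pdivlMr// (le_trans _ Pa)// abr mulrAC ler_wpM2r ?invr_ge0 -?abr ?(ltW a1)//.
by rewrite abr mulrC ler_wpM2r.
Qed.

Let F_out (t e z : R) : z + e <= 0 -> F t e z = 0.
Proof. by move=> ze; rewrite /F escape_le0// !mul0r. Qed.

Let F_le (t e z : R) : 0 < t -> 0 < e <= 1 ->
  0 <= F t e z <= (`|z| + 1) * ((1 + 2 * m) / (m * t)) * gden t (z - m * t).
Proof.
move=> t0 /andP[e0 e1]; have mt0 : 0 < m * t by rewrite mulr_gt0.
have c0 : 0 <= (1 + 2 * m) / (m * t) by rewrite divr_ge0 ?(ltW mt0)// addr_ge0// mulr_ge0// ltW.
have [ze|ze] := leP (z + e) 0.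
  by rewrite F_out// lexx/= mulr_ge0 ?gden_ge0// mulr_ge0// addr_ge0.
have /andP[lo up] := F_squeeze t0 e0 (ltW ze).
have h0 := @escape_ge0 _ m (z + e) (ltW m0).
have g0 := @gden_ge0 R t (z - m * t).
have k0 : 0 <= escape m (z + e) * gden t (z - m * t) * ((z + e) / (m * t)).
  by rewrite mulr_ge0 ?(mulr_ge0 h0 g0)// divr_ge0 ?(ltW mt0)// ltW.
apply/andP; split.
  by rewrite (le_trans _ lo)// divr_ge0// addr_ge0// !mulr_ge0 ?invr_ge0// ltW.
apply: (le_trans up); set g := gden t _ in g0 *.
rewrite (_ : _ * (1 + _) = escape m (z + e) * ((z + e) * (1 + 2 * m * e)) * (g / (m * t)));
  last by ring.
rewrite (_ : (`|z| + 1) * _ * _ = (1 * ((`|z| + 1) * (1 + 2 * m))) * (g / (m * t)));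
  last by ring.
rewrite ler_wpM2r ?divr_ge0 ?(ltW mt0)//.
have e20 : 0 <= 1 + 2 * m * e by rewrite addr_ge0// !mulr_ge0// ltW.
apply: ler_pM => //; first by rewrite mulr_ge0 ?(ltW ze).
  exact: escape_le1.
apply: ler_pM => //; first exact: ltW.
  by rewrite lerD// ler_norm.
by rewrite lerD2l ler_piMr// mulr_ge0// ltW.
Qed.

Let cvg_F (t z : R) (e_ : nat -> R) : 0 < t -> (forall n, 0 < e_ n) ->
  e_ n @[n --> \oo] --> (0 : R) -> F t (e_ n) z @[n --> \oo] --> cden t z.
Proof.
move=> t0 e0 ce; have [z0|z0] := ltP z 0.
  rewrite /cden escape_le0 ?(ltW z0)// !mul0r.
  apply: cvg_near_cst; near=> n; apply: F_out.
  have : e_ n < - z by near: n; apply: (cvgr_lt 0) => //; rewrite oppr_gt0.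
  by lra.
have cze : z + e_ n @[n --> \oo] --> z.
  by rewrite -[X in _ --> X]addr0; apply: cvgD => //; exact: cvg_cst.
pose k n := escape m (z + e_ n) * gden t (z - m * t) * ((z + e_ n) / (m * t)).
have ck : k n @[n --> \oo] --> cden t z.
  rewrite /cden mulrAC; apply: cvgM; last by apply: cvgM => //; exact: cvg_cst.
  apply: cvgM; last exact: cvg_cst.
  apply: (@continuous_cvg_seq R (escape m) (fun n => z + e_ n) z) => //.
  exact/blip_continuous/blip_escape/ltW.
apply: (@squeeze_cvgr _ _ _ _ (fun n => k n / (1 + 2 * e_ n * (z + e_ n) / t))
  (fun n => k n * (1 + 2 * m * e_ n))).
- by apply: nearW => n; apply: F_squeeze => //; rewrite addr_ge0// ltW.
- rewrite -[cden _ _]divr1; apply: cvgM => //; apply: cvgV; first exact: oner_neq0.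
  rewrite -[X in _ --> X]addr0; apply: cvgD; first exact: cvg_cst.
  rewrite -[X in _ --> X](mul0r t^-1); apply: cvgM; last exact: cvg_cst.
  rewrite -[X in _ --> X](mul0r z); apply: cvgM => //.
  by rewrite -[X in _ --> X](mulr0 2); apply: cvgM => //; exact: cvg_cst.
- rewrite -[cden _ _]mulr1; apply: cvgM => //.
  rewrite -[X in _ --> X]addr0; apply: cvgD; first exact: cvg_cst.
  by rewrite -[X in _ --> X](mulr0 (2 * m)); apply: cvgM => //; exact: cvg_cst.
Unshelve. all: by end_near. Qed.

Let measurable_F (t e : R) : measurable_fun setT (F t e).
Proof.
apply: measurable_funM => //; apply: measurable_funM.
  apply: (measurableT_comp (blip_measurable (blip_escape (ltW m0)))).
  exact: measurable_funD.
by apply: (measurableT_comp (@measurable_qdenr R m t e)); exact: measurable_funD.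
Qed.

(** [nonnegative_law] started from [e], translated back by [e]. *)
Let cond_expectationE (t e : R) (g : R -> R) : 0 < t -> 0 < e ->
  blip g -> (forall z, 0 <= g z) ->
  cond_expectation P (fun w => g (W t w + m * t)) (drift_ge W m e) =
  fine (\int[mu]_z (g z * F t e z)%:E)%E.
Proof.
move=> t0 e0 bg g0; rewrite /cond_expectation drift_geE.
have he : 0 < escape m e.
  by rewrite /escape max_l ?(ltW e0)// subr_gt0 -expR0 ltr_expR oppr_lt0 !mulr_gt0.
rewrite [P _](@never_below _ _ _ P W m hW m0 e (ltW e0)) /=.
rewrite integral_mkcond.
have mF := measurable_F t e.
have F0 z : 0 <= F t e z.
  have [ze|ze] := leP (z + e) 0; first by rewrite F_out.
  apply: mulr_ge0; last by rewrite invr_ge0 ltW.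
  by rewrite mulr_ge0 ?escape_ge0 ?qden_ge0// ltW.
have mgF : measurable_fun setT (fun z => (g z * F t e z)%:E).
  by apply/measurable_EFinP/measurable_funM => //; exact: blip_measurable.
transitivity (fine (\int[P]_w (g (W t w + m * t) * \1_(stays_forever W m e 0) w)%:E)%E
    / escape m e).
  congr (fine _ / _); apply: eq_integral => w _; rewrite patchE indicE.
  by case: ifP => _; rewrite (mulr1, mulr0).
rewrite (nonnegative_law hW m0 t0 (ltW e0) bg g0).
rewrite -(@ge0_integral_translation R _ e); last 2 first.
- apply/measurable_EFinP; apply: measurable_funM; last exact: measurable_qdenr.
  apply: measurable_funM; last exact: measurable_indic.
  apply: measurable_funM; last exact: (blip_measurable (blip_escape (ltW m0))).
  by apply: (measurableT_comp (blip_measurable bg)); exact: measurable_funB.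
- move=> z; rewrite lee_fin indicE; have [/set_mem|_] := boolP (z \in _).
    rewrite /= in_itv/= andbT => z0; rewrite mulr1.
    by rewrite mulr_ge0 ?qden_ge0// ?mulr_ge0 ?escape_ge0// ltW.
  by rewrite mulr0 mul0r.
transitivity (fine ((escape m e)%:E * \int[mu]_z (g z * F t e z)%:E)%E / escape m e).
  congr (fine _ / _).
  rewrite -ge0_integralZl_EFin//; last 2 first.
  - by move=> z _; rewrite lee_fin mulr_ge0.
  - exact: ltW.
  apply: eq_integral => z _; rewrite -EFinM; congr EFin.
  rewrite addrK indicE /F; have [ze|ze] := leP (z + e) 0.
    by rewrite escape_le0// !(mulr0, mul0r).
  by rewrite mem_set ?mulr1/= ?in_itv/= ?ze//; field; rewrite gt_eqF.
(* [fine] commutes with the division, also at infinity *)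
case: (integral _ _ _) => [r| |] /=.
- by field; rewrite gt_eqF.
- by rewrite gt0_muley ?lte_fin//= mul0r.
- by rewrite gt0_muleNy ?lte_fin//= mul0r.
Qed.

(** Dominated convergence along [e = 1 / (n + 1)]; the bound on [|z| g z] absorbs the
    linear growth in [F_le]. *)
Let marginal_test (t M : R) (g : R -> R) : 0 < t ->
  blip g -> (forall z, 0 <= g z) -> (forall z, `|z| * g z <= M) ->
  (\int[P']_w (g (X t w))%:E = \int[mu]_z (g z * cden t z)%:E)%E.
Proof.
move=> t0 bg g0 gM; have [_ _ hXl] := hX; have [C C0 [gC _]] := bg.
have mg := blip_measurable bg.
have cX := hXl 1%N (fun _ => t) (fun v => g (v 0 0)) (fun _ => ltW t0) _ _.
have {cX} : cond_expectation P (fun w => g (W t w + m * t)) (drift_ge W m e)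
    @[e --> 0^'+] --> fine (\int[P']_w (g (X t w))%:E)%E.
  have -> : (fun w => g (W t w + m * t)) =
      (fun w => g ((\row__ (W t w + m * t) : 'rV[R]_1) 0 0)).
    by apply/funext => w; rewrite mxE.
  have -> : (fun w => (g (X t w))%:E) = (fun w => (g ((\row__ X t w : 'rV[R]_1) 0 0))%:E).
    by apply/funext => w; rewrite mxE.
  apply: cX; last by exists C => v; exact: gC.
  move=> v; apply: (@continuous_comp _ _ _ (fun v : 'rV[R]_1 => v 0 0) g).
    exact: coord_continuous.
  exact: blip_continuous.
(* the one-dimensional instance of the limit that defines the conditioned motion *)
move/(cvg_at_rightP _ _ _).1 => cX.
have h0 n : (0 : R) < harmonic n by rewrite /= invr_gt0.
have h1 n : (harmonic n : R) <= 1 by rewrite /= invf_le1// ler1n.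
have {}cX := cX _ (conj h0 cvg_harmonic).
have cEE : (fun n : nat => cond_expectation P (fun w => g (W t w + m * t))
      (drift_ge W m (harmonic n))) =
    (fun n : nat => fine (\int[mu]_z (g z * F t (harmonic n) z)%:E)%E).
  by apply/funext => n; exact: cond_expectationE.
rewrite cEE in cX.
pose G z := (M + C) * ((1 + 2 * m) / (m * t)) * gden t (z - m * t).
have c0 : 0 <= (1 + 2 * m) / (m * t).
  by rewrite divr_ge0 ?addr_ge0// ?mulr_ge0// ltW.
have iG : mu.-integrable setT (EFin \o G).
  rewrite (_ : EFin \o G = (fun z => ((M + C) * ((1 + 2 * m) / (m * t)))%:E *
      (gden t (z - m * t))%:E)%E); last by apply/funext => z; rewrite /= EFinM.
  apply: integrableZl => //; apply/integrableP; split.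
    apply/measurable_EFinP; apply: (measurableT_comp (@measurable_gdenl R t)).
    exact: measurable_funB.
  under eq_integral do rewrite gee0_abs ?lee_fin ?gden_ge0//.
  by rewrite integral_gden_shift// ltry.
have gF_le n z : `|g z * F t (harmonic n) z| <= G z.
  have /andP[Fz0 Fz] := @F_le t (harmonic n) z t0 (introT andP (conj (h0 n) (h1 n))).
  rewrite ger0_norm; last exact: mulr_ge0.
  apply: (le_trans (ler_wpM2l (g0 z) Fz)).
  rewrite [leLHS]mulrA; apply: ler_wpM2r; first exact: gden_ge0.
  rewrite [leLHS]mulrA; apply: ler_wpM2r => //.
  rewrite mulrDr mulr1 lerD// 1?mulrC//.
  exact: le_trans (ler_norm _) (gC z).
have mgF n : measurable_fun setT (fun z => (g z * F t (harmonic n) z)%:E).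
  exact/measurable_EFinP/measurable_funM.
have mgc : measurable_fun setT (fun z => (g z * cden t z)%:E).
  apply/measurable_EFinP/measurable_funM => //.
  exact: (measurableT_comp measurable_cden (pair1_measurable t)).
have [|||ic _ cI] := @dominated_convergence _ _ R mu setT measurableT
  (fun n z => (g z * F t (harmonic n) z)%:E) (fun z => (g z * cden t z)%:E)
  (EFin \o G) mgF mgc.
- apply/aeW => z _; apply: cvg_EFin; first exact: nearW.
  apply: cvgM; first exact: cvg_cst.
  by apply: cvg_F => //; exact: cvg_harmonic.
- exact: iG.
- by apply/aeW => z n _; rewrite lee_fin.
have finc : (\int[mu]_z (g z * cden t z)%:E)%E \is a fin_num.
  exact: integrable_fin_num.
have finX : (\int[P']_w (g (X t w))%:E)%E \is a fin_num.
  apply: integrable_fin_num => //.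
  apply: (@le_integrable _ _ _ P' _ _ _ (cst C%:E)) => //.
  + by apply/measurable_EFinP; exact: measurableT_comp.
  + by move=> w _ /=; rewrite lee_fin (le_trans (gC _))// ler_norm.
  + exact: finite_measure_integrable_cst.
rewrite -(fineK finc) in cI.
have {}cI : fine (\int[mu]_z (g z * F t (harmonic n) z)%:E)%E @[n --> \oo] -->
  fine (\int[mu]_z (g z * cden t z)%:E)%E := fine_cvg cI.
rewrite -(fineK finX) -[RHS](fineK finc); congr EFin.
exact: (cvg_unique _ cX (cI _)).
Qed.

Let marginal_itv (t a b : R) : 0 < t ->
  P' (X t @^-1` `]a, b[) = (\int[mu]_(z in `]a, b[) (cden t z)%:E)%E.
Proof.
move=> t0.
have mcden : measurable_fun setT (cden t).
  exact: (measurableT_comp measurable_cden (pair1_measurable t)).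
pose C := Num.max `|a| `|b|.
have pM n z : `|z| * plateau a b n z <= C.
  have [/andP[az zb]|h] := boolP (a < z < b); last first.
    by rewrite plateau_out// mulr0 le_max normr_ge0.
  apply: (@le_trans _ _ `|z|).
    by rewrite ler_piMr// plateau_le1.
  rewrite le_max; have [z0|z0] := leP 0 z.
    by rewrite [X in _ || X](_ : _ = true) ?orbT// ger0_norm// (le_trans (ltW zb))// ler_norm.
  by rewrite ltr0_norm// -(normrN a) (le_trans _ (ler_norm (- a)))// lerN2 ltW.
have e n := @marginal_test t C (plateau a b n) t0 (blip_plateau _ _ _)
  (plateau_ge0 a b n) (pM n).
have cL : (\int[P']_w (plateau a b n (X t w))%:E)%E @[n --> \oo] -->
    (\int[P']_w (\1_(`]a, b[%classic) (X t w))%:E)%E.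
  apply: cvg_integral_monotone => [n|n w|w n k nk|w].
  - apply/measurable_EFinP; apply: measurableT_comp => //.
    exact: (blip_measurable (blip_plateau a b n)).
  - by rewrite lee_fin plateau_ge0.
  - by rewrite lee_fin le_plateau.
  - by apply: cvg_EFin; [exact: nearW|exact: cvg_plateau].
have cR : (\int[mu]_z (plateau a b n z * cden t z)%:E)%E @[n --> \oo] -->
    (\int[mu]_z (\1_(`]a, b[%classic) z * cden t z)%:E)%E.
  apply: cvg_integral_monotone => [n|n z|z n k nk|z].
  - apply/measurable_EFinP/measurable_funM => //.
    exact: (blip_measurable (blip_plateau a b n)).
  - by rewrite lee_fin mulr_ge0 ?plateau_ge0 ?cden_ge0.
  - by rewrite lee_fin ler_wpM2r ?le_plateau ?cden_ge0.
  - apply: cvg_EFin; first exact: nearW.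
    by apply: cvgM; [exact: cvg_plateau|exact: cvg_cst].
have HQ : (fun n => (\int[P']_w (plateau a b n (X t w))%:E)%E) =
  (fun n => (\int[mu]_z (plateau a b n z * cden t z)%:E)%E).
  by apply/funext => n; exact: e.
rewrite HQ in cL; have {cL cR HQ} eI : (\int[P']_w (\1_(`]a, b[%classic) (X t w))%:E =
    \int[mu]_z (\1_(`]a, b[%classic) z * cden t z)%:E)%E by exact: (cvg_unique _ cL cR).
have mI : measurable (X t @^-1` `]a, b[).
  by rewrite -[X in measurable X]setTI; apply: (measurable_funP (X t)).
transitivity (\int[P']_w (\1_(`]a, b[%classic) (X t w))%:E)%E.
  by rewrite -[X in P' X]setIT -integral_indic//; apply: eq_integral.
apply: (etrans eI); rewrite [in RHS]integral_mkcond; apply: eq_integral => z _.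
by rewrite patchE indicE; case: ifP => _; rewrite ?mul1r ?mul0r.
Qed.

(** As [e] tends to [0], both the probability [escape m e] of the conditioning and
    the density [qden m t e z] of the motion killed below [-e] are equivalent to
    a constant times [e]; their ratio, times the probability [escape m z] of
    surviving after time [t], is [cden]. *)
Lemma conditioned_marginal t (f : R -> \bar R) : 0 < t ->
  measurable_fun setT f -> (forall z, 0 <= f z)%E ->
  (\int[P']_w f (X t w) = \int[mu]_z (f z * (cden t z)%:E))%E.
Proof.
move=> t0 mf f0; apply: law_of_density => //.
- exact: (measurableT_comp measurable_cden (pair1_measurable t)).
- by move=> z; exact: cden_ge0.
- by move=> a b; exact: marginal_itv.
Qed.

End conditioned_marginal.

(** * Expected occupation of the two processes *)

Section tonelli_on.
Context d (T : measurableType d) (R : realType).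
Variables (nu : {sigma_finite_measure set T -> \bar R}) (D : set R) (g : R * T -> \bar R).
Hypotheses (mD : measurable D) (mg : measurable_fun setT g) (g0 : forall p, (0 <= g p)%E).

Let h (p : measurableTypeR R * T) := (g p * (\1_D p.1)%:E)%E.

Let mh : measurable_fun setT h.
Proof.
apply: emeasurable_funM => //; apply/measurable_EFinP.
by apply: (measurableT_comp (measurable_indic mD)); exact: measurable_fst.
Qed.

Let h0 p : (0 <= h p)%E. Proof. by rewrite mule_ge0. Qed.

Let restrictE (k : R -> \bar R) :
  (\int[lebesgue_measure]_(t in D) k t = \int[lebesgue_measure]_t (k t * (\1_D t)%:E))%E.
Proof.
rewrite integral_mkcond; apply: eq_integral => t _.
by rewrite patchE indicE; case: ifP => _; rewrite (mule1, mule0).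
Qed.

Lemma measurable_integral_on :
  measurable_fun setT (fun w => \int[lebesgue_measure]_(t in D) g (t, w))%E.
Proof.
under eq_fun do rewrite restrictE.
exact: (@measurable_fun_fubini_tonelli_G _ _ (measurableTypeR R) T R lebesgue_measure h).
Qed.

Lemma tonelli_on :
  (\int[nu]_w \int[lebesgue_measure]_(t in D) g (t, w) =
   \int[lebesgue_measure]_(t in D) \int[nu]_w g (t, w))%E.
Proof.
under eq_integral do rewrite restrictE.
have := @fubini_tonelli _ _ (measurableTypeR R) T R (@lebesgue_measure R) nu h mh h0.
rewrite /h /= => <-; rewrite restrictE; apply: eq_integral => t _.
have [tD|tD] := boolP (t \in D).
  by under eq_integral do rewrite indicE tD mule1; rewrite indicE tD mule1.
under eq_integral do rewrite indicE (negbTE tD) mule0.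
by rewrite integral0 indicE (negbTE tD) mule0.
Qed.

End tonelli_on.

Section occupation.
Context d (T : measurableType d) (R : realType) (P : probability T R).
Local Notation mu := (@lebesgue_measure R).

Lemma measurable_halfline_process (Z : R -> T -> R) :
  (forall t, measurable_fun setT (Z t)) ->
  (forall w, {within `[0, +oo[, continuous (fun t => Z t w)}) ->
  measurable_fun setT (fun p : R * T => Z (Num.max p.1 0) p.2).
Proof.
move=> mZ cZ.
apply: (@measurable_continuous_process _ T R (fun t w => Z (Num.max t 0) w)) => //.
by move=> w; exact: (continuous_max0 (cZ w)).
Qed.

Lemma integral_halflineE (g : R -> \bar R) :
  measurable_fun setT g ->
  (\int[mu]_(t in `[0%R, +oo[) g t = \int[mu]_(t in `]0%R, +oo[) g t)%E.
Proof.
by move=> mg; rewrite -integral_itv_obnd_cbnd//; exact: measurable_funTS.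
Qed.

(** Dropping the time [0] and stopping the clock at negative times puts the time
    integral in the form to which [tonelli_on] applies. *)
Lemma integral_timeE (Z : R -> T -> R) (f : R -> \bar R) w :
  (forall w, {within `[0, +oo[, continuous (fun t => Z t w)}) ->
  measurable_fun setT f ->
  (\int[mu]_(t in `[0%R, +oo[) f (Z t w) =
   \int[mu]_(t in `]0%R, +oo[) f (Z (Num.max t 0%R) w))%E.
Proof.
move=> cZ mf.
rewrite -integral_halflineE; last first.
  apply: (measurableT_comp mf).
  exact: (continuous_measurable_fun (continuous_max0 (cZ w))).
apply: eq_integral => t; rewrite inE/= in_itv/= andbT => t0.
by rewrite max_l.
Qed.

Lemma occupation_swap (Z : R -> T -> R) (f : R -> \bar R) :
  (forall t, measurable_fun setT (Z t)) ->
  (forall w, {within `[0, +oo[, continuous (fun t => Z t w)}) ->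
  measurable_fun setT f -> (forall z, 0 <= f z)%E ->
  (\int[P]_w \int[mu]_(t in `[0%R, +oo[) f (Z t w) =
   \int[mu]_(t in `]0%R, +oo[) \int[P]_w f (Z t w))%E.
Proof.
move=> mZ cZ mf f0.
under eq_integral do rewrite (integral_timeE _ cZ mf).
have mfZ := measurableT_comp mf (measurable_halfline_process mZ cZ).
rewrite (tonelli_on P (measurable_itv _) mfZ (fun p => f0 _)).
apply: eq_integral => t; rewrite inE/= in_itv/= andbT => t0.
by rewrite max_l// ltW.
Qed.

(** Integrating the density [D t] over time first gives the Green function [G],
    except possibly at the origin, which has measure zero. *)
Lemma green_integral (D : R -> R -> R) (G : R -> R) (f : R -> \bar R) :
  measurable_fun setT (fun p : R * R => D p.1 p.2) ->
  (forall t z, 0 < t -> 0 <= D t z) ->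
  measurable_fun setT G ->
  (forall z : R, z != 0%R -> \int[mu]_(t in `]0%R, +oo[) (D t z)%:E = (G z)%:E)%E ->
  measurable_fun setT f -> (forall z, 0 <= f z)%E ->
  (\int[mu]_(t in `]0%R, +oo[) \int[mu]_z (f z * (D t z)%:E) =
   \int[mu]_z (f z * (G z)%:E))%E.
Proof.
move=> mD D0 mG hG mf f0.
(* Tonelli's theorem needs a density that is nonnegative at all real times *)
pose D' t z := Num.max (D t z) 0.
have D'E t z : 0 < t -> D' t z = D t z by move=> t0; rewrite /D' max_l// D0.
have mD' : measurable_fun setT (fun p : R * R => (D' p.1 p.2)%:E).
  by apply/measurable_EFinP; apply: measurable_maxr.
have D'0 t z : (0 <= (D' t z)%:E)%E by rewrite lee_fin le_max lexx orbT.
have mf2 : measurable_fun setT (fun p : R * R => f p.2).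
  by apply: (measurableT_comp mf); exact: measurable_snd.
transitivity (\int[mu]_(t in `]0%R, +oo[) \int[mu]_z (f z * (D' t z)%:E))%E.
  apply: eq_integral => t; rewrite inE/= in_itv/= andbT => t0.
  by apply: eq_integral => z _; rewrite D'E.
rewrite -(@tonelli_on _ (measurableTypeR R) R mu `]0, +oo[%classic
  (fun p => (f p.2 * (D' p.1 p.2)%:E)%E))//=; last 2 first.
- exact: emeasurable_funM.
- by move=> p; rewrite mule_ge0.
apply: ae_eq_integral => //.
- apply: (@measurable_integral_on _ (measurableTypeR R) R `]0, +oo[%classic
    (fun p => f p.2 * (D' p.1 p.2)%:E)%E) => //.
  + exact: emeasurable_funM.
  + by move=> p; rewrite mule_ge0.
- by apply: emeasurable_funM => //; exact/measurable_EFinP.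
exists [set 0]; split.
- exact: measurable_set1.
- exact: lebesgue_measure_set1.
move=> z /= h; apply: contrapT => /eqP z0; apply: h => _.
rewrite ge0_integralZl//; last first.
  apply/measurable_EFinP/measurable_funTS.
  by apply: measurable_maxr => //; exact: (measurableT_comp mD (pair2_measurable z)).
rewrite -(hG _ z0); congr (_ * _)%E.
by apply: eq_integral => t; rewrite inE/= in_itv/= andbT => t0; rewrite D'E.
Qed.

Lemma drifted_occupation (B : R -> {RV P >-> R}) (m : R) (f : R -> \bar R) :
  brownian_motion B -> 0 < m ->
  measurable_fun setT f -> (forall z, 0 <= f z)%E ->
  (\int[P]_w \int[mu]_(t in `[0%R, +oo[) f (B t w - m * t)%R =
   \int[mu]_z (f z * (m^-1 * expR (- (2 * m * Num.max z 0)))%:E))%E.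
Proof.
move=> hB m0 mf f0; have [_ cB _ _] := hB.
rewrite (@occupation_swap (fun t w => B t w - m * t) f)//; last 2 first.
- by move=> t; exact: measurable_funB.
- move=> w x; apply: cvgB; first exact: cB.
  by apply: continuous_subspaceT => y; apply: cvgM => //; exact: cvg_cst.
rewrite -(@green_integral (fun t z => gden t (z + m * t))
  (fun z => m^-1 * expR (- (2 * m * Num.max z 0))))//; first last.
- by move=> z z0; exact: integral_gden_green.
- apply: measurable_funM => //; apply: measurableT_comp => //.
  apply: measurableT_comp => //; apply: measurable_funM => //.
  exact: measurable_maxr.
- by move=> t z _; exact: gden_ge0.
- have m1 := @measurable_fst _ _ R R; have m2 := @measurable_snd _ _ R R.
  apply: measurable_fun_gden => //; apply: measurable_funD => //.
  exact: measurable_funM.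
apply: eq_integral => t; rewrite inE/= in_itv/= andbT => t0.
have mfs : measurable_fun setT (fun z : R => f (z - m * t)%R).
  by apply: (measurableT_comp mf); exact: measurable_funB.
transitivity (\int[mu]_z (f (z - m * t)%R * (gden t z)%:E))%E.
  exact: (@brownian_marginal _ _ _ _ _ hB t (fun z : R => f (z - m * t)%R) t0 mfs).
rewrite -(@ge0_integral_translation R _ (m * t)).
- by apply: eq_integral => z _; rewrite addrK.
- by apply: emeasurable_funM => //; apply/measurable_EFinP; exact: measurable_gdenl.
- by move=> z; rewrite mule_ge0 ?lee_fin ?gden_ge0.
Qed.

End occupation.

(** For [z > 0] the time integral of [z / t] times the Gaussian density is the mass
    of a first passage law, so that only [escape m z / m] remains. *)
Lemma conditioned_occupation d (T : measurableType d) (R : realType) (P : probability T R)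
    d' (T' : measurableType d') (P' : probability T' R)
    (W : R -> {RV P >-> R}) (X : R -> {RV P' >-> R}) (m : R) (f : R -> \bar R) :
  brownian_motion W -> 0 < m -> conditioned_nonneg m W X ->
  measurable_fun setT f -> (forall z, 0 <= f z)%E ->
  (\int[P']_w \int[lebesgue_measure]_(t in `[0%R, +oo[) f (X t w) =
   \int[lebesgue_measure]_z (f z * (m^-1 * escape m z)%:E))%E.
Proof.
move=> hW m0 hX mf f0; have [_ cX _] := hX.
rewrite (@occupation_swap _ _ _ _ X f)//.
rewrite -(@green_integral R (fun t z => cden m t z) (fun z => m^-1 * escape m z))//; first last.
- move=> z z0; have [zle|zgt] := leP z 0.
    rewrite escape_le0// mulr0; apply: integral0_eq => t _.
    by rewrite /cden escape_le0// !mul0r.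
  rewrite (_ : _ * _ = (m^-1 * escape m z) * 1); last by rewrite mulr1.
  have e0 : 0 <= m^-1 * escape m z by rewrite mulr_ge0 ?invr_ge0 ?escape_ge0// ltW.
  rewrite EFinM -(integral_first_passage m0 zgt) -ge0_integralZl//.
  + apply: eq_integral => t _; rewrite -EFinM /cden; congr EFin.
    rewrite invfM; ring.
  + apply/measurable_EFinP/measurable_funTS; apply: measurable_funM; last exact: measurable_gden_time.
    by apply: measurable_funM => //; exact: measurable_inv.
  + move=> t; rewrite /= in_itv/= andbT => t0.
    by rewrite lee_fin mulr_ge0 ?gden_ge0// divr_ge0// ltW.
- by apply: measurable_funM => //; exact: (blip_measurable (blip_escape (ltW m0))).
- by move=> t z; exact: cden_ge0.
- exact: measurable_cden.
apply: eq_integral => t; rewrite inE/= in_itv/= andbT => t0.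
exact: (conditioned_marginal hW m0 hX t0 mf f0).
Qed.

(** * The exponential functional and its expectation *)

(** [pi] times the constant of [I]: the expected value of the exponential
    functional started from infinity. *)
Definition total_mass (R : realType) (gamma m : R) (I : R -> R) : \bar R :=
  (\int[lebesgue_measure]_z (m^-1 * I (expR (gamma * z)))%:E)%E.

(** The expected value of the exponential functional started from [a]: the occupation
    density of the drifted motion translated by [ln a / gamma]. *)
Definition mass (R : realType) (gamma m : R) (I : R -> R) (a : R) : \bar R :=
  if 0 < a then
    (\int[lebesgue_measure]_z (m^-1 * I (expR (gamma * z)) *
       expR (- (2 * m * Num.max (z - ln a / gamma) 0)))%:E)%E
  else 0%E.

Section mass.
Context (R : realType) (gamma m : R) (I : R -> R).
Hypotheses (gamma0 : 0 < gamma) (m0 : 0 < m).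
Hypotheses (mI : measurable_fun (`[0, +oo[%classic : set R) I).
Hypotheses (I_ge0 : forall x, 0 <= x -> 0 <= I x).
Local Notation mu := (@lebesgue_measure R).

Lemma measurable_comp_ge0 d (T : measurableType d) (h : T -> R) :
  measurable_fun setT h -> (forall x, 0 <= h x) -> measurable_fun setT (I \o h).
Proof.
move=> mh h0; have := @measurable_comp _ _ _ _ _ _ _ _ _ _ _ _ mI mh. apply => //.
by move=> _ [x _ <-]; rewrite /= in_itv/= h0.
Qed.

Let fI z := m^-1 * I (expR (gamma * z)).

Let mfI : measurable_fun setT fI.
Proof.
apply: measurable_funM => //.
apply: measurable_comp_ge0 => [|x]; last exact: expR_ge0.
by apply: measurableT_comp => //; exact: measurable_funM.
Qed.

Let fI0 z : 0 <= fI z.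
Proof. by rewrite mulr_ge0 ?I_ge0 ?expR_ge0// invr_ge0 ltW. Qed.

Let weight (a z : R) := expR (- (2 * m * Num.max (z - ln a / gamma) 0)).

Let weight_le (a b z : R) : 0 < a -> a <= b -> weight a z <= weight b z.
Proof.
move=> a0 ab; rewrite ler_expR lerN2 ler_wpM2l//.
  by rewrite mulr_ge0// ltW.
rewrite ge_max !le_max lexx orbT andbT; apply/orP; left.
by rewrite lerB// ler_wpM2r ?invr_ge0 ?(ltW gamma0)// ler_ln ?posrE// (lt_le_trans a0).
Qed.

Let weight_le1 a z : weight a z <= 1.
Proof.
by rewrite -expR0 ler_expR oppr_le0 !mulr_ge0 ?(ltW m0)// le_max lexx orbT.
Qed.

Let mweight a : measurable_fun setT (weight a).
Proof.
apply: measurableT_comp => //; apply: measurableT_comp => //.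
apply: measurable_funM => //; apply: measurable_maxr => //.
exact: measurable_funB.
Qed.

Let mfw a : measurable_fun setT (fun z => (fI z * weight a z)%:E).
Proof. by apply/measurable_EFinP; exact: measurable_funM. Qed.

Let fw0 a z : (0 <= (fI z * weight a z)%:E)%E.
Proof. by rewrite lee_fin mulr_ge0// expR_ge0. Qed.

Lemma mass_ge0 a : (0 <= mass gamma m I a)%E.
Proof. by rewrite /mass; case: ifP => // _; apply: integral_ge0 => z _; exact: fw0. Qed.

Lemma total_mass_ge0 : (0 <= total_mass gamma m I)%E.
Proof. by apply: integral_ge0 => z _; rewrite lee_fin; exact: fI0. Qed.

Lemma le_mass a b : a <= b -> (mass gamma m I a <= mass gamma m I b)%E.
Proof.
move=> ab; rewrite {1}/mass; case: ifPn => [a0|_]; last exact: mass_ge0.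
rewrite /mass (lt_le_trans a0 ab); apply: ge0_le_integral => //.
- by move=> z _; exact: fw0.
- exact: mfw.
- exact: mfw.
- move=> z _; rewrite lee_fin; apply: ler_wpM2l; first exact: fI0.
  exact: weight_le.
Qed.

Lemma mass_le a : (mass gamma m I a <= total_mass gamma m I)%E.
Proof.
rewrite /mass; case: ifPn => [a0|_]; last exact: total_mass_ge0.
apply: ge0_le_integral => //.
- by move=> z _; exact: fw0.
- exact: mfw.
- exact/measurable_EFinP.
- move=> z _; rewrite lee_fin; apply: ler_piMr; first exact: fI0.
  exact: weight_le1.
Qed.

(** The weights are eventually equal to [1] at each [z], and increase. *)
Lemma cvg_mass e : 0 < e ->
  mass gamma m I (n.+1%:R * e) @[n --> \oo] --> total_mass gamma m I.
Proof.
move=> e0.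
rewrite (_ : (fun n : nat => _) =
    (fun n => \int[mu]_z (fI z * weight (n.+1%:R * e) z)%:E)%E); last first.
  by apply/funext => n; rewrite /mass mulr_gt0.
apply: cvg_integral_monotone => [n|n z|z n k nk|z].
- exact: mfw.
- exact: fw0.
- by rewrite lee_fin ler_wpM2l// weight_le ?mulr_gt0// ler_wpM2r ?(ltW e0)// ler_nat.
- apply: cvg_near_cst; near=> n; congr EFin; rewrite -/(fI z) /weight max_r.
    by rewrite mulr0 oppr0 expR0 mulr1.
  rewrite subr_le0 ler_pdivlMr// -ler_expR lnK ?posrE ?mulr_gt0//.
  rewrite -ler_pdivrMr//.
  apply: (@le_trans _ _ n%:R); last by rewrite ler_nat.
  by near: n; exact: nbhs_infty_ger.
Unshelve. all: by end_near. Qed.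

End mass.

Section exponential_functional.
Context d (T : measurableType d) (R : realType) (P : probability T R).
Variables (B : R -> {RV P >-> R}) (gamma m : R) (I : R -> R).
Hypotheses (hB : brownian_motion B) (gamma0 : 0 < gamma) (m0 : 0 < m).
Hypotheses (mI : measurable_fun (`[0, +oo[%classic : set R) I).
Hypotheses (I_ge0 : forall x, 0 <= x -> 0 <= I x).
Local Notation mu := (@lebesgue_measure R).

Let cZ w : {within `[0, +oo[, continuous (fun t => B t w - m * t)}.
Proof.
have [_ cB _ _] := hB.
move=> x; apply: cvgB; first exact: cB.
by apply: continuous_subspaceT => y; apply: cvgM => //; exact: cvg_cst.
Qed.

Let mf (a : R) : 0 <= a -> measurable_fun setT (fun z => (I (a * expR (gamma * z)))%:E).
Proof.
move=> a0; apply/measurable_EFinP; apply: (measurable_comp_ge0 mI) => [|x].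
  by apply: measurable_funM => //; apply: measurableT_comp => //; exact: measurable_funM.
by rewrite mulr_ge0 ?expR_ge0.
Qed.

Let f0 (a z : R) : 0 <= a -> (0 <= (I (a * expR (gamma * z)))%:E)%E.
Proof. by move=> a0; rewrite lee_fin I_ge0// mulr_ge0 ?expR_ge0. Qed.

Lemma exp_functional_ge0 a w : 0 <= a -> (0 <= exp_functional B gamma m I a w)%E.
Proof. by move=> a0; apply: integral_ge0 => t _; exact: f0. Qed.

(** Joint measurability in the starting point and the path, with respect to any
    sigma-algebra that makes the path measurable; independence is applied to
    such sigma-algebras. *)
Lemma measurable_exp_functional (F : set (T -> R)) d' (T' : measurableType d') (a : T' -> R) :
  (forall t, 0 <= t -> F (B t)) -> measurable_fun setT a -> (forall x, 0 <= a x) ->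
  measurable_fun setT (fun p : T' * gen_by F => exp_functional B gamma m I (a p.1) p.2).
Proof.
move=> hF ma a0.
pose Z t (w : gen_by F) := B t w - m * t.
have mY : measurable_fun setT (fun p : R * gen_by F => Z (Num.max p.1 0) p.2).
  apply: (@measurable_continuous_process _ (gen_by F) R (fun t w => Z (Num.max t 0) w)) => [t|w].
    apply: measurable_funB => //; apply: measurable_gen_by; apply: hF.
    by rewrite le_max lexx orbT.
  apply: (@continuous_max0 R (fun t => Z t w)); exact: cZ.
pose g (p : R * (T' * gen_by F)) :=
  (I (a p.2.1 * expR (gamma * Z (Num.max p.1 0) p.2.2)))%:E.
have -> : (fun p : T' * gen_by F => exp_functional B gamma m I (a p.1) p.2) =
    (fun p => \int[mu]_(t in `]0%R, +oo[) g (t, p))%E.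
  apply/funext => p; rewrite /exp_functional.
  exact: (integral_timeE (Z := fun t w => B t w - m * t) p.2 cZ (mf (a0 p.1))).
apply: measurable_integral_on => //.
- apply/measurable_EFinP; apply: (measurable_comp_ge0 mI) => [|p]; last first.
    by rewrite mulr_ge0 ?expR_ge0.
  apply: measurable_funM.
    apply: (measurableT_comp ma); apply: (measurableT_comp measurable_fst).
    exact: measurable_snd.
  apply: measurableT_comp => //; apply: measurable_funM => //.
  apply: (measurableT_comp mY (measurable_fun_pair _ _)); first exact: measurable_fst.
  by apply: (measurableT_comp measurable_snd); exact: measurable_snd.
- by move=> p; exact: f0.
Qed.

Lemma expectation_exp_functional a : I 0 = 0 -> 0 <= a ->
  (\int[P]_w exp_functional B gamma m I a w)%E = mass gamma m I a.
Proof.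
move=> I00 a0; rewrite /exp_functional.
rewrite (@drifted_occupation _ _ _ _ _ _ (fun z => (I (a * expR (gamma * z)))%:E) hB m0)//; last 2 first.
- exact: mf.
- by move=> z; exact: f0.
rewrite /mass; case: ifPn => [ap|]; last first.
  rewrite -leNgt => a0'; apply: integral0_eq => z _.
  by rewrite (_ : a = 0) ?mul0r ?I00 ?mul0e//; apply/le_anti/andP.
rewrite -[RHS](@ge0_integral_translation R _ (ln a / gamma)).
- apply: eq_integral => z _; rewrite -EFinM addrK; congr EFin.
  rewrite (_ : expR (gamma * (z + _)) = a * expR (gamma * z)); first by ring.
  rewrite mulrDr expRD [gamma * (_ / _)]mulrC divfK ?gt_eqF// lnK ?posrE// mulrC//.
- apply/measurable_EFinP; apply: measurable_funM.
    apply: measurable_funM => //; apply: (measurable_comp_ge0 mI) => [|x]; last exact: expR_ge0.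
    by apply: measurableT_comp => //; exact: measurable_funM.
  apply: measurableT_comp => //; apply: measurableT_comp => //.
  by apply: measurable_funM => //; apply: measurable_maxr => //; exact: measurable_funB.
- move=> z; rewrite lee_fin mulr_ge0 ?expR_ge0// mulr_ge0 ?I_ge0 ?expR_ge0//.
  by rewrite invr_ge0 ltW.
Qed.

Lemma measurable_mass d' (T' : measurableType d') (a : T' -> R) : I 0 = 0 ->
  measurable_fun setT a -> (forall x, 0 <= a x) ->
  measurable_fun setT (fun x => mass gamma m I (a x)).
Proof.
move=> I00 ma a0.
have -> : (fun x => mass gamma m I (a x)) =
    (fun x => \int[P]_w exp_functional B gamma m I (a x) w)%E.
  by apply/funext => x; rewrite expectation_exp_functional.
pose F : set (T -> R) := range (fun t => B t : T -> R).
have mid : measurable_fun setT (id : T -> gen_by F).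
  by apply: measurable_to_gen_by => _ [t _ <-]; exact: measurable_funPT.
apply: (@measurable_fun_fubini_tonelli_F _ _ T' T R P
  (fun p => exp_functional B gamma m I (a p.1) p.2)).
- apply: (measurableT_comp (@measurable_exp_functional F _ T' a _ ma a0)
    (measurable_fun_pair measurable_fst (measurableT_comp mid measurable_snd))).
  by move=> t _; exists t.
- by move=> p; exact: exp_functional_ge0.
Qed.

End exponential_functional.

(** The occupation densities of the two processes are [m^-1] times [escape m z] and
    [1 - escape m z]. *)
Lemma c_constE d (T : measurableType d) (R : realType) (P : probability T R)
    d' (T' : measurableType d') (P' : probability T' R)
    (W : R -> {RV P >-> R}) (X : R -> {RV P' >-> R}) (gamma m : R) (I : R -> R) :
  brownian_motion W -> 0 < m -> conditioned_nonneg m W X ->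
  measurable_fun (`[0, +oo[%classic : set R) I -> (forall x, 0 <= x -> 0 <= I x) ->
  (pi%:E * c_const W X gamma m I)%E = total_mass gamma m I.
Proof.
move=> hW m0 hX mI I0.
rewrite /c_const muleA -EFinM mulfV ?gt_eqF ?pi_gt0// mul1e.
have mf : measurable_fun setT (fun z : R => (I (expR (gamma * z)))%:E).
  apply/measurable_EFinP; apply: (measurable_comp_ge0 mI) => [|x]; last exact: expR_ge0.
  by apply: measurableT_comp => //; exact: measurable_funM.
have f0 (z : R) : (0 <= (I (expR (gamma * z)))%:E)%E by rewrite lee_fin I0// expR_ge0.
rewrite (conditioned_occupation hW m0 hX mf f0) (drifted_occupation hW m0 mf f0).
have m1 : 0 <= m^-1 by rewrite invr_ge0 ltW.
rewrite -ge0_integralD//.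
- apply: eq_integral => z _; rewrite -!EFinM -EFinD /escape; congr EFin; ring.
- by move=> z _; rewrite -EFinM lee_fin !mulr_ge0 ?escape_ge0 ?I0 ?expR_ge0// ltW.
- apply: emeasurable_funM => //; apply/measurable_EFinP; apply: measurable_funM => //.
  exact: (blip_measurable (blip_escape (ltW m0))).
- by move=> z _; rewrite -EFinM lee_fin !mulr_ge0 ?I0 ?expR_ge0.
- apply: emeasurable_funM => //; apply/measurable_EFinP; apply: measurable_funM => //.
  apply: measurableT_comp => //; apply: measurableT_comp => //.
  by apply: measurable_funM => //; exact: measurable_maxr.
Qed.

(** * Independence and passage to the limit *)

Lemma integral_independent_families d (T : measurableType d) (R : realType)
    (P : probability T R) (F G : set (T -> R)) (g : T * T -> \bar R) :
  (forall f, F f -> measurable_fun setT f) -> (forall f, G f -> measurable_fun setT f) ->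
  independent_families P (sigma_generated F) (sigma_generated G) ->
  measurable_fun setT (g : gen_by F * gen_by G -> \bar R) -> (forall p, 0 <= g p)%E ->
  (\int[P]_w g (w, w) = \int[P]_w \int[P]_v g (w, v))%E.
Proof.
move=> mF mG FG mg g0.
apply: (@integral_independent _ _ _ P _ (gen_by F) _ (gen_by G) id id g) => //.
- exact: measurable_to_gen_by.
- exact: measurable_to_gen_by.
Qed.

(** A sequence of lower bounds that tends to an upper bound forces the limit along
    any filter; this turns a monotone limit along the integers into a limit in
    one or several real variables. *)
Lemma cvg_from_below (R : realType) (X : Type) (G : set_system X) (FG : Filter G)
    (F : X -> \bar R) (u : nat -> \bar R) (L : \bar R) :
  L \is a fin_num -> (forall n, 0 <= u n)%E -> u n @[n --> \oo] --> L ->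
  (forall n, \forall x \near G, (u n <= F x <= L)%E) ->
  F x @[x --> G] --> L.
Proof.
move=> finL u0 uL uF.
have Ffin n x : (u n <= F x <= L)%E -> F x \is a fin_num.
  move=> /andP[uFx FL]; rewrite ge0_fin_numE ?(le_trans (u0 n))//.
  by rewrite (le_lt_trans FL)// ltey_eq finL.
rewrite -(fineK finL); apply/fine_cvgP; split.
  by apply: filterS (uF 0%N) => x; exact: Ffin.
apply/cvgrPdist_le => e e0.
have [N _ uN] : \forall n \near \oo, u n \is a fin_num /\ `|fine L - fine (u n)| <= e.
  rewrite -(fineK finL) in uL; have /fine_cvgP[ufin ufL] := uL.
  by near=> n; split; near: n => //; move/cvgrPdist_le : ufL; exact.
have [ufin uLN] := uN N (leqnn N).
apply: filterS (uF N) => x uFL; have Fx := Ffin _ _ uFL.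
move: uFL; rewrite -(fineK ufin) -(fineK Fx) -(fineK finL) !lee_fin => /andP[h1 h2].
rewrite ger0_norm ?subr_ge0// (le_trans _ uLN)// (le_trans _ (ler_norm _))//.
by rewrite lerB.
Unshelve. all: by end_near. Qed.

(** Monotone convergence; the limit of [u] only matters where [E] is positive. *)
Lemma cvg_integral_weighted d (T : measurableType d) (R : realType) (P : probability T R)
    (E : T -> R) (u : nat -> T -> \bar R) (K : \bar R) :
  measurable_fun setT E -> (forall w, 0 <= E w) ->
  (forall n, measurable_fun setT (u n)) -> (forall n w, 0 <= u n w)%E ->
  (forall w, {homo (fun n => u n w) : n k / (n <= k)%N >-> (n <= k)%E}) ->
  (0 <= K)%E -> {ae P, forall w, 0 < E w -> u n w @[n --> \oo] --> K} ->
  (\int[P]_w ((E w)%:E * u n w))%E @[n --> \oo] --> (K * \int[P]_w (E w)%:E)%E.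
Proof.
move=> mE E0 mu u0 ndu K0 uK.
have mEE : measurable_fun setT (fun w => (E w)%:E) by exact/measurable_EFinP.
have mEu n : measurable_fun setT (fun w => (E w)%:E * u n w)%E by exact: emeasurable_funM.
have Eu0 n w : (0 <= (E w)%:E * u n w)%E by rewrite mule_ge0 ?lee_fin.
have ndEu w : {homo (fun n => (E w)%:E * u n w)%E : n k / (n <= k)%N >-> (n <= k)%E}.
  by move=> n k nk; rewrite lee_wpmul2l ?lee_fin ?ndu.
have := @cvg_monotone_convergence _ T R P setT measurableT
  (fun n w => (E w)%:E * u n w)%E mEu (fun n w _ => Eu0 n w) (fun w _ => ndEu w).
rewrite (_ : \int[P]_w limn _ = K * \int[P]_w (E w)%:E)%E//.
rewrite -ge0_integralZl//; last by move=> w _; rewrite lee_fin.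
apply: ae_eq_integral => //.
- apply: (emeasurable_fun_cvg (fun n w => (E w)%:E * u n w)%E) => // w _.
  exact: ereal_nondecreasing_is_cvgn.
- exact: emeasurable_funM.
apply: filterS uK => w uKw _.
have [Ew|Ew] := ltP 0 (E w).
  by rewrite muleC; apply/cvg_lim => //; apply: cvgeZl => //; exact: uKw.
rewrite (_ : E w = 0); last by apply/le_anti; rewrite Ew E0.
rewrite mule0; apply/cvg_lim => //; apply: cvg_near_cst; apply: nearW => n.
by rewrite mul0e.
Qed.

Section weighted_functionals.
Context (R : realType) d (T : measurableType d) (P : probability T R).
Variables (B1 B2 : R -> {RV P >-> R}) (E0 E1 E2 : {RV P >-> R}).
Variables (m1 m2 gamma1 gamma2 : R) (I1 I2 : R -> R).
Hypotheses (hB1 : brownian_motion B1) (hB2 : brownian_motion B2).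
Hypothesis hB12 : independent_families P
  (sigma_process `[0, +oo[ B1) (sigma_process `[0, +oo[ B2).
Let FE := [set (E0 : T -> R); (E1 : T -> R); (E2 : T -> R)].
Let FB1 := [set (B1 t : T -> R) | t in `[0, +oo[].
Let FB2 := [set (B2 t : T -> R) | t in `[0, +oo[].
Hypothesis hEB : independent_families P (sigma_generated FE)
  (sigma_generated (FB1 `|` FB2)).
Hypotheses (hE0 : forall w, 0 <= E0 w) (hE1 : forall w, 0 <= E1 w)
  (hE2 : forall w, 0 <= E2 w).
Hypotheses (hm1 : 0 < m1) (hm2 : 0 < m2) (hgamma1 : 0 < gamma1) (hgamma2 : 0 < gamma2).
Hypotheses (mI1 : measurable_fun (`[0, +oo[%classic : set R) I1)
  (mI2 : measurable_fun (`[0, +oo[%classic : set R) I2).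
Hypotheses (hI1 : forall x, 0 <= x -> 0 <= I1 x) (hI2 : forall x, 0 <= x -> 0 <= I2 x).
Hypotheses (I10 : I1 0 = 0) (I20 : I2 0 = 0).

Let J1 := exp_functional B1 gamma1 m1 I1.
Let J2 := exp_functional B2 gamma2 m2 I2.
Let u1 := mass gamma1 m1 I1.
Let u2 := mass gamma2 m2 I2.

Let mFE f : FE f -> measurable_fun setT f.
Proof. by move=> [[->|->]|->]; exact: measurable_funPT. Qed.

Let mFB1 f : FB1 f -> measurable_fun setT f.
Proof. by move=> [t _ <-]; exact: measurable_funPT. Qed.

Let mFB2 f : FB2 f -> measurable_fun setT f.
Proof. by move=> [t _ <-]; exact: measurable_funPT. Qed.

Let mFB f : (FB1 `|` FB2) f -> measurable_fun setT f.
Proof. by move=> [/mFB1|/mFB2]. Qed.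

Let FB1t t : 0 <= t -> FB1 (B1 t). Proof. by move=> t0; exists t => //=; rewrite in_itv/= t0. Qed.

Let FB2t t : 0 <= t -> FB2 (B2 t). Proof. by move=> t0; exists t => //=; rewrite in_itv/= t0. Qed.

Let FBt1 t : 0 <= t -> (FB1 `|` FB2) (B1 t). Proof. by move=> t0; left; exact: FB1t. Qed.

Let FBt2 t : 0 <= t -> (FB1 `|` FB2) (B2 t). Proof. by move=> t0; right; exact: FB2t. Qed.

Let a1 l w := l * E1 w.
Let a2 l w := l * E2 w.

Let ma1 l : measurable_fun setT (a1 l : gen_by FE -> R).
Proof. by apply: measurable_funM => //; apply: measurable_gen_by; left; right. Qed.

Let ma2 l : measurable_fun setT (a2 l : gen_by FE -> R).
Proof. by apply: measurable_funM => //; apply: measurable_gen_by; right. Qed.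

Let mE0 : measurable_fun setT (E0 : gen_by FE -> R).
Proof. by apply: measurable_gen_by; left; left. Qed.

Let a1_ge0 l w : 0 <= l -> 0 <= a1 l w. Proof. by move=> l0; rewrite mulr_ge0. Qed.

Let a2_ge0 l w : 0 <= l -> 0 <= a2 l w. Proof. by move=> l0; rewrite mulr_ge0. Qed.

Let mJ1 l : 0 <= l ->
  measurable_fun setT (fun p : gen_by FE * gen_by (FB1 `|` FB2) => J1 (a1 l p.1) p.2).
Proof. by move=> l0; apply: measurable_exp_functional => // w; exact: a1_ge0. Qed.

Let mJ2 l : 0 <= l ->
  measurable_fun setT (fun p : gen_by FE * gen_by (FB1 `|` FB2) => J2 (a2 l p.1) p.2).
Proof. by move=> l0; apply: measurable_exp_functional => // w; exact: a2_ge0. Qed.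

Let mE0E : measurable_fun setT (fun p : gen_by FE * gen_by (FB1 `|` FB2) => (E0 p.1)%:E).
Proof. by apply/measurable_EFinP; apply: (measurableT_comp mE0); exact: measurable_fst. Qed.

Let mJ1a (a : R) : 0 <= a -> measurable_fun setT (J1 a : gen_by FB1 -> \bar R).
Proof.
move=> a0; have := measurable_exp_functional gamma1 m1 hB1 mI1 hI1 FB1t
  (@measurable_cst _ _ (measurableTypeR R) R setT a) (fun _ => a0).
by move=> h; exact: (measurableT_comp h (pair1_measurable (0 : measurableTypeR R))).
Qed.

Let mJ2a (a : R) : 0 <= a -> measurable_fun setT (J2 a : gen_by FB2 -> \bar R).
Proof.
move=> a0; have := measurable_exp_functional gamma2 m2 hB2 mI2 hI2 FB2t
  (@measurable_cst _ _ (measurableTypeR R) R setT a) (fun _ => a0).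
by move=> h; exact: (measurableT_comp h (pair1_measurable (0 : measurableTypeR R))).
Qed.

Let mJ1T (a : R) : 0 <= a -> measurable_fun setT (J1 a).
Proof. by move=> a0; apply: (measurableT_comp (mJ1a a0)); exact: measurable_to_gen_by. Qed.

Let mJ2T (a : R) : 0 <= a -> measurable_fun setT (J2 a).
Proof. by move=> a0; apply: (measurableT_comp (mJ2a a0)); exact: measurable_to_gen_by. Qed.

Let J1_ge0 a w : 0 <= a -> (0 <= J1 a w)%E.
Proof. by move=> a0; exact: exp_functional_ge0. Qed.

Let J2_ge0 a w : 0 <= a -> (0 <= J2 a w)%E.
Proof. by move=> a0; exact: exp_functional_ge0. Qed.

Let u1_ge0 a : (0 <= u1 a)%E. Proof. exact: mass_ge0. Qed.

Let u2_ge0 a : (0 <= u2 a)%E. Proof. exact: mass_ge0. Qed.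

Let integral_J1 a : 0 <= a -> (\int[P]_w J1 a w)%E = u1 a.
Proof. by move=> a0; exact: expectation_exp_functional. Qed.

Let integral_J2 a : 0 <= a -> (\int[P]_w J2 a w)%E = u2 a.
Proof. by move=> a0; exact: expectation_exp_functional. Qed.

(** For deterministic starting points the two functionals are independent. *)
Let integral_J1J2 a b : 0 <= a -> 0 <= b ->
  (\int[P]_w (J1 a w * J2 b w))%E = (u1 a * u2 b)%E.
Proof.
move=> a0 b0.
rewrite (@integral_independent_families _ T R P FB1 FB2 (fun p => J1 a p.1 * J2 b p.2)%E)//=.
- under eq_integral => w _ do rewrite (ge0_integralZl P measurableT (mJ2T b0)
    (fun v _ => J2_ge0 v b0) (J1_ge0 w a0)) integral_J2//.
  by rewrite (ge0_integralZr P measurableT (mJ1T a0) (fun v _ => J1_ge0 v a0) (u2_ge0 b)) integral_J1.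
- apply: emeasurable_funM.
    by apply: (measurableT_comp (mJ1a a0)); exact: measurable_fst.
  by apply: (measurableT_comp (mJ2a b0)); exact: measurable_snd.
- by move=> p; rewrite mule_ge0 ?J1_ge0 ?J2_ge0.
Qed.

Lemma integral_weighted_single l : 0 <= l ->
  (\int[P]_w ((E0 w)%:E * J1 (l * E1 w) w) = \int[P]_w ((E0 w)%:E * u1 (l * E1 w)))%E.
Proof.
move=> l0.
rewrite (@integral_independent_families _ T R P FE (FB1 `|` FB2)
  (fun p => (E0 p.1)%:E * J1 (a1 l p.1) p.2)%E)//=.
- apply: eq_integral => w _; rewrite ge0_integralZl ?integral_J1 ?a1_ge0 ?lee_fin//.
  + by apply: mJ1T; exact: a1_ge0.
  + by move=> v _; apply: J1_ge0; exact: a1_ge0.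
- by apply: emeasurable_funM => //; exact: mJ1.
- by move=> p; rewrite mule_ge0 ?J1_ge0 ?a1_ge0 ?lee_fin.
Qed.

(** Independence of the weights and the pair of motions freezes the starting points,
    after which the independence of the motions applies. *)
Lemma integral_weighted_product l1 l2 : 0 <= l1 -> 0 <= l2 ->
  (\int[P]_w ((E0 w)%:E * (J1 (l1 * E1 w) w * J2 (l2 * E2 w) w)) =
   \int[P]_w ((E0 w)%:E * (u1 (l1 * E1 w) * u2 (l2 * E2 w))))%E.
Proof.
move=> l10 l20.
rewrite (@integral_independent_families _ T R P FE (FB1 `|` FB2)
  (fun p => (E0 p.1)%:E * (J1 (a1 l1 p.1) p.2 * J2 (a2 l2 p.1) p.2))%E)//=.
- apply: eq_integral => w _; rewrite ge0_integralZl ?integral_J1J2 ?a1_ge0 ?a2_ge0 ?lee_fin//.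
  + by apply: emeasurable_funM; [apply: mJ1T; exact: a1_ge0|apply: mJ2T; exact: a2_ge0].
  + by move=> v _; rewrite mule_ge0 ?J1_ge0 ?J2_ge0 ?a1_ge0 ?a2_ge0.
- by apply: emeasurable_funM => //; apply: emeasurable_funM; [exact: mJ1|exact: mJ2].
- by move=> p; rewrite !mule_ge0 ?J1_ge0 ?J2_ge0 ?a1_ge0 ?a2_ge0 ?lee_fin.
Qed.

End weighted_functionals.

(** * Bounds and limits of the weighted functionals *)

Lemma le_integral_weighted d (T : measurableType d) (R : realType) (P : probability T R)
    (E : T -> R) (u v : T -> \bar R) :
  measurable_fun setT E -> (forall w, 0 <= E w) ->
  measurable_fun setT u -> measurable_fun setT v -> (forall w, 0 <= u w)%E ->
  (forall w, u w <= v w)%E ->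
  (\int[P]_w ((E w)%:E * u w) <= \int[P]_w ((E w)%:E * v w))%E.
Proof.
move=> mE E0 mu mv u0 uv.
have mEE : measurable_fun setT (fun w => (E w)%:E) by exact/measurable_EFinP.
apply: ge0_le_integral => //.
- by move=> w _; rewrite mule_ge0 ?lee_fin.
- exact: emeasurable_funM.
- exact: emeasurable_funM.
- by move=> w _; rewrite lee_wpmul2l ?lee_fin.
Qed.

Lemma integral_weighted_cst d (T : measurableType d) (R : realType) (P : probability T R)
    (E : T -> R) (K : \bar R) :
  measurable_fun setT E -> (forall w, 0 <= E w) -> (0 <= K)%E ->
  (\int[P]_w ((E w)%:E * K) = K * \int[P]_w (E w)%:E)%E.
Proof.
move=> mE E0 K0; rewrite ge0_integralZr//; first by rewrite muleC.
- exact/measurable_EFinP.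
- by move=> w _; rewrite lee_fin.
Qed.

Theorem lemma2p11 (R : realType)
  (d : measure_display) (T : measurableType d) (P : probability T R)
  (B1 B2 : R -> {RV P >-> R}) (E0 E1 E2 : {RV P >-> R})
  (* realisations of the processes that enter the constants c *)
  (d0 : measure_display) (S0 : measurableType d0) (Q0 : probability S0 R)
  (W : R -> {RV Q0 >-> R})
  (d1 : measure_display) (S1 : measurableType d1) (Q1 : probability S1 R)
  (X1 : R -> {RV Q1 >-> R})
  (d2 : measure_display) (S2 : measurableType d2) (Q2 : probability S2 R)
  (X2 : R -> {RV Q2 >-> R})
  (m1 m2 gamma1 gamma2 : R) (I1 I2 : R -> R)
  (hB1 : brownian_motion B1) (hB2 : brownian_motion B2)
  (hB12 : independent_families P
            (sigma_process `[0, +oo[ B1) (sigma_process `[0, +oo[ B2))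
  (hEB : independent_families P
           (sigma_generated [set (E0 : T -> R); (E1 : T -> R); (E2 : T -> R)])
           (sigma_generated ([set (B1 t : T -> R) | t in `[0, +oo[] `|`
                             [set (B2 t : T -> R) | t in `[0, +oo[])))
  (hE0 : forall w, 0 <= E0 w) (hE1 : forall w, 0 <= E1 w)
  (hE2 : forall w, 0 <= E2 w)
  (hE0fin : ('E_P[E0] < +oo)%E)
  (hm1 : 0 < m1) (hm2 : 0 < m2) (hgamma1 : 0 < gamma1) (hgamma2 : 0 < gamma2)
  (hI1meas : measurable_fun (`[0, +oo[%classic : set R) I1)
  (hI2meas : measurable_fun (`[0, +oo[%classic : set R) I2)
  (hI1 : forall x, 0 <= x -> 0 <= I1 x) (hI2 : forall x, 0 <= x -> 0 <= I2 x)
  (hI10 : I1 0 = 0) (hI20 : I2 0 = 0)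
  (hW : brownian_motion W)
  (hX1 : conditioned_nonneg m1 W X1) (hX2 : conditioned_nonneg m2 W X2)
  (hc1 : (c_const W X1 gamma1 m1 I1 < +oo)%E)
  (hc2 : (c_const W X2 gamma2 m2 I2 < +oo)%E) :
  let J1 (l : R) (w : T) := exp_functional B1 gamma1 m1 I1 (l * E1 w) w in
  let J2 (l : R) (w : T) := exp_functional B2 gamma2 m2 I2 (l * E2 w) w in
  let pic1 := (pi%:E * c_const W X1 gamma1 m1 I1)%E in
  let pic2 := (pi%:E * c_const W X2 gamma2 m2 I2)%E in
  (forall l1 l2 : R, 0 < l1 -> 0 < l2 ->
     (\int[P]_w ((E0 w)%:E * J1 l1 w) <= pic1 * 'E_P[E0])%E /\
     (\int[P]_w ((E0 w)%:E * (J1 l1 w * J2 l2 w))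
        <= (pic1 * pic2) * 'E_P[E0])%E)
  /\
  (* the limits require E1 (resp. E1 and E2) to be a.s. positive where E0 is *)
  ({ae P, forall w, 0 < E0 w -> 0 < E1 w} ->
     ((\int[P]_w ((E0 w)%:E * J1 l1 w))%E @[l1 --> +oo]
        --> (pic1 * 'E_P[E0])%E)
     /\
     ({ae P, forall w, 0 < E0 w -> 0 < E2 w} ->
        (\int[P]_w ((E0 w)%:E * (J1 l.1 w * J2 l.2 w)))%E
          @[l --> filter_prod (pinfty_nbhs R) (pinfty_nbhs R)]
        --> (pic1 * pic2 * 'E_P[E0])%E)).

Proof.
move=> J1 J2 pic1 pic2.
have mE0 : measurable_fun setT E0 by exact: measurable_funPT.
pose K1 := total_mass gamma1 m1 I1; pose K2 := total_mass gamma2 m2 I2.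
have pic1E : pic1 = K1 by exact: c_constE.
have pic2E : pic2 = K2 by exact: c_constE.
have K1_ge0 : (0 <= K1)%E by exact: total_mass_ge0.
have K2_ge0 : (0 <= K2)%E by exact: total_mass_ge0.
have pi_pos : (0 <= (pi : R)%:E)%E by rewrite lee_fin pi_ge0.
have K1_fin : K1 \is a fin_num.
  rewrite (ge0_fin_numE K1_ge0) -pic1E.
  exact: (@lte_mul_pinfty R pi%:E _ pi_pos isT hc1).
have K2_fin : K2 \is a fin_num.
  rewrite (ge0_fin_numE K2_ge0) -pic2E.
  exact: (@lte_mul_pinfty R pi%:E _ pi_pos isT hc2).
have EE0 : ('E_P[E0] = \int[P]_w (E0 w)%:E)%E by rewrite unlock.
have EE0_fin : (\int[P]_w (E0 w)%:E)%E \is a fin_num.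
  rewrite ge0_fin_numE -?EE0// EE0; apply: integral_ge0 => w _.
  by rewrite lee_fin.
pose u1 l w := mass gamma1 m1 I1 (l * E1 w).
pose u2 l w := mass gamma2 m2 I2 (l * E2 w).
have mu1 l : 0 <= l -> measurable_fun setT (u1 l).
  move=> l0; apply: (measurable_mass hB1) => // [|w]; last exact: mulr_ge0.
  exact: measurable_funM.
have mu2 l : 0 <= l -> measurable_fun setT (u2 l).
  move=> l0; apply: (measurable_mass hB2) => // [|w]; last exact: mulr_ge0.
  exact: measurable_funM.
have u1_ge0 l w : (0 <= u1 l w)%E by exact: mass_ge0.
have u2_ge0 l w : (0 <= u2 l w)%E by exact: mass_ge0.
have u1_le l w : (u1 l w <= K1)%E by exact: mass_le.
have u2_le l w : (u2 l w <= K2)%E by exact: mass_le.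
have le_u1 l k w : l <= k -> (u1 l w <= u1 k w)%E.
  by move=> lk; apply: le_mass => //; rewrite ler_wpM2r.
have le_u2 l k w : l <= k -> (u2 l w <= u2 k w)%E.
  by move=> lk; apply: le_mass => //; rewrite ler_wpM2r.
have single l : 0 <= l ->
    (\int[P]_w ((E0 w)%:E * J1 l w) = \int[P]_w ((E0 w)%:E * u1 l w))%E.
  by move=> l0; exact: (integral_weighted_single hB1 hEB hE0 hE1 hm1 hgamma1 hI1meas hI1 hI10 l0).
have product l k : 0 <= l -> 0 <= k ->
    (\int[P]_w ((E0 w)%:E * (J1 l w * J2 k w)) =
     \int[P]_w ((E0 w)%:E * (u1 l w * u2 k w)))%E.
  by move=> l0 k0; exact: (integral_weighted_product hB1 hB2 hB12 hEB hE0 hE1 hE2 hm1 hm2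
    hgamma1 hgamma2 hI1meas hI2meas hI1 hI2 hI10 hI20 l0 k0).
have n0 n : 0 <= n.+1%:R :> R by [].
have cvg_u1 w : 0 < E1 w -> u1 n.+1%:R w @[n --> \oo] --> K1.
  by move=> E1w; exact: cvg_mass.
have cvg_u2 w : 0 < E2 w -> u2 n.+1%:R w @[n --> \oo] --> K2.
  by move=> E2w; exact: cvg_mass.
rewrite pic1E pic2E EE0.
(* from here on only monotonicity, the bounds and the limits of [u1], [u2] matter *)
clearbody J1 J2 u1 u2.
clear hc1 hc2 pic1E pic2E pic1 pic2 hX1 hX2.
clearbody K1 K2.
have mu12 l k : 0 <= l -> 0 <= k -> measurable_fun setT (fun w => u1 l w * u2 k w)%E.
  by move=> l0 k0; apply: emeasurable_funM; [exact: mu1|exact: mu2].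
have u12_ge0 l k w : (0 <= u1 l w * u2 k w)%E by exact: mule_ge0.
have K12_ge0 : (0 <= K1 * K2)%E by exact: mule_ge0.
have single_le l : 0 <= l ->
    (\int[P]_w ((E0 w)%:E * u1 l w) <= K1 * \int[P]_w (E0 w)%:E)%E.
  move=> l0; rewrite -integral_weighted_cst//.
  by apply: le_integral_weighted => //; exact: mu1.
have product_le l k : 0 <= l -> 0 <= k ->
    (\int[P]_w ((E0 w)%:E * (u1 l w * u2 k w)) <= (K1 * K2) * \int[P]_w (E0 w)%:E)%E.
  move=> l0 k0; rewrite -integral_weighted_cst//.
  apply: le_integral_weighted => //; first exact: mu12.
  by move=> w; exact: lee_pmul.
split=> [l1 l2 /ltW l10 /ltW l20|E1_gt0].
  by rewrite single// product//; split; [exact: single_le|exact: product_le].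
split.
  apply: (@cvg_from_below _ _ _ _ _ (fun n => \int[P]_w ((E0 w)%:E * u1 n.+1%:R w))%E).
  - exact: fin_numM.
  - by move=> n; apply: integral_ge0 => w _; rewrite mule_ge0 ?lee_fin.
  - apply: cvg_integral_weighted => //.
    + by move=> n; exact: mu1.
    + by move=> w n k nk; apply: le_u1; rewrite ler_nat.
    + by apply: filterS E1_gt0 => w E1w /E1w; exact: cvg_u1.
  - move=> n; near=> l.
    have nl : n.+1%:R <= l by near: l; exact: nbhs_pinfty_ge.
    have l0 : 0 <= l by exact: le_trans nl.
    rewrite single// single_le// andbT.
    by apply: le_integral_weighted => //; [exact: mu1|exact: mu1|move=> w; exact: le_u1].
move=> E2_gt0.
apply: (@cvg_from_below _ _ _ _ _
  (fun n => \int[P]_w ((E0 w)%:E * (u1 n.+1%:R w * u2 n.+1%:R w)))%E).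
- by rewrite !fin_numM.
- by move=> n; apply: integral_ge0 => w _; rewrite mule_ge0 ?lee_fin.
- apply: (@cvg_integral_weighted _ _ _ _ _ (fun n w => u1 n.+1%:R w * u2 n.+1%:R w)%E) => //.
  + by move=> n; exact: mu12.
  + by move=> w n k nk; apply: lee_pmul => //; [apply: le_u1|apply: le_u2]; rewrite ler_nat.
  + apply: filterS2 E1_gt0 E2_gt0 => w E1w E2w E0w.
    apply: cvgeM; [|exact/cvg_u1/E1w|exact/cvg_u2/E2w].
    by rewrite mule_def_fin.
- move=> n; near=> l.
  have [nl1 nl2] : n.+1%:R <= l.1 /\ n.+1%:R <= l.2.
    near: l; exists ([set x | n.+1%:R <= x], [set x | n.+1%:R <= x]).
      by split; exact: nbhs_pinfty_ge.
    by move=> [x y] /=.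
  have l10 : 0 <= l.1 by exact: le_trans nl1.
  have l20 : 0 <= l.2 by exact: le_trans nl2.
  rewrite product// product_le// andbT.
  apply: le_integral_weighted => //; [exact: mu12|exact: mu12|move=> w].
  by apply: lee_pmul => //; [exact: le_u1|exact: le_u2].
Unshelve. all: by end_near. Qed.
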